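(* Let $\Bbbk$ be an algebraically closed field and $f\in\Bbbk[x_1,\dots,x_n]\setminus\Bbbk$. There exist a finite subset $E(f)\subset\Bbbk$ with $|E(f)|<\deg f$ and a positive integer $d$ such that the following hold. (1) For every $\mu\in\Bbbk\setminus E(f)$ one has $f+\mu=\alpha\cdot f_{\mu,1}\cdot f_{\mu,2}\cdots f_{\mu,k}$ with $\alpha\in\Bbbk^{\times}$ and $k\ge 1$, where all $f_{\mu,i}\in\Bbbk[x_1,\dots,x_n]$ are irreducible (not necessarily distinct) and $f_{\mu,i}-f_{\mu,j}\in\Bbbk$ for all $i,j$. (2) The factors in (1) can be chosen (simultaneously for all $\mu\notin E(f)$) so that moreover $f_{\mu,i}-f_{\nu,j}\in\Bbbk^{\times}$ for all $\mu,\nu\notin E(f)$ with $\nu\neq\mu$ and all $i,j$; in particular, the degree $\deg(f_{\mu,i})$ does not depend on $i$ and on $\mu\notin E(f)$, and it is equal to $d$. (3) For every $\mu\in\Bbbk$, each irreducible factor of $f+\mu$ has degree at most $d$. (4) For $\mu\in\Bbbk$ let $n(\mu,f)$ be the number of pairwise non-proportional irreducible factors of $f+\mu$ and let $s(\mu,f)$ be the sum of the degrees of these factors, each counted once (without multiplicity). Then $$\sum_{\mu\in\Bbbk}\Bigl(n(\mu,f)-\frac{\deg(f)}{d}\Bigr)<\min_{\mu\in\Bbbk} s(\mu,f).$$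
   Context: $\Bbbk^{\times}=\Bbbk\setminus\{0\}$. For every $\mu\in\Bbbk$ one writes $f+\mu=\alpha\prod_{i=1}^{n(\mu,f)}q_{\mu,i}^{d_{\mu,i}}$ with $\alpha\in\Bbbk^{\times}$, $d_{\mu,i}\ge1$, and pairwise non-proportional irreducible $q_{\mu,i}$; thus $s(\mu,f)=\sum_{i=1}^{n(\mu,f)}\deg(q_{\mu,i})$. In (4), only finitely many summands on the left are positive; if infinitely many summands are negative (which can occur only in positive characteristic), the sum is understood to be $-\infty$. *)

(* Defs.v *)
From mathcomp Require Import all_boot all_order all_algebra finmap.
From mathcomp Require Import mpoly.
From mathcomp Require Import boolp classical_sets cardinality fsbigop.
(* Notations left out: they clash with those of mpoly. *)
From mathcomp Require Import -(notations) constructive_ereal.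

Set Implicit Arguments.
Unset Strict Implicit.
Unset Printing Implicit Defensive.

Import Order.TTheory GRing.Theory Num.Theory.
Local Open Scope classical_set_scope.
Local Open Scope ring_scope.

Definition irreducible (R : idomainType) (p : R) : Prop :=
  [/\ p != 0, p \isn't a GRing.unit &
      forall a b : R, p = a * b ->
        a \is a GRing.unit \/ b \is a GRing.unit].

Section Polynomials.
Variables (K : closedFieldType) (n : nat).
Implicit Types (p q f : {mpoly K[n]}) (qs : seq {mpoly K[n]}) (mu : K).

(* [msize] is one more than the total degree of a nonzero polynomial. *)
Definition mdegree p : nat := (msize p).-1.

Definition is_scalar p : Prop := exists c : K, p = c%:MP.

Definition is_nzscalar p : Prop := exists2 c : K, c != 0 & p = c%:MP.

Definition proportional p q : Prop := exists2 c : K, c != 0 & p = c *: q.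

(* [qs] lists the q_i of a factorization p = alpha * \prod_i q_i ^+ d_i *)
Definition irr_factorization p qs : Prop :=
  [/\ {in qs, forall q, irreducible q},
      uniq qs,
      {in qs &, forall q r, q != r -> ~ proportional q r} &
      exists (alpha : K) (d : {mpoly K[n]} -> nat),
        [/\ alpha != 0, {in qs, forall q, (0 < d q)%N} &
            p = alpha *: \prod_(q <- qs) q ^+ d q]].

(* A nonzero [p] has such a factorization, unique up to the order of the q_i
   and to nonzero scalar factors; the default [::] serves only for p = 0. *)
Definition irr_factors p : seq {mpoly K[n]} :=
  xget [::] [set qs | irr_factorization p qs].

Definition nfactors mu f : nat := size (irr_factors (f + mu%:MP)).

Definition sfactors mu f : nat :=
  (\sum_(q <- irr_factors (f + mu%:MP)) mdegree q)%N.

Definition min_sfactors f : nat :=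
  ex_minn (P := fun m => `[< exists mu, sfactors mu f = m >])
    (ex_intro _ (sfactors 0 f) (asboolT (ex_intro _ 0 erefl))).

End Polynomials.

(* The sum of a family with finitely many positive terms: -oo when infinitely
   many terms are negative, and otherwise the sum over the finite support. *)
Definition sum_ninfty (I : choiceType) (g : I -> rat) :
    extended rat :=
  if `[< finite_set [set i | g i < 0] >]
  then EFin (\sum_(i \in [set: I]) g i)
  else ENInf rat.

(* Main.v *)
From HB Require Import structures.
Require Import Defs.
From mathcomp Require Import all_boot all_order all_fingroup all_algebra all_field finmap.
From mathcomp Require Import mpoly.
From mathcomp Require Import boolp classical_sets cardinality fsbigop.
From mathcomp Require Import -(notations) constructive_ereal.
From mathcomp Require Import ring lra zify.

(** Call a nonconstant polynomial h closed if every polynomial integral over K[h]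
    lies in K[h]. Luroth's theorem provides a closed h with f = F(h)
    ([monic_pencil_generator]): take h of least degree with f in K[h]. The fibres
    of f are products of fibres of h,
      f + mu = const * prod (h - c),   c ranging over the roots of F + mu,
    and d is the degree of h. With n(c) and s(c) the number of distinct prime
    factors of h - c and the sum of their degrees, everything follows from
      sum_c (n(c) - 1) < s(c0)   for every c0,
    the sum being over any finite set ([total_reducibility_bound]). Indeed a fibre
    of h with n(c) = 1 is irreducible ([fibre_irreducible]), so that fewer than
    deg h fibres are reducible, and the sum in (4) is at most
    sum_c (n(c) - 1) because F + mu has at most deg F distinct roots.

    The bound is classical: the prime factors of the fibres are units on the
    generic fibre h = t away from infinity, and the generic fibre has at most
    s(c0) points at infinity. The proof below makes this elementary. In suitable
    coordinates h is monic of degree deg h in one variable y; let x be the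
    others. Over K(t)(x), with the valuation minus the degree in x, extended to a
    splitting field, h(x, Y) = t has roots th_1, ..., th_d. To a prime factor q of
    some fibre attach the vector of the values of the q(th_i). Three facts are
    used.
    - The sum of the entries is 0, as it is the value of the norm of q
      ([sum_branches_divisor]).
    - Two roots th_i, th_j with the same nearest root of h(x, Y) = c0 give equal
      entries ([shared_closest_divisor]). As h - c0 has at most s(c0) distinct
      roots, the vectors span a space of dimension less than s(c0).
    - A product of prime factors whose vector is 0 is integral over K[h], hence
      in K[h], hence a product of fibres ([integral_of_nonneg]).
    If the bound failed, leaving out one prime factor of each fibre would still
    leave s(c0) prime factors, so an integer relation between their vectors; by
    the third fact it would give a multiplicative relation between these prime
    factors and the fibres, against unique factorization
    ([monic_total_reducibility_bound]). *)

Import Order.TTheory GRing.Theory Num.Theory.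
Local Open Scope classical_set_scope.
Local Open Scope ring_scope.

Set Implicit Arguments.
Unset Strict Implicit.
Unset Printing Implicit Defensive.

(** * Unique factorization *)
Definition divides {R : comNzRingType} (a b : R) : Prop := exists c, b = c * a.

Definition prime_elt (R : idomainType) (p : R) : Prop :=
  [/\ p != 0, p \isn't a GRing.unit &
      forall a b : R, divides p (a * b) -> divides p a \/ divides p b].

(** Phrased with primes rather than with irreducibles and uniqueness, because
    this is the form that passes to polynomial rings by induction. *)
Definition factorial_domain (R : idomainType) : Prop :=
  forall a : R, a != 0 ->
    exists (u : R) (s : seq R), [/\ u \is a GRing.unit, {in s, forall p : R, prime_elt p} &
                    a = u * \prod_(p <- s) p].

Lemma dividesD (R : comNzRingType) (a b c : R) :
  divides a b -> divides a c -> divides a (b + c).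
Proof. by case=> x -> [y ->]; exists (x + y); rewrite mulrDl. Qed.

Lemma divides_mull (R : comNzRingType) (a b c : R) :
  divides a b -> divides a (c * b).
Proof. by case=> x ->; exists (c * x); rewrite mulrA. Qed.

Lemma divides_mulr (R : comNzRingType) (a b c : R) :
  divides a b -> divides a (b * c).
Proof. by case=> x ->; exists (x * c); rewrite mulrAC. Qed.

Lemma divides_trans (R : comNzRingType) (a b c : R) :
  divides a b -> divides b c -> divides a c.
Proof. by case=> x -> [y ->]; exists (y * x); rewrite mulrA. Qed.

Lemma divides_refl (R : comNzRingType) (a : R) : divides a a.
Proof. by exists 1; rewrite mul1r. Qed.

Lemma prime_prod (R : idomainType) (p : R) (I : eqType) (s : seq I) (F : I -> R) :
  prime_elt p -> divides p (\prod_(i <- s) F i) ->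
  exists2 i, i \in s & divides p (F i).
Proof.
case=> _ pU pP; elim: s => [|i s IH].
  by rewrite big_nil => -[c] /esym/(congr1 (fun x => x \is a GRing.unit));
     rewrite unitrM unitr1 (negbTE pU) andbF.
rewrite big_cons => /pP[pi|/IH[j js pj]].
  by exists i; rewrite ?mem_head.
by exists j; rewrite // inE js orbT.
Qed.

Lemma prime_exp (R : idomainType) (p a : R) k :
  prime_elt p -> divides p (a ^+ k) -> divides p a.
Proof.
move=> pP; rewrite -[k]card_ord -prodr_const.
by rewrite -big_enum /= => /(prime_prod pP)[].
Qed.

Lemma factorial_irreducible_prime (R : idomainType) (p : R) :
  factorial_domain R -> irreducible p -> prime_elt p.
Proof.
move=> fR [p0 pU pP]; have [u [s [uU sP pE]]] := fR _ p0.
case: s sP pE => [|q s] sP pE.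
  by rewrite pE big_nil mulr1 uU in pU.
have qP := sP q (mem_head _ _); have [q0 qU qD] := qP.
move: pE; rewrite big_cons mulrCA => pE.
have := pP _ _ pE; rewrite (negbTE qU) => -[//|wU].
set w := u * _ in pE wU; split=> // a b [c abE].
have pq d : divides q d -> divides p d.
  by case=> x ->; exists (x / w); rewrite pE mulrCA -mulrA mulVr ?mulr1 1?mulrC.
have /qD[/pq|/pq] : divides q (a * b); [|by left|by right].
by exists (c * w); rewrite abE pE mulrAC mulrA.
Qed.

Lemma divides_polyC (R : idomainType) (c : R) (p : {poly R}) :
  divides c%:P p <-> forall i, divides c p`_i.
Proof.
split=> [[q ->] i|cp]; first by exists q`_i; rewrite coefMC.
have [q qE] := choice cp.
exists (\poly_(i < size p) q i); apply/polyP=> i.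
by rewrite coefMC coef_poly; case: ltnP => [_|/(nth_default 0)->];
   rewrite ?mul0r // -qE.
Qed.

(** Cancel leading terms: if [p] divides [f * g], it divides one of the leading
    coefficients, and that leading term can be removed. *)
Lemma polyC_prime (R : idomainType) (p : R) :
  prime_elt p -> prime_elt p%:P.
Proof.
move=> pP; have [p0 pU pD] := pP; split; rewrite ?polyC_eq0 ?polyCE //.
  by rewrite poly_unitE coefC eqxx (negbTE pU) andbF.
have split_lead (f : {poly R}) : f != 0 -> exists2 g : {poly R},
  f = g + (lead_coef f)%:P * 'X ^+ (size f).-1 & (size g < size f)%N.
  move=> f0; exists (\poly_(i < (size f).-1) f`_i); last first.
    by rewrite (leq_ltn_trans (size_poly _ _)) // prednK // size_poly_gt0.
  rewrite {1}[f](esym (coefK _)) poly_def -[in LHS](@prednK (size f)) ?size_poly_gt0 //.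
  by rewrite big_ord_recr /= -poly_def -lead_coefE mul_polyC.
have lead_dvd (f : {poly R}) k : divides p (lead_coef f) ->
    divides p%:P ((lead_coef f)%:P * 'X^k).
  by case=> c ->; exists (c%:P * 'X^k); rewrite polyCM mulrAC.
have cancelD a b : divides p%:P (a + b) -> divides p%:P b -> divides p%:P a.
  move=> ha [c bE]; rewrite -[a](addrK b); apply: dividesD => //.
  by exists (- c); rewrite bE mulNr.
move=> f g; have [m] := ubnP (size f + size g); elim: m f g => // m IH f g.
have [->|f0] := eqVneq f 0; first by left; exists 0; rewrite mul0r.
have [->|g0] := eqVneq g 0; first by right; exists 0; rewrite mul0r.
rewrite ltnS => sz fg.
have : divides p (lead_coef f * lead_coef g).
  by rewrite -lead_coefM lead_coefE; move/divides_polyC: fg; apply.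
have [f' fE sf'] := split_lead f f0; have [g' gE sg'] := split_lead g g0.
case/pD => pl.
- have hf := lead_dvd f (size f).-1 pl.
  have : divides p%:P (f' * g).
    apply: (@cancelD _ ((lead_coef f)%:P * 'X ^+ (size f).-1 * g)).
      by rewrite -mulrDl -fE.
    exact: divides_mulr.
  case/IH; first by rewrite (leq_trans _ sz) // ltn_add2r.
    by move=> pf'; left; rewrite fE; apply: dividesD.
  by right.
have hg := lead_dvd g (size g).-1 pl.
have : divides p%:P (f * g').
  apply: (@cancelD _ (f * ((lead_coef g)%:P * 'X ^+ (size g).-1))).
    by rewrite -mulrDr -gE.
  exact: divides_mull.
case/IH; first by rewrite (leq_trans _ sz) // ltn_add2l.
  by left.
by move=> pg'; right; rewrite gE; apply: dividesD.
Qed.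

(** Gauss's lemma in the form used here: a constant that multiplies a product
    can be distributed over the two factors, one constant prime at a time. *)
Lemma factorial_split_polyC (R : idomainType) (fR : factorial_domain R)
    (r : R) (q f g : {poly R}) :
  r != 0 -> r%:P * q = f * g ->
  exists r1 r2 f' g', [/\ r1 * r2 = r, f = r1%:P * f', g = r2%:P * g' & q = f' * g'].
Proof.
move=> /fR[u [s [uU sP ->]]]; elim: s sP q f g => [|p s IH] sP q f g.
  rewrite big_nil mulr1 => E.
  exists u, 1, (u^-1%:P * f), g; rewrite mulr1 mul1r mulrA -polyCM divrr // mul1r.
  by split=> //; rewrite -mulrA -E mulrA -polyCM mulVr // mul1r.
have pP := sP p (mem_head _ _); have [p0 _ _] := pP.
have sP' : {in s, forall p, prime_elt p} by move=> x xs; apply: sP; rewrite inE xs orbT.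
rewrite big_cons mulrCA => E.
have pc0 : p%:P != 0 by rewrite polyC_eq0.
have [_ _ /(_ f g)] := polyC_prime pP.
case; first by exists ((u * \prod_(j <- s) j)%:P * q); rewrite -E polyCM -[in LHS]mulrA mulrC.
- case=> f1 fE.
  have {}E: (u * \prod_(j <- s) j)%:P * q = f1 * g.
    by apply: (mulfI pc0); rewrite mulrA -polyCM E fE mulrAC mulrC.
  rewrite fE.
  have [r1 [r2 [f' [g' [<- -> -> ->]]]]] := IH sP' _ _ _ E.
  by exists (p * r1), r2, f', g'; split; rewrite ?mulrA // mulrC polyCM mulrA.
case=> g1 gE.
have {}E: (u * \prod_(j <- s) j)%:P * q = f * g1.
  by apply: (mulfI pc0); rewrite mulrA -polyCM E gE mulrA mulrC.
rewrite gE.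
have [r1 [r2 [f' [g' [<- -> -> ->]]]]] := IH sP' _ _ _ E.
exists r1, (p * r2), f', g'; split => //; first by rewrite mulrCA.
by rewrite mulrC polyCM mulrA.
Qed.


Definition factorable (R : idomainType) (a : R) : Prop :=
  exists (u : R) (s : seq R), [/\ u \is a GRing.unit,
    {in s, forall p : R, prime_elt p} & a = u * \prod_(p <- s) p].

Lemma factorableM (R : idomainType) (a b : R) :
  factorable a -> factorable b -> factorable (a * b).
Proof.
move=> [u [s [uU sP ->]]] [v [t [vU tP ->]]]; exists (u * v), (s ++ t).
split; first by rewrite unitrM uU.
  by move=> p; rewrite mem_cat => /orP[/sP|/tP].
by rewrite big_cat /= mulrACA.
Qed.

Lemma factorable_prime (R : idomainType) (p : R) : prime_elt p -> factorable p.
Proof.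
by move=> pP; exists 1, [:: p]; rewrite unitr1 big_seq1 mul1r; split=> // q /[1!inE]/eqP->.
Qed.

Section Gauss.
Variables (R : idomainType) (fR : factorial_domain R).

Definition primitive (f : {poly R}) : Prop :=
  forall p : R, prime_elt p -> ~ divides p%:P f.

Lemma primitive_content (f g : {poly R}) (r : R) :
  primitive f -> r != 0 -> f = r%:P * g -> r \is a GRing.unit.
Proof.
move=> fP r0 fE; have [u [[|p s] [uU sP rE]]] := fR r0.
  by rewrite rE big_nil mulr1.
case: (fP p); first by apply: sP; rewrite mem_head.
exists ((u * \prod_(j <- s) j)%:P * g).
by rewrite fE rE big_cons mulrCA polyCM -mulrA mulrC.
Qed.

Lemma primitive_divides (f g h : {poly R}) (r : R) :
  primitive f -> r != 0 -> r%:P * h = f * g -> divides f h.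
Proof.
move=> fP r0 /(factorial_split_polyC fR r0)[r1 [r2 [f' [g' [rE fE gE ->]]]]].
have r10 : r1 != 0 by apply: contra_neq r0 => r10; rewrite -rE r10 mul0r.
have r1U := primitive_content fP r10 fE.
by exists (r1^-1%:P * g'); rewrite fE mulrACA -polyCM mulVr // mul1r mulrC.
Qed.

(** Pseudo-division replaces the passage to the fraction field. If [f] divides
    [a * b], either [gcdp f a] is constant and a Bezout relation shows that [f]
    divides a constant multiple of [b], or the gcd is [f] up to a constant; the
    constants disappear because [f] is primitive. *)
Lemma primitive_prime (f : {poly R}) :
  (1 < size f)%N -> primitive f ->
  (forall g h : {poly R}, f = g * h -> (size g <= 1)%N || (size h <= 1)%N) ->
  prime_elt f.
Proof.
move=> sf fP fI; have f0 : f != 0 by rewrite -size_poly_gt0 ltnW.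
split=> // [|a b [c abE]].
  by rewrite poly_unitE; case: eqP => // sf1; rewrite sf1 in sf.
have [cop|ncop] := boolP (coprimep f a).
  right; move/Bezout_coprimepP: cop => [[u v] /=].
  rewrite -size_poly_eq1 => /size_poly1P[r r0 uvE].
  apply: (@primitive_divides _ (u * b + v * c) _ r) => //.
  by rewrite -uvE mulrDl -!mulrA abE; ring.
left; have /Pdiv.Idomain.dvdpP[[r h] /= r0] := dvdp_gcdl f a.
have /Pdiv.Idomain.dvdpP[[r' k] /= r'0] := dvdp_gcdr f a.
rewrite coprimep_def in ncop.
set g := gcdp f a in ncop *; rewrite -!mul_polyC => aE fE.
have g0 : g != 0 by rewrite gcdp_eq0 negb_and f0.
have sg : (1 < size g)%N by rewrite ltn_neqAle eq_sym ncop size_poly_gt0.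
have [r1 [r2 [h' [g' [rE hE gE fE']]]]] := factorial_split_polyC fR r0 fE.
have sg' : (1 < size g')%N.
  rewrite (leq_trans sg) // gE; have [->|g'0] := eqVneq g' 0.
    by rewrite mulr0.
  by rewrite (leq_trans (size_polyMleq _ _)) // size_polyC; case: eqP => //= _; rewrite ?add1n //; case: (size g').
have /orP[sh|] := fI _ _ fE'; last by rewrite leqNgt sg'.
have h'C : h' = (h'`_0)%:P by apply: size1_polyC.
have h'0 : h'`_0 != 0.
  by apply: contra_neq f0 => h'0; rewrite fE' h'C h'0 polyC0 mul0r.
rewrite {}h'C in fE'; have h'U := primitive_content fP h'0 fE'.
apply: (@primitive_divides _ (r2%:P * k * (h'`_0)^-1%:P) _ r') => //.
rewrite aE gE {1}fE'.
rewrite [RHS](_ : _ = (h'`_0 * (h'`_0)^-1)%:P * (k * (r2%:P * g'))).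
  by rewrite divrr // mul1r.
by rewrite polyCM; ring.
Qed.

(** Gauss's theorem. The outer induction is on the degree; the inner one counts
    the primes of the leading coefficient, which drop each time a constant prime
    is divided out. *)
Lemma factorial_poly : factorial_domain {poly R}.
Proof.
move=> f f0; rewrite -/(factorable f).
have [m] := ubnP (size f); elim: m f f0 => // m IH f f0; rewrite ltnS => sf.
have [u [s [uU sP lE]]] : factorable (lead_coef f) by apply: fR; rewrite lead_coef_eq0.
have [k] := ubnP (size s); elim: k f f0 sf u s uU sP lE => // k IHk f f0 sf u s uU sP lE.
rewrite ltnS => sk.
have [sf1|sf1] := leqP (size f) 1.
  have fC := size1_polyC sf1; have c0 : f`_0 != 0 by rewrite -polyC_eq0 -fC.
  have [v [t [vU tP cE]]] := fR c0.
  exists v%:P, (map polyC t); split.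
  - have v0 : v != 0 by apply: contraTneq vU => ->; rewrite unitr0.
    by rewrite poly_unitE size_polyC coefC eqxx vU v0.
  - by move=> _ /mapP[p pt ->]; apply/polyC_prime/tP.
  by rewrite fC cE polyCM rmorph_prod big_map.
have [fP|] := pselect (primitive f); last first.
  rewrite /primitive => /existsNP[p /not_implyP[pP /contrapT[g fE]]].
  have [p0 pU pD] := pP.
  have g0 : g != 0 by apply: contra_neq f0 => g0; rewrite fE g0 mul0r.
  have sfg : size f = size g by rewrite fE mulrC mul_polyC size_scale.
  have : divides p (\prod_(q <- s) q).
    have : divides p (u * \prod_(q <- s) q).
      by exists (lead_coef g); rewrite -lE fE lead_coefM lead_coefC.
    by case=> c cE; exists (u^-1 * c); rewrite -mulrA -cE mulrA mulVr // mul1r.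
  case/(prime_prod pP) => q qs [w qE].
  have [q0 qU qD] := sP q qs.
  have wU : w \is a GRing.unit.
    have [|[x wE]|[x pE]] := qD w p; first by rewrite -qE; apply: divides_refl.
      case/negP: pU; apply/unitrPr; exists x; apply: (mulIf q0).
      by rewrite mul1r {2}qE wE; ring.
    apply/unitrPr; exists x; apply: (mulIf q0).
    by rewrite mul1r -mulrA -pE -qE.
  rewrite fE; apply: factorableM; last exact/factorable_prime/polyC_prime.
  apply: (IHk g g0 _ (u * w) (rem q s)); rewrite ?sfg ?unitrM ?uU //.
  - by rewrite -sfg.
  - by move=> x /mem_rem/sP.
  - apply: (mulIf p0); rewrite -[in LHS](lead_coefC p) -lead_coefM -fE lE.
    by rewrite (big_rem _ qs) /= qE; ring.
  by rewrite size_rem // (leq_trans _ sk) // prednK //; case: (s) qs.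
have [fI|] := pselect (forall g h : {poly R}, f = g * h ->
    (size g <= 1)%N || (size h <= 1)%N).
  exact/factorable_prime/primitive_prime.
move=> /existsNP[g /existsNP[h /not_implyP[fE /negP]]].
rewrite negb_or -!ltnNge => /andP[sg sh].
have g0 : g != 0 by rewrite -size_poly_gt0 ltnW.
have h0 : h != 0 by rewrite -size_poly_gt0 ltnW.
move: sf; rewrite fE size_mul // => sgh.
apply: factorableM; apply: IH => //; move: sg sh sgh; clear; lia.
Qed.

End Gauss.

Lemma factorial_iso (R S : idomainType) (f : {rmorphism R -> S}) (g : {rmorphism S -> R}) :
  cancel f g -> cancel g f -> factorial_domain S -> factorial_domain R.
Proof.
move=> fK gK fS a a0.
have fU x : (f x \is a GRing.unit) = (x \is a GRing.unit).
  by apply/idP/idP => [/(rmorph_unit g)|/(rmorph_unit f)]; rewrite ?fK.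
have f0 x : (f x == 0) = (x == 0) by rewrite -(rmorph0 f) (can_eq fK).
have [|u [s [uU sP E]]] := fS (f a); first by rewrite f0.
exists (g u), (map g s); split; first by rewrite -fU gK.
  move=> _ /mapP[p /sP[p0 pU pD] ->]; split; rewrite -?f0 -?fU ?gK //.
  move=> x y [c xyE].
  have [|[d dE]|[d dE]] := pD (f x) (f y).
  - by exists (f c); rewrite -rmorphM xyE rmorphM gK.
  - by left; exists (g d); rewrite -[x]fK dE rmorphM.
  by right; exists (g d); rewrite -[y]fK dE rmorphM.
by rewrite -[a]fK E rmorphM rmorph_prod big_map.
Qed.

(** * Linear coordinates *)
Lemma mpoly_morph_eq (R S : comNzRingType) n (f g : {rmorphism {mpoly R[n]} -> S}) :
  (forall c, f c%:MP = g c%:MP) -> (forall i, f 'X_i = g 'X_i) -> f =1 g.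
Proof.
move=> fgC fgX p; elim/mpolyind: p => [|c m p _ _ IH]; first by rewrite !rmorph0.
rewrite !rmorphD IH -mul_mpolyC !rmorphM fgC mpolyXE_id; congr (_ * _ + _).
by rewrite !rmorph_prod; apply: eq_bigr => i _; rewrite !rmorphXn fgX.
Qed.

Lemma poly_morph_eq (R S : comNzRingType) (f g : {rmorphism {poly R} -> S}) :
  (forall c, f c%:P = g c%:P) -> f 'X = g 'X -> f =1 g.
Proof.
move=> fgC fgX p; elim/poly_ind: p => [|p c IH]; first by rewrite !rmorph0.
by rewrite !rmorphD !rmorphM fgC fgX IH.
Qed.

Section Coordinates.
Variables (K : fieldType) (n : nat) (v : 'I_n.+1 -> K).
Local Notation y := (@ord_max n).

(** The image of the variable [i] under the change of coordinates
    x_i -> x_i + v_i y for i < n and x_n -> v_n y, in which the direction [v]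
    becomes the last coordinate axis. *)
Definition along (i : 'I_n.+1) : {poly {mpoly K[n]}} :=
  (if unlift y i is Some j then ('X_j)%:P else 0) + ((v i)%:MP)%:P * 'X.

Definition to_poly : {mpoly K[n.+1]} -> {poly {mpoly K[n]}} :=
  mmap (polyC \o @mpolyC n K) along.

HB.instance Definition _ := GRing.RMorphism.on to_poly.

Definition straighten (j : 'I_n) : {mpoly K[n.+1]} :=
  'X_(lift y j) - (v (lift y j) / v y) *: 'X_y.

Definition of_poly : {poly {mpoly K[n]}} -> {mpoly K[n.+1]} :=
  horner_eval ((v y)^-1 *: 'X_y) \o map_poly (mmap (@mpolyC n.+1 K) straighten).

HB.instance Definition _ := GRing.RMorphism.on of_poly.

Lemma to_polyC c : to_poly c%:MP = (c%:MP)%:P.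
Proof. by rewrite /to_poly mmapC. Qed.

Lemma to_polyX i : to_poly 'X_i = along i.
Proof. by rewrite /to_poly mmapX mmap1U. Qed.

Lemma of_polyC c : of_poly c%:P = mmap (@mpolyC n.+1 K) straighten c.
Proof. by rewrite /of_poly /= map_polyC /horner_eval hornerC. Qed.

Lemma of_polyX : of_poly 'X = (v y)^-1 *: 'X_y.
Proof. by rewrite /of_poly /= map_polyX /horner_eval hornerX. Qed.

Lemma along_y : along y = ((v y)%:MP)%:P * 'X.
Proof. by rewrite /along unlift_none add0r. Qed.

Lemma along_lift j : along (lift y j) = ('X_j)%:P + ((v (lift y j))%:MP)%:P * 'X.
Proof. by rewrite /along liftK. Qed.

Definition top_form d (p : {mpoly K[n.+1]}) : {mpoly K[n.+1]} :=
  \sum_(m <- msupp p | mdeg m == d) p@_m *: 'X_[m].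

Lemma coef_top_mul (R : comNzRingType) (p q : {poly R}) k l :
  (size p <= k.+1)%N -> (size q <= l.+1)%N ->
  (size (p * q)%R <= (k + l).+1)%N /\ (p * q)`_(k + l) = p`_k * q`_l.
Proof.
move=> sp sq; split.
  by apply: leq_trans (size_polyMleq _ _) _; lia.
rewrite coefM (bigD1 (inord k)) //= inordK ?ltnS ?leq_addr // addKn.
rewrite big1 ?addr0 // => i; rewrite -val_eqE /= inordK ?ltnS ?leq_addr // => ik.
have [ki|ki] := ltnP k i; first by rewrite nth_default ?mul0r // (leq_trans sp).
rewrite [q`__]nth_default ?mulr0 // (leq_trans sq) //.
by have := ltn_ord i; lia.
Qed.

Lemma to_poly_monomial (m : 'X_{1..n.+1}) :
  (size (to_poly 'X_[m]) <= (mdeg m).+1)%N /\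
  (to_poly 'X_[m])`_(mdeg m) = ('X_[m].@[v])%:MP.
Proof.
rewrite mpolyXE_id !rmorph_prod mdegE /=.
elim/big_rec3: _ => [|i c k p _ [sp cp]].
  by rewrite size_poly1 coef1.
rewrite !rmorphXn /= to_polyX mevalXU.
have [sa ca] : (size (along i ^+ m i)%R <= (m i).+1)%N /\
   (along i ^+ m i)`_(m i) = (v i ^+ m i)%:MP.
  elim: (m i) => [|l [sl cl]]; first by rewrite !expr0 size_poly1 coef1.
  have sa : (size (along i) <= 2)%N.
    rewrite /along (leq_trans (size_polyD _ _)) // geq_max.
    rewrite (leq_trans (size_polyMleq _ _)) ?andbT; last first.
      by rewrite size_polyX addn2 /= ltnS size_polyC leq_b1.
    case: (unlift _ _) => [j|]; last by rewrite size_poly0.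
    by rewrite size_polyC (leq_trans (leq_b1 _)).
  rewrite !exprS -[l.+1]add1n.
  have [-> ->] := @coef_top_mul _ _ _ 1 l sa sl; split=> //.
  rewrite cl rmorphM; congr (_ * _).
  rewrite /along coefD coefMX /= coefC eqxx.
  by case: (unlift _ _) => [j|]; rewrite ?coefC ?coef0 add0r.
have [-> ->] := @coef_top_mul _ _ _ _ _ sa sp; split=> //.
by rewrite ca cp rmorphXn.
Qed.

Lemma size_to_poly p : (size (to_poly p) <= msize p)%N.
Proof.
rewrite [in to_poly p](mpolyE p) rmorph_sum /=.
rewrite (leq_trans (size_sum _ _ _)) //; apply/bigmax_leqP_seq => m mp _.
rewrite -mul_mpolyC rmorphM /= to_polyC mul_polyC (leq_trans (size_scale_leq _ _)) //.
by rewrite (leq_trans (to_poly_monomial m).1) // msize_mdeg_lt.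
Qed.

(** In the coordinates attached to [v], the coefficient of the highest power of
    y is the value at [v] of the top form; so [p] is, up to a constant, monic in y
    of its full degree as soon as [v] is not a zero of that form. *)
Lemma coef_to_poly_top d p : (msize p <= d.+1)%N ->
  (to_poly p)`_d = ((top_form d p).@[v])%:MP.
Proof.
move=> sp; rewrite [in LHS](mpolyE p) rmorph_sum /= coef_sum /top_form.
rewrite (rmorph_sum (meval v)) rmorph_sum [RHS]big_mkcond.
apply: eq_big_seq => m mp; rewrite -mul_mpolyC rmorphM /= to_polyC coefCM.
have [<-|md] := eqVneq; first by rewrite (to_poly_monomial m).2 mul_mpolyC mevalZ rmorphM.
rewrite nth_default ?mulr0 // (leq_trans (to_poly_monomial m).1) //.
by rewrite ltn_neqAle md -ltnS (leq_trans _ sp) // msize_mdeg_lt.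
Qed.

Lemma top_form_neq0 p : p != 0 -> top_form (msize p).-1 p != 0.
Proof.
move=> p0; apply/eqP => /(congr1 (mcoeff (mlead p))); rewrite mcoeff0 => /eqP.
have ld : mdeg (mlead p) = (msize p).-1 by rewrite -(mlead_deg p0).
rewrite /top_form raddf_sum /= big_mkcond (bigD1_seq (mlead p)) ?msupp_uniq ?mlead_supp //=.
rewrite ld eqxx mcoeffZ mcoeffX eqxx mulr1 big1 ?addr0 ?mleadc_eq0 ?(negbTE p0) //.
by move=> m /negbTE ml; rewrite mcoeffZ mcoeffX ml mulr0 if_same.
Qed.

Hypothesis vy : v y != 0.

Lemma to_polyK : cancel to_poly of_poly.
Proof.
move=> p; rewrite -[RHS]/(idfun p); move: p.
apply: (@mpoly_morph_eq _ _ _ (of_poly \o to_poly) idfun) => [c|i] /=.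
  by rewrite to_polyC of_polyC mmapC.
rewrite to_polyX; case: (unliftP y i) => [j|] ->.
  rewrite along_lift rmorphD rmorphM /= !of_polyC of_polyX mmapX mmap1U mmapC.
  by rewrite mul_mpolyC scalerA subrK.
by rewrite along_y rmorphM /= of_polyC of_polyX mmapC mul_mpolyC scalerA divff ?scale1r.
Qed.

Lemma of_polyK : cancel of_poly to_poly.
Proof.
have toZ c (p : {mpoly K[n.+1]}) : to_poly (c *: p) = (c%:MP)%:P * to_poly p.
  by rewrite -mul_mpolyC rmorphM /= to_polyC.
move=> p; rewrite -[RHS]/(idfun p); move: p.
apply: (@poly_morph_eq _ _ (to_poly \o of_poly) idfun) => [c|] /=.
  apply: (@mpoly_morph_eq _ _ _ (to_poly \o (of_poly \o polyC)) polyC) c => [c|i] /=.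
    by rewrite of_polyC mmapC to_polyC.
  rewrite of_polyC mmapX mmap1U /straighten rmorphB /= toZ !to_polyX.
  rewrite along_lift along_y mulrA -polyCM -mpolyCM divfK //.
  by rewrite addrK.
by rewrite of_polyX toZ to_polyX along_y mulrA -polyCM -mpolyCM mulVf // mul1r.
Qed.

End Coordinates.

Lemma mpoly0_const (R : nzRingType) (p : {mpoly R[0]}) : p = (p@_0)%:MP.
Proof.
apply/mpolyP => m; have -> : m = 0%MM by apply/mnmP; case.
by rewrite mcoeffC eqxx mulr1.
Qed.

(** One variable at a time, by Gauss's theorem. *)
Lemma factorial_mpoly (K : fieldType) n : factorial_domain {mpoly K[n]}.
Proof.
elim: n => [|n IH].
  move=> p p0; exists p, [::]; rewrite big_nil mulr1; split=> //.
  have p00 : p@_0 != 0 by apply: contra_neq p0 => p00; rewrite (mpoly0_const p) p00 mpolyC0.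
  by rewrite (mpoly0_const p); apply: (rmorph_unit (@mpolyC 0 K)); rewrite unitfE.
pose v := fun _ : 'I_n.+1 => 1 : K; have vy : v ord_max != 0 by apply: oner_neq0.
apply: (factorial_iso (to_polyK vy) (of_polyK vy)).
exact: factorial_poly.
Qed.

Lemma closed_field_infinite (K : closedFieldType) (s : seq K) : exists x, x \notin s.
Proof.
pose p := \prod_(z <- 0 :: s) ('X - z%:P) + 1.
have [|x /rootP px] := closed_rootP p _.
  by rewrite /p size_polyDl size_prod_XsubC ?size_poly1.
exists x; apply/negP => xs; move: px; rewrite /p !hornerE.
have -> : (\prod_(z <- 0 :: s) ('X - z%:P)).[x] = 0.
  by apply/rootP; rewrite root_prod_XsubC inE xs orbT.
by move/eqP; rewrite add0r oner_eq0.
Qed.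

(** Induction on the number of variables: a nonzero value of the leading
    coefficient leaves a nonzero polynomial in one variable, whose roots are
    finitely many while the field is infinite. *)
Lemma mpoly_nonroot (K : closedFieldType) n (p : {mpoly K[n]}) :
  p != 0 -> exists v, p.@[v] != 0.
Proof.
elim: n p => [|n IH] p p0.
  exists (fun _ => 0); rewrite (mpoly0_const p) mevalC.
  by apply: contra_neq p0 => p00; rewrite (mpoly0_const p) p00 mpolyC0.
pose e := fun i : 'I_n.+1 => (i == ord_max)%:R : K.
have ey : e ord_max != 0 by rewrite /e eqxx oner_neq0.
have P0 : to_poly e p != 0.
  by apply: contra_neq p0 => P0; rewrite -[p](to_polyK ey) P0 rmorph0.
have [w lw] := IH _ (etrans (congr1 negb (lead_coef_eq0 _)) P0).
pose q := map_poly (meval w) (to_poly e p).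
have q0 : q != 0.
  apply/eqP => /(congr1 (fun r : {poly K} => r`_(size (to_poly e p)).-1)).
  by rewrite coef_map coef0 -lead_coefE => /eqP; rewrite (negbTE lw).
have [s qs] : exists s : seq K, forall x, root q x -> x \in s.
  have [s qE] := closed_field_poly_normal q.
  by exists s => x; rewrite qE rootZ ?lead_coef_eq0 // root_prod_XsubC.
have [x xs] := closed_field_infinite s.
exists (fun i => if unlift ord_max i is Some j then w j else x).
apply: contraNneq xs => px; apply: qs; apply/rootP; rewrite -[RHS]px.
set w' := fun i => _; suff : horner_eval x \o (map_poly (meval w) \o to_poly e) =1 meval w'.
  by apply.
apply: (@mpoly_morph_eq _ _ _ (horner_eval x \o (map_poly (meval w) \o to_poly e))
  (meval w')) => [c|i] /=.
  by rewrite to_polyC map_polyC /horner_eval hornerC /= !mevalC.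
rewrite to_polyX mevalXU /w' /along rmorphD rmorphM /= map_polyX /horner_eval.
rewrite map_polyC hornerD hornerM hornerX hornerC /= mevalC /e.
case: (unliftP ord_max i) => [j|] ->.
  rewrite map_polyC hornerC /= mevalXU.
  by rewrite eq_sym (negbTE (neq_lift _ _)) mul0r addr0.
by rewrite rmorph0 horner0 add0r eqxx mul1r.
Qed.

(** * Extension of valuations *)
(** The value at 0 is left arbitrary; it plays the part of infinity. *)
Definition valuation (F : nzRingType) (v : F -> rat) : Prop :=
  (forall x y, x != 0 -> y != 0 -> v (x * y) = v x + v y) /\
  (forall x y, x != 0 -> y != 0 -> x + y != 0 -> Num.min (v x) (v y) <= v (x + y)).

Section ValuationTheory.
Variables (F : fieldType) (v : F -> rat).
Hypothesis vV : valuation v.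

Lemma val_mul x y : x != 0 -> y != 0 -> v (x * y) = v x + v y.
Proof. by have [h _] := vV; apply: h. Qed.

Lemma val_add x y r : x != 0 -> y != 0 -> x + y != 0 ->
  r <= v x -> r <= v y -> r <= v (x + y).
Proof.
have [_ h] := vV => x0 y0 xy0 rx ry; apply: le_trans (h _ _ x0 y0 xy0).
by rewrite le_min rx ry.
Qed.

Lemma val1 : v 1 = 0.
Proof.
have h := val_mul (oner_neq0 F) (oner_neq0 F).
by apply: (addrI (v 1)); rewrite -h mulr1 addr0.
Qed.

Lemma val_exp x n : x != 0 -> v (x ^+ n) = v x *+ n.
Proof.
move=> x0; elim: n => [|n IH]; first by rewrite expr0 mulr0n val1.
by rewrite exprS mulrS val_mul ?expf_neq0 // IH.
Qed.

Lemma valV x : x != 0 -> v x^-1 = - v x.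
Proof.
move=> x0; apply: (addrI (v x)).
by rewrite -val_mul ?invr_eq0 // divff // val1 subrr.
Qed.

Lemma valN x : v (- x) = v x.
Proof.
have [->|x0] := eqVneq x 0; first by rewrite oppr0.
have m0 : -1 != 0 :> F by rewrite oppr_eq0 oner_neq0.
have : v (-1) *+ 2 = 0 by rewrite -val_exp // sqrrN expr1n val1.
rewrite -(mulN1r x) val_mul // => /eqP; rewrite mulrn_eq0 /= => /eqP ->.
by rewrite add0r.
Qed.

Lemma val_div x y : x != 0 -> y != 0 -> v (x / y) = v x - v y.
Proof. by move=> x0 y0; rewrite val_mul ?invr_eq0 // valV. Qed.

Lemma val_prod (I : eqType) (s : seq I) (G : I -> F) :
  {in s, forall i, G i != 0} ->
  \prod_(i <- s) G i != 0 /\ v (\prod_(i <- s) G i) = \sum_(i <- s) v (G i).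
Proof.
elim: s => [|i s IH] G0; first by rewrite !big_nil oner_neq0 val1.
have [|p0 pE] := IH; first by move=> x xs; apply: G0; rewrite inE xs orbT.
have Gi : G i != 0 by apply: G0; rewrite mem_head.
by rewrite !big_cons mulf_neq0 // val_mul // pE.
Qed.

End ValuationTheory.

Section ValuationExtension.
Variables (F L : fieldType) (j : {rmorphism F -> L}) (v : F -> rat).
Hypothesis vV : valuation v.

(** The subrings of [L] that meet [F] exactly in the valuation ring of [v]. The
    valuation ring of an extension of [v] is a maximal one (Chevalley). *)
Record dominates (A : set L) : Prop := Dominates {
  dom1 : A 1;
  domB : forall x y, A x -> A y -> A (x - y);
  domM : forall x y, A x -> A y -> A (x * y);
  dom_ge0 : forall a, a != 0 -> 0 <= v a -> A (j a);
  dom_le0 : forall a, a != 0 -> A (j a) -> 0 <= v a }.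

Lemma dom0 A : dominates A -> A 0.
Proof. by move=> dA; rewrite -(subrr 1); apply: domB => //; apply: dom1. Qed.

Lemma domN A x : dominates A -> A x -> A (- x).
Proof. by move=> dA Ax; rewrite -sub0r; apply: domB => //; apply: dom0. Qed.

Lemma domD A x y : dominates A -> A x -> A y -> A (x + y).
Proof. by move=> dA Ax Ay; rewrite -[y]opprK; apply: domB => //; apply: domN. Qed.

Lemma domX A x n : dominates A -> A x -> A (x ^+ n).
Proof.
by move=> dA Ax; elim: n => [|n IH]; rewrite ?expr0 ?exprS; [apply: dom1|apply: domM].
Qed.

Lemma exists_maximal_dominating :
  exists A, dominates A /\ forall B, dominates B -> A `<=` B -> B `<=` A.
Proof.
pose base : set L := [set x | x = 0 \/ exists a, [/\ a != 0, 0 <= v a & x = j a]].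
have baseD : dominates base.
  have baseM x y : base x -> base y -> base (x * y).
    case=> [->|[a [a0 va ->]]]; first by left; rewrite mul0r.
    case=> [->|[b [b0 vb ->]]]; first by left; rewrite mulr0.
    right; exists (a * b); split; rewrite ?mulf_neq0 ?rmorphM //.
    by rewrite (val_mul vV) ?addr_ge0.
  have baseN x : base x -> base (- x).
    case=> [->|[a [a0 va ->]]]; first by left; rewrite oppr0.
    by right; exists (- a); split; rewrite ?oppr_eq0 ?rmorphN ?(valN vV).
  split=> //.
  - by right; exists 1; rewrite oner_neq0 (val1 vV) lexx rmorph1.
  - move=> x y bx /baseN; case: bx => [->|[a [a0 va ->]]]; first by rewrite add0r.
    case=> [->|[b [b0 vb ->]]].
      by right; exists a; rewrite addr0.
    have [ab|ab] := eqVneq (a + b) 0; first by left; rewrite -rmorphD ab rmorph0.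
    right; exists (a + b); split; rewrite ?rmorphD //.
    exact: (val_add vV).
  - by move=> a a0 va; right; exists a.
  move=> a a0 [/eqP|[b [b0 vb /fmorph_inj ->]]] //.
  by rewrite fmorph_eq0 (negbTE a0).
(* The empty set is admitted because the union of the empty chain is empty. *)
have [|A [PA maxA]] := @Zorn_bigcup L [set A | A = set0 \/ dominates A].
  move=> Fam FP Ftot.
  have [[A0 [FA0 dA0]]|none] := pselect (exists A, Fam A /\ dominates A); last first.
    left; apply/seteqP; split=> // x [A FA Ax].
    by case: (FP _ FA) => [A0|dA]; [rewrite A0 in Ax|case: none; exists A].
  have dF A x : Fam A -> A x -> dominates A.
    by move=> /FP[->|].
  have two x y : (\bigcup_(X in Fam) X) x -> (\bigcup_(X in Fam) X) y ->
     exists A, [/\ Fam A, dominates A, A x & A y].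
    move=> [A FA Ax] [B FB By]; case: (Ftot _ _ FA FB) => [AB|BA].
      by exists B; split=> //; [apply: dF By|apply: AB].
    by exists A; split=> //; [apply: dF Ax|apply: BA].
  right; split.
  - by exists A0 => //; apply: dom1.
  - by move=> x y Ux Uy; have [A [FA dA Ax Ay]] := two _ _ Ux Uy; exists A => //; apply: domB.
  - by move=> x y Ux Uy; have [A [FA dA Ax Ay]] := two _ _ Ux Uy; exists A => //; apply: domM.
  - by move=> a a0 va; exists A0 => //; apply: dom_ge0.
  by move=> a a0 [A FA Aa]; have dA := dF _ _ FA Aa; apply: dom_le0 dA _ _ _.
have dA : dominates A.
  case: PA => // A0; case: (maxA base); last by right.
  rewrite A0; split; first by [].
  by move=> /(_ 1 (dom1 baseD)).
exists A; split=> // B dB AB; apply: contrapT => nBA.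
by apply: (maxA B); [split|right].
Qed.

Section MaximalSubring.
Variable A : set L.
Hypotheses (dA : dominates A) (maxA : forall B, dominates B -> A `<=` B -> B `<=` A).

(** The ideal generated in [A] by the maximal ideal of the valuation ring of
    [v]. A single generator suffices, since of two elements of that maximal ideal
    one divides the other in the valuation ring. *)
Definition small (x : L) : Prop :=
  x = 0 \/ exists m a, [/\ m != 0, 0 < v m, A a & x = j m * a].

Lemma smallM x y : small x -> A y -> small (x * y).
Proof.
case=> [->|[m [a [m0 vm Aa ->]]]] Ay; first by left; rewrite mul0r.
right; exists m, (a * y); split=> //; first exact: domM.
by rewrite mulrA.
Qed.

Lemma smallD x y : small x -> small y -> small (x + y).
Proof.
case=> [->|sx]; first by rewrite add0r.
case=> [->|sy]; first by rewrite addr0; right.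
right; wlog [m [m' [a [b [[m0 m'0 vm mm [Aa Ab]] [-> ->]]]]]] : x y sx sy /
    exists m m' a b, [/\ m != 0, m' != 0, 0 < v m, v m <= v m' & A a /\ A b] /\
   x = j m * a /\ y = j m' * b.
  move=> H; have [m [a [m0 vm Aa xE]]] := sx; have [m' [b [m'0 vm' Ab yE]]] := sy.
  have [mm|/ltW mm] := leP (v m) (v m'); first by apply: H => //; exists m, m', a, b.
  by rewrite addrC; apply: H => //; exists m', m, b, a.
exists m, (a + j (m' / m) * b); split=> //.
  apply: domD => //; apply: domM => //; apply: dom_ge0 => //.
    by rewrite mulf_neq0 ?invr_eq0.
  by rewrite (val_div vV) // subr_ge0.
by rewrite mulrDr mulrA -rmorphM [m * _]mulrC divfK.
Qed.

Lemma smallN x : small x -> small (- x).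
Proof. by move=> sx; rewrite -mulrN1; apply: smallM => //; apply: domN => //; apply: dom1. Qed.

Lemma small_in x : small x -> A x.
Proof.
case=> [->|[m [a [m0 vm Aa ->]]]]; first exact: dom0.
by apply: domM => //; apply: dom_ge0 => //; apply: ltW.
Qed.

Lemma small_neq1 : ~ small 1.
Proof.
case=> [/eqP|[m [a [m0 vm Aa]]]]; first by rewrite oner_eq0.
move/(congr1 (fun x => (j m)^-1 * x)).
rewrite mulr1 mulKf ?fmorph_eq0 // -fmorphV => E.
have : 0 <= v m^-1 by apply: (dom_le0 dA); rewrite ?invr_eq0 ?E.
by rewrite (valV vV) // oppr_ge0 leNgt vm.
Qed.

Lemma one_sub_small_neq0 x : small x -> 1 - x != 0.
Proof. by move=> sx; rewrite subr_eq0; apply/eqP => x1; apply: small_neq1; rewrite x1. Qed.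

(** Maximality, restated: a larger ring that contains no element of [F] of
    negative value is equal to [A]. *)
Lemma maximal_among_dominating (B : set L) : A `<=` B ->
  (forall x y, B x -> B y -> B (x - y)) -> (forall x y, B x -> B y -> B (x * y)) ->
  (forall a, a != 0 -> v a < 0 -> ~ B (j a)) -> B `<=` A.
Proof.
move=> AB BB BM Bn; apply: maxA => //; split=> //.
- by apply: AB; apply: dom1.
- by move=> a a0 va; apply: AB; apply: dom_ge0.
by move=> a a0 Ba; rewrite leNgt; apply/negP => va; apply: Bn Ba.
Qed.

(** Localizing [A] at the elements 1 - s with s small still gives a ring that
    dominates, so by maximality these elements are already invertible. *)
Lemma small_inv x : small x -> A (1 - x)^-1.
Proof.
move=> sx; pose B : set L := [set z | exists b s, [/\ A b, small s & z = b / (1 - s)]].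
have sM s t : small s -> small t -> exists2 w, small w & (1 - s) * (1 - t) = 1 - w.
  move=> ss st; exists (s + t - s * t); last by ring.
  by apply: smallD; [apply: smallD|apply: smallN; apply: smallM => //; apply: small_in].
apply: (@maximal_among_dominating B); last by exists 1, x; rewrite mul1r; split=> //; apply: dom1.
- by move=> b Ab; exists b, 0; rewrite subr0 divr1; split=> //; left.
- move=> _ _ [b [s [Ab ss ->]]] [c [t [Ac st ->]]].
  have [w sw wE] := sM s t ss st.
  exists (b * (1 - t) - c * (1 - s)), w; split=> //.
    by apply: domB => //; apply: domM => //; apply: domB => //;
      first [exact: dom1 dA|exact: small_in].
  rewrite -wE; field.
  by rewrite !one_sub_small_neq0.
- move=> _ _ [b [s [Ab ss ->]]] [c [t [Ac st ->]]].
  have [w sw wE] := sM s t ss st.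
  exists (b * c), w; split=> //; first exact: domM.
  rewrite -wE; field.
  by rewrite !one_sub_small_neq0.
move=> a a0 va [b [s [Ab ss E]]]; apply: small_neq1.
suff -> : 1 = j a^-1 * b + s.
  apply: smallD => //; right; exists a^-1, b; split; rewrite ?invr_eq0 //.
  by rewrite (valV vV) // oppr_gt0.
have -> : b = j a * (1 - s) by rewrite E divfK // one_sub_small_neq0.
by rewrite mulrA -rmorphM mulVf // rmorph1 mul1r subrK.
Qed.

(** A relation of degree at most [k] which expresses that 1 belongs to the ideal
    generated by the small elements in A[z]. *)
Definition smallrel (z : L) (k : nat) : Prop :=
  exists p : {poly L}, [/\ (size p <= k.+1)%N, forall i, small p`_i & p.[z] = 1].

(** A[z] is strictly larger than [A], so it contains an element of [F] of
    negative value; divide by it. *)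
Lemma smallrel_exists z : ~ A z -> exists k, smallrel z k.
Proof.
move=> nAz; pose B : set L := [set x | exists2 p : {poly L}, forall i, A p`_i & x = p.[z]].
have polyM (p q : {poly L}) i : (forall i, A p`_i) -> (forall i, A q`_i) -> A (p * q)`_i.
  move=> Ap Aq; rewrite coefM; elim/big_ind: _ => [|x y|k _].
  - exact: dom0.
  - exact: domD.
  exact: domM.
apply: contrapT => none; apply: nAz; apply: (@maximal_among_dominating B).
- move=> a Aa; exists a%:P; rewrite ?hornerC // => i.
  by rewrite coefC; case: ifP => // _; apply: dom0.
- move=> _ _ [p Ap ->] [q Aq ->]; exists (p - q); rewrite ?hornerE // => i.
  by rewrite coefB; apply: domB.
- by move=> _ _ [p Ap ->] [q Aq ->]; exists (p * q); rewrite ?hornerM // => i; apply: polyM.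
- move=> a a0 va [p Ap E]; apply: none; exists (size p).
  exists (j a^-1 *: p); split.
  - by rewrite (leq_trans (size_scale_leq _ _)).
  - move=> i; rewrite coefZ; right; exists a^-1, p`_i; rewrite invr_eq0.
    by rewrite (valV vV) // oppr_gt0.
  by rewrite hornerZ -E -rmorphM mulVf // rmorph1.
exists 'X; last by rewrite hornerX.
by move=> i; rewrite coefX; case: eqP => _; [apply: dom1|apply: dom0].
Qed.

(** The relation for 1/z, solved for its constant term and multiplied by z^k,
    rewrites z^k through lower powers of z. *)
Lemma smallrel_reduce z k l : z != 0 -> (l <= k)%N -> smallrel z k -> smallrel z^-1 l ->
  smallrel z k.-1.
Proof.
move=> z0; case: k => [|k]; first by move=> _ h _.
move=> lk [p [sp ps pz]] [q [sq qs qz]].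
have u0 := one_sub_small_neq0 (qs 0%N); have Au := small_inv (qs 0%N).
set u := 1 - q`_0 in u0 Au.
have zE : z ^+ k.+1 = \sum_(i < l) (q`_i.+1 / u) * z ^+ (k - i).
  apply: (mulfI u0); rewrite mulr_sumr.
  have {1}-> : u = \sum_(i < l) q`_i.+1 * z^-1 ^+ i.+1.
    rewrite /u -qz (horner_coef_wide _ sq) big_ord_recl expr0 mulr1 addrAC subrr add0r.
    exact: eq_bigr.
  rewrite mulr_suml; apply: eq_bigr => i _; rewrite mulrA [u * _]mulrC divfK //.
  have ik : (i <= k)%N by rewrite -ltnS (leq_trans (ltn_ord i)).
  have -> : k.+1 = (k - i + i.+1)%N by rewrite addnS subnK.
  by rewrite -mulrA exprVn exprD [_^-1 * _]mulrC mulfK // expf_neq0.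
exists (\poly_(i < k.+1) p`_i + \sum_(i < l) (p`_k.+1 * (q`_i.+1 / u)) *: 'X^(k - i)); split.
- rewrite (leq_trans (size_polyD _ _)) // geq_max size_poly /=.
  rewrite (leq_trans (size_sum _ _ _)) //; apply/bigmax_leqP => i _.
  by rewrite (leq_trans (size_scale_leq _ _)) // size_polyXn ltnS leq_subr.
- move=> i; rewrite coefD; apply: smallD.
    by rewrite coef_poly; case: ifP => // _; left.
  rewrite coef_sum; elim/big_ind: _ => [|x y|m _]; [by left|exact: smallD|].
  rewrite coefZ coefXn; case: eqP => _; rewrite ?mulr0 ?mulr1; last by left.
  by apply: smallM => //; apply: domM => //; apply: small_in.
rewrite hornerD horner_sum -[RHS]pz (horner_coef_wide z sp) big_ord_recr /=.
rewrite horner_poly zE mulr_sumr; congr (_ + _); apply: eq_bigr => i _.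
by rewrite hornerZ hornerXn -mulrA.
Qed.

(** If neither z nor 1/z were in [A], a pair of relations of least total degree
    could be shortened. *)
Lemma maximal_valuation_ring z : z != 0 -> A z \/ A z^-1.
Proof.
move=> z0; apply: contrapT => /not_orP[/smallrel_exists[k Sk] /smallrel_exists[l Sl]].
have [m] := ubnP (k + l); elim: m z z0 k l Sk Sl => // m IH z z0 k l Sk Sl klm.
wlog lk : z z0 k l Sk Sl klm / (l <= k)%N.
  move=> H; have [lk|/ltnW kl] := leqP l k; first exact: (H z z0 k l).
  apply: (H z^-1 _ l k); rewrite ?invr_eq0 ?invrK //.
  by rewrite addnC.
case: k => [|k] in Sk klm lk.
  case: Sk => p [sp ps]; rewrite (size1_polyC sp) hornerC => p1.
  by apply: small_neq1; rewrite -p1.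
apply: (IH z z0 k l) => //; exact: (smallrel_reduce z0 lk Sk Sl).
Qed.

(** Equality up to a unit of [A]: equality of values, for the valuation to come. *)
Definition equiv (x y : L) : Prop := A (x / y) /\ A (y / x).

Lemma equivM x y x' y' : equiv x y -> equiv x' y' -> equiv (x * x') (y * y').
Proof. by move=> [a b] [c d]; split; rewrite -mulf_div; apply: domM. Qed.

Lemma equiv_refl x : x != 0 -> equiv x x.
Proof. by move=> x0; split; rewrite divff //; apply: dom1. Qed.

Lemma equiv_sym x y : equiv x y -> equiv y x.
Proof. by case. Qed.

Lemma equiv_trans y x z : y != 0 -> equiv x y -> equiv y z -> equiv x z.
Proof.
move=> y0 [a b] [c d]; split.
  have -> : x / z = (x / y) * (y / z) by rewrite mulrA divfK.
  exact: domM.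
have -> : z / x = (z / y) * (y / x) by rewrite mulrA divfK.
exact: domM.
Qed.

Lemma equivX x y n : equiv x y -> equiv (x ^+ n) (y ^+ n).
Proof. by case=> a b; split; rewrite -expr_div_n; apply: domX. Qed.

Lemma nonunit_add1 c : A c -> ~ A c^-1 -> 1 + c != 0 /\ A (1 + c)^-1.
Proof.
move=> Ac nc; have c1 : 1 + c != 0.
  apply/eqP => c1; apply: nc; have -> : c = -1 by apply/eqP; rewrite -addr_eq0 addrC c1.
  by rewrite invrN invr1; apply: domN => //; apply: dom1.
split=> //; have [c0|c0] := eqVneq c 0.
  by rewrite c0 addr0 invr1; apply: dom1.
have cc0 : c / (1 + c) != 0 by rewrite mulf_neq0 ?invr_eq0.
case: (maximal_valuation_ring cc0) => h.
  have -> : (1 + c)^-1 = 1 - c / (1 + c) by field.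
  by apply: domB => //; apply: dom1.
case: nc; have -> : c^-1 = (c / (1 + c))^-1 - 1 by field; rewrite ?c0 ?c1.
by apply: domB => //; apply: dom1.
Qed.

(** The strict case of the ultrametric inequality, which is an equality. *)
Lemma dominant x y : x != 0 -> y != 0 -> ~ equiv x y ->
  x + y != 0 /\ (equiv (x + y) x \/ equiv (x + y) y).
Proof.
move=> x0 y0; have yx0 : y / x != 0 by rewrite mulf_neq0 ?invr_eq0.
wlog Ayx : x y x0 y0 yx0 / A (y / x).
  move=> H ne; case: (maximal_valuation_ring yx0) => h; first exact: H.
  rewrite addrC; have [|//||] := H y x y0 x0.
  - by rewrite mulf_neq0 ?invr_eq0.
  - by rewrite -[x / y]invf_div.
  - by move/equiv_sym.
  by move=> -> [h'|h']; split=> //; [right|left].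
move=> ne; have [|s0 As] := @nonunit_add1 (y / x) Ayx.
  by rewrite invf_div => h; apply: ne.
have E : x + y = (1 + y / x) * x by rewrite mulrDl mul1r divfK.
split; first by rewrite E mulf_neq0.
left; rewrite E; split; first by rewrite mulfK //; apply: domD => //; apply: dom1.
by rewrite invfM mulrCA divff // mulr1.
Qed.

(** The value group of an algebraic extension is torsion over that of [F]: in an
    algebraic equation for x two different terms must be equivalent, for
    otherwise the sum would be equivalent to its dominant term. *)
Lemma algebraic_torsion x : x != 0 -> algebraicOver j x ->
  exists N a, [/\ (0 < N)%N, a != 0 & equiv (x ^+ N) (j a)].
Proof.
move=> x0 [p p0 px]; apply: contrapT => none.
have claim k : (\sum_(i < k) j p`_i * x ^+ i = 0 /\ forall i, (i < k)%N -> p`_i = 0) \/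
   (\sum_(i < k) j p`_i * x ^+ i != 0 /\ exists i, [/\ (i < k)%N, p`_i != 0 &
      equiv (\sum_(i < k) j p`_i * x ^+ i) (j p`_i * x ^+ i)]).
  elim: k => [|k IH]; first by left; rewrite big_ord0.
  rewrite big_ord_recr /=; have [pk|pk] := eqVneq p`_k 0.
    rewrite pk rmorph0 mul0r addr0; case: IH => [[-> h]|[s0 [i [ik pi e]]]].
      by left; split=> // i; rewrite ltnS leq_eqVlt => /predU1P[->|/h].
    by right; split=> //; exists i; split=> //; apply: ltnW.
  have t0 i : p`_i != 0 -> j p`_i * x ^+ i != 0.
    by move=> pi; rewrite mulf_neq0 ?fmorph_eq0 ?expf_neq0.
  right; case: IH => [[-> h]|[s0 [i [ik pi e]]]].
    by rewrite add0r t0 //; split=> //; exists k; split=> //; apply/equiv_refl/t0.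
  have [|s1 se] := dominant s0 (t0 _ pk).
    move=> e'; apply: none; exists (k - i)%N, (p`_i / p`_k); split.
    - by rewrite subn_gt0.
    - by rewrite mulf_neq0 ?invr_eq0.
    have [] : equiv (j p`_k * x ^+ k) (j p`_i * x ^+ i).
      by apply: equiv_trans (equiv_sym e') e.
    have -> : j (p`_i / p`_k) = j p`_i / j p`_k by rewrite rmorphM fmorphV.
    have xi : x ^+ i != 0 by rewrite expf_neq0.
    have jk : j p`_k != 0 by rewrite fmorph_eq0.
    have ji : j p`_i != 0 by rewrite fmorph_eq0.
    have -> : x ^+ k = x ^+ (k - i) * x ^+ i by rewrite -exprD subnK // ltnW.
    have xki : x ^+ (k - i) != 0 by rewrite expf_neq0.
    set X := x ^+ (k - i) in xki *; set Y := x ^+ i in xi *.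
    have -> : j p`_k * (X * Y) / (j p`_i * Y) = X / (j p`_i / j p`_k).
      by field; rewrite jk ji xi.
    have -> : j p`_i * Y / (j p`_k * (X * Y)) = (j p`_i / j p`_k) / X.
      by field; rewrite jk xki xi.
    by [].
  split=> //; case: se => se; last by exists k; split=> //; exact: se.
  exists i; split=> //; first exact: ltnW.
  exact: equiv_trans s0 se e.
have := claim (size p); rewrite -[\sum_(i < _) _](_ : (map_poly j p).[x] = _).
  rewrite (rootP px) eqxx => -[[_ h]|[]//].
  have sp : (0 < size p)%N by rewrite size_poly_gt0.
  move: p0; rewrite -lead_coef_eq0 lead_coefE h ?eqxx //.
  by rewrite prednK.
rewrite horner_coef size_map_poly; apply: eq_bigr => i _; by rewrite coef_map.
Qed.

(** The value of x is v(a)/N whenever x^N is equivalent to a. *)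
Definition torsion_value (x : L) (r : rat) : Prop :=
  exists N a, [/\ (0 < N)%N, a != 0, equiv (x ^+ N) (j a) & r = v a / N%:R].

Lemma equiv_base a b : a != 0 -> b != 0 -> equiv (j a) (j b) -> v a = v b.
Proof.
move=> a0 b0; rewrite /equiv -!fmorph_div => -[/(dom_le0 dA) h1 /(dom_le0 dA) h2].
by apply/le_anti/andP; split; rewrite -subr_ge0 -(val_div vV) //; [apply: h2|apply: h1];
   rewrite mulf_neq0 ?invr_eq0.
Qed.

Lemma torsion_value_uniq x r s : x != 0 -> torsion_value x r -> torsion_value x s -> r = s.
Proof.
move=> x0 [N [a [N0 a0 e ->]]] [M [b [M0 b0 e' ->]]].
have : equiv (j (a ^+ M)) (j (b ^+ N)).
  rewrite !rmorphXn; apply: (@equiv_trans (x ^+ (N * M))); first by rewrite expf_neq0.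
    by rewrite exprM; apply/equiv_sym/equivX.
  by rewrite mulnC exprM; apply: equivX.
move/equiv_base; rewrite !expf_neq0 // => /(_ isT isT).
rewrite !(val_exp vV) // -[_ *+ M]mulr_natr -[_ *+ N]mulr_natr => E.
apply/eqP; rewrite eqr_div ?pnatr_eq0 -?lt0n //; apply/eqP; exact: E.
Qed.

Lemma torsion_value_mul x y r s : torsion_value x r -> torsion_value y s ->
  torsion_value (x * y) (r + s).
Proof.
move=> [N [a [N0 a0 e ->]]] [M [b [M0 b0 e' ->]]].
exists (N * M)%N, (a ^+ M * b ^+ N); split.
- by rewrite muln_gt0 N0.
- by rewrite mulf_neq0 ?expf_neq0.
- rewrite exprMn rmorphM !rmorphXn; apply: equivM; first by rewrite exprM; apply: equivX.
  by rewrite mulnC exprM; apply: equivX.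
rewrite (val_mul vV) ?expf_neq0 // !(val_exp vV) // natrM.
rewrite -[_ *+ M]mulr_natr -[_ *+ N]mulr_natr.
by field; rewrite !pnatr_eq0 -!lt0n N0 M0.
Qed.

Lemma torsion_value_ge0 x r : x != 0 -> torsion_value x r -> (0 <= r <-> A x).
Proof.
move=> x0 [N [a [N0 a0 [e1 e2] ->]]].
have jN : 0 < N%:R :> rat by rewrite ltr0n.
have ja : j a != 0 by rewrite fmorph_eq0.
rewrite pmulr_lge0 ?invr_gt0 //; split=> [va|Ax]; last first.
  apply: (dom_le0 dA) => //; have -> : j a = (j a / x ^+ N) * x ^+ N by rewrite divfK ?expf_neq0.
  by apply: domM => //; apply: domX.
have AxN : A (x ^+ N).
  have -> : x ^+ N = (x ^+ N / j a) * j a by rewrite divfK.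
  by apply: domM => //; apply: dom_ge0.
case: (maximal_valuation_ring x0) => // Ax.
have -> : x = x ^+ N * x^-1 ^+ N.-1.
  by rewrite -{1}(prednK N0) exprS exprVn mulfK // expf_neq0.
by apply: domM => //; apply: domX.
Qed.

End MaximalSubring.

(** The ring of a maximal dominating subring decides the sign, and
    [algebraic_torsion] makes the values rational. *)
Theorem valuation_extension : (forall x, algebraicOver j x) ->
  exists w : L -> rat, valuation w /\ forall a, a != 0 -> w (j a) = v a.
Proof.
move=> alg; have [A [dA maxA]] := exists_maximal_dominating.
pose w x := xget 0 [set r | torsion_value A x r].
have wP x : x != 0 -> torsion_value A x (w x).
  move=> x0; have [N [a [N0 a0 e]]] := algebraic_torsion dA maxA x0 (alg x).
  by apply: (@xgetI _ 0 _ (v a / N%:R)); exists N, a.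
have wM x y : x != 0 -> y != 0 -> w (x * y) = w x + w y.
  move=> x0 y0; have xy0 : x * y != 0 by rewrite mulf_neq0.
  apply: (torsion_value_uniq dA xy0); first exact: wP.
  by apply: torsion_value_mul => //; apply: wP.
have w_ge0 x : x != 0 -> (0 <= w x <-> A x).
  by move=> x0; apply: torsion_value_ge0 (wP x x0).
exists w; split; first split=> // x y x0 y0 xy0; last first.
  move=> a a0; have ja : j a != 0 by rewrite fmorph_eq0.
  apply: (torsion_value_uniq dA ja); first exact: wP.
  by exists 1%N, a; rewrite divr1; split=> //; apply: equiv_refl.
wlog wxy : x y x0 y0 xy0 / w x <= w y.
  move=> H; have /orP[wxy|wyx] := le_total (w x) (w y); first exact: H.
  by rewrite minC addrC; apply: H; rewrite // addrC.
rewrite min_l //; have yx0 : y / x != 0 by rewrite mulf_neq0 ?invr_eq0.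
have E : x + y = x * (1 + y / x) by rewrite mulrDr mulr1 mulrCA divff ?mulr1.
have s0 : 1 + y / x != 0 by apply: contra_neq xy0 => s0; rewrite E s0 mulr0.
rewrite E wM // lerDl; apply/(w_ge0 _ s0); apply: domD => //; first exact: dom1.
apply/(w_ge0 _ yx0); have : w y = w x + w (y / x) by rewrite -wM // mulrCA divff ?mulr1.
by move/eqP; rewrite addrC -subr_eq => /eqP <-; rewrite subr_ge0.
Qed.

End ValuationExtension.

(** * Valued splitting fields *)
Lemma fraction_quotient (D : idomainType) (x : {fraction D}) :
  exists a b : D, b != 0 /\ x = tofrac a / tofrac b.
Proof.
elim/quotW: x => r; exists (\n_r), (\d_r); split; first exact: denom_ratioP.
have d0 : tofrac \d_r != 0 by rewrite tofrac_eq0 denom_ratioP.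
apply: (canRL (mulfK d0)); rewrite /tofrac; unlock FracField.tofrac.
rewrite -[LHS]FracField.pi_mul; apply/eqmodP.
rewrite /= /FracField.equivf /FracField.mulf /= !numden_Ratio ?oner_neq0 ?mulf_neq0 ?denom_ratioP //.
by rewrite !mulr1 mulrC.
Unshelve. all: exact: oner_neq0.
Qed.

Lemma valuation_fraction (D : idomainType) (v : D -> rat) : valuation v ->
  exists w : {fraction D} -> rat, valuation w /\ forall a, a != 0 -> w (tofrac a) = v a.
Proof.
move=> [vM vD].
pose isv (x : {fraction D}) r := exists a b, [/\ a != 0, b != 0, x = tofrac a / tofrac b & r = v a - v b].
pose w x := xget 0 [set r | isv x r].
have t0 (a : D) : a != 0 -> tofrac a != 0 by rewrite tofrac_eq0.
have isvP x : x != 0 -> isv x (w x).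
  move=> x0; have [a [b [b0 xE]]] := fraction_quotient x.
  apply: (@xgetI _ 0 _ (v a - v b)); exists a, b; split=> //.
  by apply: contra_neq x0 => a0; rewrite xE a0 rmorph0 mul0r.
have isv_uniq x r s : isv x r -> isv x s -> r = s.
  move=> [a [b [a0 b0 -> ->]]] [c [d [c0 d0 E ->]]].
  have : v (a * d) = v (c * b).
    congr v; apply/eqP; rewrite -tofrac_eq !rmorphM -eqr_div ?t0 //; exact/eqP.
  rewrite !vM // => /eqP; rewrite -subr_eq0 => /eqP h.
  by apply/eqP; rewrite -subr_eq0 -h; apply/eqP; ring.
have wE a b : a != 0 -> b != 0 -> w (tofrac a / tofrac b) = v a - v b.
  move=> a0 b0; apply: (isv_uniq (tofrac a / tofrac b)); last by exists a, b.
  by apply: isvP; rewrite mulf_neq0 ?invr_eq0 ?t0.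
have v1 : v 1 = 0.
  have h := vM _ _ (oner_neq0 D) (oner_neq0 D).
  by apply: (addrI (v 1)); rewrite -h mulr1 addr0.
exists w; split; first split.
- move=> x y /isvP[a [b [a0 b0 xE ->]]] /isvP[c [d [c0 d0 yE ->]]].
  have -> : x * y = tofrac (a * c) / tofrac (b * d).
    by rewrite xE yE !rmorphM invfM mulrACA.
  by rewrite wE ?mulf_neq0 // !vM //; ring.
- move=> x y x0 y0 xy0.
  have [a [b [a0 b0 xE wx]]] := isvP _ x0; have [c [d [c0 d0 yE wy]]] := isvP _ y0.
  have xyE : x + y = tofrac (a * d + c * b) / tofrac (b * d).
    by rewrite xE yE rmorphD !rmorphM addf_div ?t0.
  have s0 : a * d + c * b != 0.
    by apply: contra_neq xy0 => s0; rewrite xyE s0 rmorph0 mul0r.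
  rewrite xyE wE ?mulf_neq0 // wx wy.
  have ad0 : a * d != 0 by rewrite mulf_neq0.
  have cb0 : c * b != 0 by rewrite mulf_neq0.
  have := vD _ _ ad0 cb0 s0; rewrite !vM // ge_min => /orP[h|h]; rewrite ge_min.
    by apply/orP; left; lra.
  by apply/orP; right; lra.
move=> a a0; rewrite -[tofrac a]divr1 -(rmorph1 (@FracField.tofrac D)) wE ?oner_neq0 //.
by rewrite v1 subr0.
Qed.

Lemma irreducible_divisor (F : fieldType) (p : {poly F}) :
  (1 < size p)%N -> exists2 q, irreducible_poly q & q %| p.
Proof.
have [m] := ubnP (size p); elim: m p => // m IH p sm sp.
have [pP|/not_andP[]//] := pselect (irreducible_poly p); first by exists p.
move=> /existsNP[q /not_implyP[sq /not_implyP[qp /negP ne]]].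
have p0 : p != 0 by rewrite -size_poly_gt0 ltnW.
have q0 : q != 0 by apply: contraTneq qp => ->; rewrite dvd0p.
have [||r rP rq] := IH q.
- apply: (@leq_trans (size p)); last by rewrite -ltnS.
  rewrite ltn_neqAle dvdp_leq // andbT.
  by rewrite dvdp_size_eqp.
- by rewrite ltn_neqAle eq_sym sq size_poly_gt0.
by exists r => //; apply: dvdp_trans qp.
Qed.

(** Adjoin one root after another, extending the valuation at each step. *)
Theorem valued_splitting (F : fieldType) (v : F -> rat) (p : {poly F}) :
  valuation v -> p != 0 ->
  exists (L : fieldType) (j : {rmorphism F -> L}) (w : L -> rat),
    [/\ valuation w, forall a, a != 0 -> w (j a) = v a &
        exists rs : seq L, map_poly j p = j (lead_coef p) *: \prod_(r <- rs) ('X - r%:P)].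
Proof.
have [m] := ubnP (size p); elim: m F v p => // m IH F v p sm vV p0.
have [sp|sp] := leqP (size p) 1.
  exists F, idfun, v; split=> //; exists [::].
  rewrite big_nil map_poly_id // (size1_polyC sp) lead_coefC.
  by rewrite -mul_polyC mulr1.
have [q qP qp] := irreducible_divisor sp.
have [L _ [z zq _]] := irredp_FAdjoin qP.
have [|w [wV wE]] := @valuation_extension F L (in_alg L) v vV.
  by move=> x; apply/integral_algebraic/alg_integral.
have zp : root (map_poly (in_alg L) p) z by case/dvdpP: qp => r ->; rewrite rmorphM rootM zq orbT.
have /factor_theorem[p1 p1E] := zp.
have p10 : p1 != 0.
  by apply: contraTneq p0 => p10; rewrite -(map_poly_eq0 (in_alg L)) p1E p10 mul0r eqxx.
have [|L' [j' [w' [wV' wE' [rs rsE]]]]] := IH L w p1 _ wV p10.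
  have := congr1 (fun r : {poly L} => size r) p1E; rewrite size_map_poly.
  rewrite size_mul ?polyXsubC_eq0 // size_XsubC addn2 /= => E.
  by rewrite -ltnS -E.
exists L', (j' \o in_alg L), w'; split=> //.
  by move=> a a0; rewrite -wE //; apply: wE'; rewrite fmorph_eq0.
exists (j' z :: rs); rewrite map_poly_comp p1E rmorphM /= rsE big_cons.
rewrite rmorphB /= map_polyX map_polyC /= -scalerAl mulrC; congr (j' _ *: _).
have := congr1 lead_coef p1E.
by rewrite lead_coef_map lead_coefM lead_coefXsubC mulr1.
Qed.

(** * Products over the roots of a polynomial *)
Section ConjugateProduct.
Variables (D L : idomainType) (j : {rmorphism D -> L}).

Lemma mesym_meval d (c : d.-tuple L) k (f : {rmorphism {poly D} -> {poly L}}) :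
  mmap f (fun i => (tnth c i)%:P) (mesym d {poly D} k) = ((mesym d L k).@[tnth c])%:P.
Proof.
rewrite /mesym rmorph_sum (rmorph_sum (meval (tnth c))) (rmorph_sum (@polyC L)).
apply: eq_bigr => h _.
rewrite rmorph_prod (rmorph_prod (meval (tnth c))) (rmorph_prod (@polyC L)).
apply: eq_bigr => i _.
by rewrite [LHS]mmapX mmap1U; congr _%:P; rewrite [RHS]mevalXU.
Qed.

(** The product of the T - P(r) over the roots r of [G] is symmetric in the roots,
    so its coefficients are polynomials in the coefficients of [G] and [P]. It
    is the characteristic polynomial of multiplication by [P] modulo [G]; its
    constant term is, up to sign, the norm of [P]. *)
Lemma conjugate_product (G P : {poly D}) (rs : seq L) :
  map_poly j G = \prod_(r <- rs) ('X - r%:P) ->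
  exists chi : {poly D},
    map_poly j chi = \prod_(r <- rs) ('X - ((map_poly j P).[r])%:P).
Proof.
move=> GE; set d := size rs; pose c := in_tuple rs; have cE : tval c = rs by [].
pose C : {rmorphism D -> {mpoly {poly D}[d]}} := @mpolyC d {poly D} \o polyC.
pose PX (i : 'I_d) := (map_poly C P).['X_i].
pose p : {mpoly {poly D}[d]} := \prod_(i < d) (('X)%:MP - PX i).
have p_sym : p \is symmetric.
  apply/issymP => s; rewrite /p rmorph_prod /=.
  rewrite [RHS](reindex_inj (@perm_inj _ s)) /=; apply: eq_bigr => i _.
  rewrite rmorphB /= [msym s _%:MP]mmapC; congr (_ - _).
  rewrite /PX -horner_map -map_poly_comp; congr (_.[_]).
    by apply: eq_map_poly => x /=; rewrite [msym s _]mmapC.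
  by rewrite [LHS]mmapX mmap1U.
have [t [tE _]] := sym_fundamental p_sym.
pose ev : {rmorphism {mpoly {poly D}[d]} -> {poly L}} :=
  mmap (map_poly j) (fun i => (tnth c i)%:P).
pose b (i : 'I_d) : {poly D} := ((-1) ^+ i.+1 * G`_(d - i.+1))%:P.
exists (t.@[b]).
have evb (i : 'I_d) : map_poly j (b i) = ev (mesym d {poly D} i.+1).
  rewrite /ev /= mesym_meval /b map_polyC /=; congr _%:P.
  have lid : (i.+1 < d.+1)%N by rewrite ltnS.
  have := mroots_coeff c (Ordinal lid); rewrite /= -[\prod_(_ <- _) _]GE coef_map /= => E.
  by rewrite rmorphM /= E rmorphXn rmorphN1 mulrA -exprMn mulrNN mulr1 expr1n mul1r.
have -> : map_poly j t.@[b] = ev p.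
  rewrite -tE; move: t {tE}.
  apply: (@mpoly_morph_eq _ _ _ (map_poly j \o meval b) (ev \o comp_mpoly _)) => [x|i] /=.
    by rewrite mevalC comp_mpolyC; apply/esym/mmapC.
  rewrite mevalXU evb /ev /=; congr (mmap _ _ _).
  by rewrite /comp_mpoly [RHS]mmapX mmap1U tnth_map tnth_ord_tuple.
rewrite /p rmorph_prod /= -[RHS]/(\prod_(r <- tval c) _) [RHS]big_tuple; apply: eq_bigr => i _.
rewrite rmorphB /= [X in X - _]mmapC /= map_polyX; congr (_ - _).
rewrite /PX -horner_map /= -map_poly_comp [X in _.[X]]mmapX mmap1U.
have -> : map_poly (mmap (map_poly j) (fun i => (tnth c i)%:P) \o C) P = map_poly polyC (map_poly j P).
  by rewrite -map_poly_comp; apply: eq_map_poly => x; rewrite /comp [LHS]mmapC; apply: map_polyC.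
by rewrite horner_map.
Qed.

End ConjugateProduct.

(** * Branches of the generic fibre *)
Lemma monic_dvd_descent (D : idomainType) (L : fieldType) (j : {rmorphism D -> L})
    (d p : {poly D}) : injective j -> d \is monic ->
  map_poly j d %| map_poly j p -> exists W, p = W * d.
Proof.
move=> jI dM; have E := Pdiv.RingMonic.rdivp_eq dM p => dvd.
exists (Pdiv.CommonRing.rdivp p d); rewrite [LHS]E.
set Q := Pdiv.CommonRing.rdivp _ _ in E *; set r := Pdiv.CommonRing.rmodp _ _ in E *.
suff -> : r = 0 by rewrite addr0.
apply: (map_inj_poly jI (rmorph0 j)); rewrite rmorph0; apply/eqP; apply: contraTT dvd => r0.
rewrite E rmorphD rmorphM dvdp_addr ?dvdp_mull // gtNdvdp //.
rewrite !(size_map_inj_poly jI (rmorph0 j)).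
by apply: Pdiv.CommonRing.ltn_rmodpN0; apply: monic_neq0.
Qed.

Section TotalDegree.
Variables (R : idomainType) (n : nat).

(** Minus the total degree, since [msize] is one more than the degree. *)
Definition deg_val (d : {mpoly R[n]}) : rat := 1 - (msize d)%:R.

Lemma deg_val_valuation : valuation deg_val.
Proof.
split=> [p q p0 q0|p q p0 q0 _]; rewrite /deg_val.
  rewrite msizeM // (mpolySpred _ p0) (mpolySpred _ q0) addSn addnS /=.
  by rewrite -!natr1 natrD; ring.
have := msizeD_le p q; rewrite leq_max -!(ler_nat rat) ge_min => /orP[h|h].
  by apply/orP; left; lra.
by apply/orP; right; lra.
Qed.

Lemma deg_val_le0 d : d != 0 -> deg_val d <= 0.
Proof.
by move=> d0; rewrite /deg_val subr_le0 (ler_nat rat 1) (mpolySpred _ d0).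
Qed.

Lemma deg_val_ge0 d : 0 <= deg_val d -> d = (d@_0)%:MP.
Proof. by rewrite /deg_val subr_ge0 (ler_nat rat _ 1) => /msize1_polyC. Qed.

Lemma deg_valC c : c != 0 -> deg_val c%:MP = 0.
Proof. by move=> c0; rewrite /deg_val msizeC c0 subrr. Qed.

End TotalDegree.

(** The polynomial [G] is monic in y with coefficients in A = K[x]. The generic
    fibre G = t lives over D = K[t][x], whose valuation [deg_val] is minus the
    degree in x, with t of value 0. Its roots [ths], in a field [L] with a
    valuation [w] that extends [deg_val], are the branches at infinity of the
    generic fibre. *)
Section Branches.
Variables (K : closedFieldType) (n : nat).
Local Notation A := {mpoly K[n]}.
Local Notation D := {mpoly {poly K}[n]}.
Variable G : {poly A}.
Hypotheses (G_monic : G \is monic).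

Definition lift_coef : A -> D := map_mpoly polyC.
HB.instance Definition _ := GRing.RMorphism.on lift_coef.

Definition generic_const : D := ('X)%:MP.
Definition generic_fibre : {poly D} := map_poly lift_coef G - generic_const%:P.

Variables (L : fieldType) (j : {rmorphism D -> L}) (w : L -> rat).
Hypothesis jI : injective j.
Hypotheses (wV : valuation w) (wj : forall d, d != 0 -> w (j d) = deg_val d).
Variable ths : seq L.
Hypothesis thsE : map_poly j generic_fibre = \prod_(th <- ths) ('X - th%:P).

Definition evalL (q : {poly A}) (x : L) : L := (map_poly (j \o lift_coef) q).[x].
Definition constL (c : K) : L := j (lift_coef c%:MP).

Definition fibre_roots (c : K) (zs : seq L) : Prop :=
  map_poly (j \o lift_coef) (G - (c%:MP)%:P) = \prod_(z <- zs) ('X - z%:P).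

Lemma evalLM q r x : evalL (q * r) x = evalL q x * evalL r x.
Proof. by rewrite /evalL rmorphM hornerM. Qed.

Lemma evalL_fibre c x : evalL (G - (c%:MP)%:P) x = evalL G x - constL c.
Proof. by rewrite /evalL rmorphB /= map_polyC /= hornerD hornerN hornerC. Qed.

Lemma evalL_generic th : th \in ths -> evalL G th = j generic_const.
Proof.
move=> tht; have : (map_poly j generic_fibre).[th] = 0.
  by apply/rootP; rewrite thsE root_prod_XsubC.
rewrite /generic_fibre rmorphB /= map_polyC hornerD hornerN hornerC.
by rewrite -map_poly_comp => /eqP; rewrite subr_eq0 => /eqP.
Qed.

Lemma generic_sub_neq0 c : generic_const - lift_coef c%:MP != 0 :> D.
Proof.
rewrite /generic_const /lift_coef map_mpolyC -mpolyCB mpolyC_eq0.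
by rewrite polyXsubC_eq0.
Qed.

(** As a polynomial in x over K[t], the difference t - c is a nonzero constant. *)
Lemma w_generic_sub c : w (j generic_const - constL c) = 0 /\ j generic_const - constL c != 0.
Proof.
rewrite -rmorphB raddf_eq0 // generic_sub_neq0 wj ?generic_sub_neq0 //; split=> //.
rewrite /generic_const /lift_coef map_mpolyC -mpolyCB deg_valC //.
by rewrite polyXsubC_eq0.
Qed.

Lemma branch_neq c zs th z : fibre_roots c zs -> th \in ths -> z \in zs -> th - z != 0.
Proof.
move=> zsE tht zt; rewrite subr_eq0; apply/eqP => E.
have : evalL (G - (c%:MP)%:P) z = 0 by apply/rootP; rewrite zsE root_prod_XsubC.
by rewrite evalL_fibre -E evalL_generic //; apply/eqP/(w_generic_sub c).2.
Qed.

(** The product of the th - z over the roots z of G = c is t - c, of value 0. *)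
Lemma sum_branch c zs th : fibre_roots c zs -> th \in ths ->
  \sum_(z <- zs) w (th - z) = 0.
Proof.
move=> zsE tht; have [_ <-] := @val_prod _ _ wV _ zs (fun z => th - z)
  (fun z zt => branch_neq zsE tht zt).
rewrite -[RHS](w_generic_sub c).1 -(evalL_generic tht) -evalL_fibre /evalL zsE.
by rewrite horner_prod; congr w; apply: eq_bigr => z _; rewrite !hornerE.
Qed.

Definition val_ge (r : rat) (x : L) : Prop := x = 0 \/ r <= w x.

Lemma val_geD r x y : val_ge r x -> val_ge r y -> val_ge r (x + y).
Proof.
have [->|x0] := eqVneq x 0; first by rewrite add0r.
have [->|y0] := eqVneq y 0; first by rewrite addr0.
have [->|xy0] := eqVneq (x + y) 0; first by left.
move=> [/eqP|rx]; first by rewrite (negbTE x0).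
move=> [/eqP|ry]; first by rewrite (negbTE y0).
by right; apply: val_add.
Qed.

Lemma val_geN r x : val_ge r x -> val_ge r (- x).
Proof. by case=> [->|rx]; [left; rewrite oppr0|right; rewrite (valN wV)]. Qed.

Lemma val_geM r s x y : val_ge r x -> val_ge s y -> val_ge (r + s) (x * y).
Proof.
have [->|x0] := eqVneq x 0; first by left; rewrite mul0r.
have [->|y0] := eqVneq y 0; first by left; rewrite mulr0.
move=> [/eqP|rx]; first by rewrite (negbTE x0).
move=> [/eqP|ry]; first by rewrite (negbTE y0).
by right; rewrite (val_mul wV) ?lerD.
Qed.

(** The maximal ideal of the valuation ring of [w]. *)
Definition tiny (x : L) : Prop := x = 0 \/ 0 < w x.

Lemma tiny_mul x y : tiny x -> tiny y -> exists2 z, tiny z & (1 - x) * (1 - y) = 1 - z.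
Proof.
move=> tx ty; exists (x + y - x * y); last by ring.
have [->|x0] := eqVneq x 0; first by rewrite mul0r subr0 add0r.
have [->|y0] := eqVneq y 0; first by rewrite mulr0 subr0 addr0.
case: tx ty => [/eqP|wx]; first by rewrite (negbTE x0).
case=> [/eqP|wy]; first by rewrite (negbTE y0).
have : val_ge (Num.min (w x) (w y)) (x + y - x * y).
  apply: val_geD; first by apply: val_geD; right; rewrite ge_min lexx ?orbT.
  apply: val_geN; right; rewrite (val_mul wV) // ge_min.
  by apply/orP; left; rewrite lerDl ltW.
case=> [->|h]; first by left.
by right; apply: lt_le_trans h; rewrite lt_min wx.
Qed.

Lemma tiny_prod (I : eqType) (s : seq I) (X : I -> L) :
  {in s, forall i, tiny (X i)} ->
  exists2 z, tiny z & \prod_(i <- s) (1 - X i) = 1 - z.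
Proof.
elim: s => [|i s IH] Xs; first by exists 0; [left|rewrite big_nil subr0].
have [|z tz zE] := IH; first by move=> k ks; apply: Xs; rewrite inE ks orbT.
by rewrite big_cons zE; apply: tiny_mul => //; apply: Xs; rewrite mem_head.
Qed.

(** The distance from a branch to the nearest root of G = c does not depend on c.
    If z' were closer to th than every root z of G = c, each quotient
    (z' - z)/(th - z) would be 1 up to the maximal ideal; their product
    (c' - c)/(t - c) would be so too, which is impossible because
    1 - (c' - c)/(t - c) = (t - c')/(t - c) has value 0. *)
Lemma radius_le c c' zs zs' th z' : fibre_roots c zs -> fibre_roots c' zs' ->
  th \in ths -> z' \in zs' -> exists2 z, z \in zs & w (th - z') <= w (th - z).
Proof.
move=> zsE zsE' tht zt'; apply: contrapT => none.
have z'0 := branch_neq zsE' tht zt'.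
have lt z : z \in zs -> w (th - z) < w (th - z').
  by move=> zt; rewrite ltNge; apply/negP => h; apply: none; exists z.
have [|y ty yE] := @tiny_prod _ zs (fun z => (th - z') / (th - z)).
  move=> z zt; right; have z0 := branch_neq zsE tht zt.
  by rewrite (val_div wV) // subr_gt0 lt.
have prodE x : \prod_(z <- zs) (x - z) = evalL G x - constL c.
  rewrite -evalL_fibre /evalL zsE horner_prod.
  by apply: eq_bigr => z _; rewrite !hornerE.
have [wt t0] := w_generic_sub c; have [wt' t0'] := w_generic_sub c'.
set t := j generic_const in wt t0 wt' t0'.
have Gz' : evalL G z' = constL c'.
  have : evalL (G - (c'%:MP)%:P) z' = 0 by apply/rootP; rewrite zsE' root_prod_XsubC.
  by rewrite evalL_fibre => /eqP; rewrite subr_eq0 => /eqP.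
have E : (t - constL c) * (1 - y) = constL c' - constL c.
  rewrite -yE -Gz' -prodE /t -(evalL_generic tht) -prodE -big_split /=.
  rewrite big_seq [RHS]big_seq; apply: eq_bigr => z zt.
  by rewrite mulrBr mulr1 mulrCA divff ?(branch_neq zsE tht zt) // mulr1; ring.
have yE' : (t - constL c) * y = t - constL c' by rewrite -[y](subKr 1) mulrBr E; ring.
have y0 : y != 0 by apply: contra_neq t0' => y0; rewrite -yE' y0 mulr0.
case: ty => [/eqP|]; first by rewrite (negbTE y0).
have : w ((t - constL c) * y) = 0 by rewrite yE'.
by rewrite (val_mul wV) // wt add0r => ->; rewrite ltxx.
Qed.

(** Large values mean small distances. *)
Definition closest (zs : seq L) (th z : L) : Prop :=
  z \in zs /\ {in zs, forall z', w (th - z') <= w (th - z)}.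

Lemma closest_exists zs th : zs != [::] -> exists z, closest zs th z.
Proof.
elim: zs => // z zs IH _; have [->|zs0] := eqVneq zs [::].
  by exists z; split=> [|z']; rewrite inE // => /eqP ->.
have [y [yt yP]] := IH zs0; have /orP[h|h] := le_total (w (th - z)) (w (th - y)).
  exists y; split; first by rewrite inE yt orbT.
  by move=> z'; rewrite inE => /predU1P[->|/yP].
exists z; split=> [|z']; first by rewrite mem_head.
by rewrite inE => /predU1P[->|/yP/le_trans->].
Qed.

(** By the ultrametric inequality, the branch nearer to z would be at least as
    close as the other one to every root, and closer to z, although both sums of
    values over all roots vanish. *)
Lemma shared_closest_le c zs th th' z : fibre_roots c zs ->
  th \in ths -> th' \in ths -> closest zs th z -> closest zs th' z ->
  w (th' - z) <= w (th - z).
Proof.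
move=> zsE tht tht' [zt zP] [_ zP']; rewrite leNgt; apply/negP => lt.
have le y : y \in zs -> w (th - y) <= w (th' - y).
  move=> yt; have : val_ge (w (th - y)) (th' - y).
    have -> : th' - y = (th' - z) - (th - z) + (th - y) by ring.
    apply: val_geD; last by right.
    apply: val_geD; first by right; apply: le_trans (zP _ yt) (ltW lt).
    by apply: val_geN; right; apply: zP.
  by case=> // /eqP; rewrite (negbTE (branch_neq zsE tht' yt)).
have := sum_branch zsE tht; have := sum_branch zsE tht'; rewrite !(big_rem _ zt) /= => E E'.
have : \sum_(y <- rem z zs) w (th - y) <= \sum_(y <- rem z zs) w (th' - y).
  by rewrite big_seq [leRHS]big_seq; apply: ler_sum => y /mem_rem; apply: le.
by move: lt E E'; lra.
Qed.

(** Both branches lie in the disc around z of their common radius, and no root of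
    any fibre G = c' is closer to a branch than this radius. *)
Lemma shared_closest_sub c c' zs zs' th th' z y : fibre_roots c zs -> fibre_roots c' zs' ->
  th \in ths -> th' \in ths -> closest zs th z -> closest zs th' z -> y \in zs' ->
  w (th - y) = w (th' - y).
Proof.
move=> zsE zsE' tht tht' cl cl' yt.
have wE : w (th - z) = w (th' - z).
  by apply/le_anti; rewrite !(shared_closest_le zsE _ _ cl' cl) // !(shared_closest_le zsE _ _ cl cl').
have half a b : a \in ths -> b \in ths -> closest zs a z -> w (a - z) = w (b - z) ->
    w (a - y) <= w (b - y).
  move=> ta tb ca wab; have : val_ge (w (a - y)) (b - y).
    have -> : b - y = (b - z) - (a - z) + (a - y) by ring.
    have [x xt xle] := radius_le zsE zsE' ta yt.
    have ayz : w (a - y) <= w (a - z) by apply: le_trans xle (ca.2 _ xt).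
    apply: val_geD; last by right.
    by apply: val_geD; [right; rewrite -wab|apply: val_geN; right].
  by case=> // /eqP; rewrite (negbTE (branch_neq zsE' tb yt)).
by apply/le_anti; rewrite !half.
Qed.

Lemma evalL_neq0 c (q r : {poly A}) th : th \in ths -> q * r = G - (c%:MP)%:P -> evalL q th != 0.
Proof.
move=> tht qE; have : evalL (q * r) th != 0.
  by rewrite qE evalL_fibre evalL_generic //; apply: (w_generic_sub c).2.
by rewrite evalLM mulf_eq0 negb_or => /andP[].
Qed.

(** Branches in the same disc are not separated by the values of the divisors of
    the fibres. As each disc contains a root of G = c, this bounds the number
    of different columns of values by the number of distinct roots of G = c. *)
Lemma shared_closest_divisor c c' zs zs' th th' z (q r : {poly A}) :
  fibre_roots c zs -> fibre_roots c' zs' ->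
  th \in ths -> th' \in ths -> closest zs th z -> closest zs th' z ->
  q * r = G - (c'%:MP)%:P -> w (evalL q th) = w (evalL q th').
Proof.
move=> zsE zsE' tht tht' cl cl' qE.
have [m /eqp_eq] : {m | map_poly (j \o lift_coef) q %= \prod_(y <- mask m zs') ('X - y%:P)}.
  by apply: dvdp_prod_XsubC; rewrite -zsE' -qE rmorphM dvdp_mulr.
set l := lead_coef (map_poly _ q); rewrite (monicP (monic_prod_XsubC _ _ _)) scale1r => qL.
have wE t : t \in ths -> w (evalL q t) = w l + \sum_(y <- mask m zs') w (t - y).
  move=> tt; have nz : evalL q t != 0 := evalL_neq0 tt qE.
  have qtE : evalL q t = l * \prod_(y <- mask m zs') (t - y).
    rewrite /evalL qL hornerZ horner_prod; congr (_ * _).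
    by apply: eq_bigr => y _; rewrite !hornerE.
  have [p0 <-] := @val_prod _ _ wV _ (mask m zs') (fun y => t - y)
    (fun y yt => branch_neq zsE' tt (mem_mask yt)).
  rewrite qtE (val_mul wV) //.
  by apply: contraNneq nz => l0; rewrite qtE l0 mul0r.
rewrite !wE //; congr (_ + _); rewrite big_seq [RHS]big_seq; apply: eq_bigr => y /mem_mask yt.
exact: shared_closest_sub zsE zsE' tht tht' cl cl' yt.
Qed.

(** The sum is the value of the norm of [q], which lies in D, where all values are
    at most 0. The norms of [q] and of its cofactor multiply to a power of t - c,
    of value 0, so both values vanish. *)
Lemma sum_branches_divisor c (q r : {poly A}) : q * r = G - (c%:MP)%:P ->
  \sum_(th <- ths) w (evalL q th) = 0.
Proof.
have norm_le0 (p : {poly A}) : {in ths, forall th, evalL p th != 0} ->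
    \sum_(th <- ths) w (evalL p th) <= 0.
  move=> p0; have [chi chiE] := conjugate_product (map_poly lift_coef p) thsE.
  have [nz <-] := @val_prod _ _ wV _ ths (fun th => evalL p th) p0.
  have E : j chi.[0] * (-1) ^+ size ths = \prod_(th <- ths) evalL p th.
    have -> : j chi.[0] = \prod_(th <- ths) - evalL p th.
      rewrite -horner_map rmorph0 chiE horner_prod; apply: eq_bigr => th _.
      by rewrite !hornerE -map_poly_comp.
    have -> : \prod_(th <- ths) - evalL p th = (-1) ^+ size ths * \prod_(th <- ths) evalL p th.
      elim: (ths) => [|t s IH]; first by rewrite !big_nil mulr1.
      by rewrite !big_cons IH /= exprS; ring.
    by rewrite mulrAC -exprD addnn -mul2n exprM sqrrN expr1n expr1n mul1r.
  have m0 : (-1) ^+ size ths != 0 :> L by rewrite expf_neq0 // oppr_eq0 oner_neq0.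
  have c0 : j chi.[0] != 0 by apply: contraNneq nz => c0; rewrite -E c0 mul0r.
  rewrite -E (val_mul wV) // (val_exp wV) ?oppr_eq0 ?oner_neq0 //.
  rewrite (valN wV) (val1 wV) mul0rn addr0 wj; last by rewrite -(raddf_eq0 _ jI).
  by apply: deg_val_le0; rewrite -(raddf_eq0 _ jI).
move=> qE; have q0 : {in ths, forall th, evalL q th != 0} by move=> th tht; apply: evalL_neq0 tht qE.
have r0 : {in ths, forall th, evalL r th != 0}.
  by move=> th tht; apply: (@evalL_neq0 c r q) => //; rewrite mulrC.
have : \sum_(th <- ths) w (evalL q th) + \sum_(th <- ths) w (evalL r th) = 0.
  rewrite -big_split /= big_seq big1 // => th tht.
  rewrite -(val_mul wV) ?q0 ?r0 // -evalLM qE evalL_fibre evalL_generic //.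
  exact: (w_generic_sub c).1.
have := norm_le0 _ q0; have := norm_le0 _ r0; lra.
Qed.

(** The substitution H -> H(G). *)
Definition pencil : {poly K} -> {poly A} :=
  horner_eval G \o map_poly (polyC \o @mpolyC n K).
HB.instance Definition _ := GRing.RMorphism.on pencil.

Lemma pencilC c : pencil c%:P = (c%:MP)%:P.
Proof. by rewrite /pencil /= map_polyC /horner_eval hornerC. Qed.

Lemma pencilX : pencil 'X = G.
Proof. by rewrite /pencil /= map_polyX /horner_eval hornerX. Qed.

(** The coefficients of the characteristic polynomial of [P] modulo G - t have
    value at least 0, that is, degree at most 0 in x: they belong to K[t]. The
    identity of Cayley and Hamilton, specialized at t = G, then shows that [P] is
    integral over K[G]. *)
Lemma integral_of_nonneg (P : {poly A}) :
  {in ths, forall th, val_ge 0 (evalL P th)} -> integralOver pencil P.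
Proof.
move=> P0; have [chi chiE] := conjugate_product (map_poly lift_coef P) thsE.
have evE th : (map_poly j (map_poly lift_coef P)).[th] = evalL P th by rewrite -map_poly_comp.
have lead_j p : j (lead_coef p) = lead_coef (map_poly j p).
  by rewrite lead_coef_map_inj // rmorph0.
have chi_monic : chi \is monic.
  rewrite monicE -(inj_eq jI) lead_j chiE rmorph1.
  by rewrite (monicP (monic_prod_XsubC _ _ _)).
have chi_ge0 i : val_ge 0 (j chi`_i).
  rewrite -coef_map chiE; elim: (ths) P0 i => [|th s IH] P0 i.
    by rewrite big_nil coef1; case: eqP => _; [right; rewrite (val1 wV)|left].
  have {}IH := IH (fun t ts => P0 t (mem_behead (s := th :: s) ts)).
  rewrite big_cons mulrBl coefB coefXM coefCM.
  apply: val_geD; first by case: eqP => // _; left.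
  apply: val_geN; rewrite -[0]addr0; apply: val_geM => //.
  by rewrite evE; apply: P0; rewrite mem_head.
have chi_const i : chi`_i = ((chi`_i)@_0)%:MP.
  have [->|ci] := eqVneq chi`_i 0; first by rewrite mcoeff0 mpolyC0.
  case: (chi_ge0 i) => [/eqP|]; first by rewrite raddf_eq0 // (negbTE ci).
  by rewrite wj // => /deg_val_ge0.
pose chi0 := map_poly (mcoeff 0%MM) chi.
have chi0E : map_poly (@mpolyC n {poly K}) chi0 = chi.
  by apply/polyP => i; rewrite coef_map coef_map_id0 ?mcoeff0 //= -chi_const.
(* [chi0] is [chi] with its coefficients read in K[t]. *)
clearbody chi0; exists chi0.
  have CI : injective (@mpolyC n {poly K}) := can_inj (@mpolyCK n {poly K}).
  rewrite monicE -(inj_eq CI) mpolyC1.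
  by rewrite -(lead_coef_map_inj CI (mpolyC0 _ _)) chi0E (monicP chi_monic).
pose PD := map_poly lift_coef P.
have GD_monic : generic_fibre \is monic.
  by rewrite monicE -(inj_eq jI) lead_j thsE rmorph1 (monicP (monic_prod_XsubC _ _ _)).
have dvdL : map_poly j generic_fibre %| map_poly j (map_poly polyC chi).[PD].
  rewrite -horner_map /= -map_poly_comp.
  have -> : map_poly (map_poly j \o polyC) chi = map_poly polyC (map_poly j chi).
    by rewrite -map_poly_comp; apply: eq_map_poly => x /=; rewrite map_polyC.
  rewrite chiE thsE rmorph_prod horner_prod; elim: (ths) => [|th s IH].
    by rewrite !big_nil dvdpp.
  rewrite !big_cons dvdp_mul // rmorphB /= map_polyX map_polyC /= !hornerE.
  by rewrite dvdp_XsubCl /root !hornerE subrr.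
have [W WE] := monic_dvd_descent jI GD_monic dvdL.
(* The specialization t = G, Y = y. *)
pose H : {rmorphism {poly D} -> {poly A}} :=
  horner_eval 'X \o map_poly (mmap pencil (fun i => ('X_i)%:P)).
have HA (p : {poly A}) : H (map_poly lift_coef p) = p.
  rewrite /H /= -map_poly_comp -[RHS]/(idfun p); move: p.
  apply: (@poly_morph_eq _ _ (horner_eval 'X \o map_poly (mmap pencil (fun i => ('X_i)%:P) \o lift_coef)) idfun) => [c|] /=.
    rewrite map_polyC /horner_eval hornerC /=.
    move: c; apply: (@mpoly_morph_eq _ _ _ (mmap pencil (fun i => ('X_i)%:P) \o lift_coef) polyC) => [c|i] /=.
      by rewrite /lift_coef map_mpolyC [LHS]mmapC; apply: pencilC.
    by rewrite /lift_coef map_mpolyX [LHS]mmapX mmap1U.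
  by rewrite map_polyX /horner_eval hornerX.
have HC (c : {poly K}) : H (c%:MP)%:P = pencil c.
  by rewrite /H /= map_polyC /horner_eval hornerC; apply: mmapC.
have HG : H generic_fibre = 0.
  by rewrite rmorphB HA HC pencilX subrr.
apply/rootP; have := congr1 H WE; rewrite rmorphM HG mulr0 => <-.
rewrite -horner_map HA -chi0E -!map_poly_comp; congr (_.[_]).
by apply: eq_map_poly => c; apply: (esym (HC c)).
Qed.

End Branches.

(** * Total reducibility of a monic pencil *)
Lemma monic_sub_const (R : nzRingType) (p : {poly R}) (c : R) :
  (1 < size p)%N -> p \is monic -> p - c%:P \is monic.
Proof.
move=> sp; rewrite !monicE lead_coefDl // size_polyN.
by rewrite (leq_ltn_trans (size_polyC_leq1 _)).
Qed.

Lemma monic_divisor_splits (L : fieldType) (p : {poly L}) (a : L) (rs : seq L) :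
  p \is monic -> a != 0 -> p %| a *: \prod_(r <- rs) ('X - r%:P) ->
  exists s, p = \prod_(r <- s) ('X - r%:P).
Proof.
move=> pM a0; rewrite dvdpZr // => /dvdp_prod_XsubC[m].
by rewrite eqp_monic ?monic_prod_XsubC // => /eqP ->; exists (mask m rs).
Qed.

Lemma branches_exist (K : closedFieldType) n (G : {poly {mpoly K[n]}}) (cs : seq K) :
  G \is monic -> (1 < size G)%N ->
  exists (L : fieldType) (j : {rmorphism {mpoly {poly K}[n]} -> L}) (w : L -> rat),
    [/\ injective j, valuation w, forall d, d != 0 -> w (j d) = deg_val d,
        exists ths, map_poly j (generic_fibre G) = \prod_(th <- ths) ('X - th%:P) &
        {in cs, forall c, exists zs, fibre_roots G j c zs}].
Proof.
move=> GM sG; have [v [vV vE]] := valuation_fraction (@deg_val_valuation {poly K} n).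
pose T : {rmorphism {mpoly {poly K}[n]} -> {fraction {mpoly {poly K}[n]}}} := @FracField.tofrac _.
have TI : injective T by move=> x y /eqP; rewrite tofrac_eq => /eqP.
have sub_monic (R : nzRingType) (f : {rmorphism {mpoly K[n]} -> R}) (c : R) :
    map_poly f G - c%:P \is monic.
  apply: monic_sub_const; last exact: monic_map.
  by rewrite size_map_poly_id0 // (monicP GM) rmorph1 oner_neq0.
have fibE (R : nzRingType) (f : {rmorphism {mpoly K[n]} -> R}) c :
    map_poly f (G - (c%:MP)%:P) = map_poly f G - (f c%:MP)%:P.
  by rewrite rmorphB /= map_polyC.
pose F (c : K) := map_poly (@lift_coef K n) (G - (c%:MP)%:P).
have FM c : F c \is monic by rewrite /F fibE sub_monic.
pose p := generic_fibre G * \prod_(c <- cs) F c.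
have pM : p \is monic by rewrite monicMl ?sub_monic // monic_prod.
have [|L [j [w [wV wE [rs rsE]]]]] := @valued_splitting _ v (map_poly T p) vV.
  by rewrite monic_neq0 // monic_map.
have jTI : injective (j \o T) by apply: inj_comp => //; apply: fmorph_inj.
have splits q : q \is monic -> (exists r, p = q * r) ->
    exists s, map_poly (j \o T) q = \prod_(r <- s) ('X - r%:P).
  move=> qM [r pE]; apply: (@monic_divisor_splits _ _ (j (lead_coef (map_poly T p))) rs).
  - exact: monic_map.
  - by rewrite fmorph_eq0 lead_coef_eq0 monic_neq0 // monic_map.
  by rewrite -rsE -map_poly_comp pE rmorphM dvdp_mulr.
exists L, (j \o T), w; split=> //.
- move=> d d0 /=; rewrite wE ?vE //.
  by rewrite tofrac_eq0.
- by apply: splits; [apply: sub_monic|exists (\prod_(c <- cs) F c)].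
move=> c cc; have [|s sE] := splits (F c) (FM c).
  by exists (generic_fibre G * \prod_(x <- rem c cs) F x); rewrite /p (big_rem c cc) /= mulrCA.
by exists s; rewrite /fibre_roots map_poly_comp.
Qed.

(** A matrix with a nonzero vector in its right kernel does not have full column
    rank, hence its rows, at least as many as its columns, are dependent; the
    denominators are cleared. *)
Lemma integer_relation (N s : nat) (V : 'M[rat]_(N, s)) (m : 'cV[rat]_s) :
  V *m m = 0 -> m != 0 -> (s <= N)%N ->
  exists b : 'I_N -> int, (exists i, b i != 0) /\
    forall k, \sum_i (b i)%:~R * V i k = 0.
Proof.
move=> Vm m0 sN; have rm : (0 < \rank m)%N by rewrite lt0n mxrank_eq0.
have rV : (\rank V < N)%N.
  have := mulmx0_rank_max Vm; lia.
have : kermx V != 0 by rewrite kermx_eq0 /row_free neq_ltn rV.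
case/rowV0Pn => a /sub_kermxP aV a0.
pose b i := numq (a 0 i) * \prod_(k | k != i) denq (a 0 k).
pose d := \prod_k denq (a 0 k).
have bE i : (b i)%:~R = d%:~R * a 0 i :> rat.
  by rewrite /b /d [in RHS](bigD1 i) //= !intrM numqE; ring.
have d0 : d%:~R != 0 :> rat.
  by rewrite intr_eq0; apply/prodf_neq0 => k _; rewrite denq_neq0.
exists b; split.
  have /rV0Pn[i ai] := a0; exists i.
  by rewrite -(intr_eq0 rat) bE mulf_neq0.
move=> k; have /rowP/(_ k) := aV; rewrite !mxE => E.
rewrite -[RHS](mulr0 d%:~R) -[X in _ = _ * X]E mulr_sumr.
by apply: eq_bigr => i _; rewrite bE mulrA.
Qed.

Lemma mult_uniq (R : idomainType) (q x y : R) k l :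
  q != 0 -> ~ divides q x -> ~ divides q y -> q ^+ k * x = q ^+ l * y -> k = l.
Proof.
move=> q0; wlog kl : k l x y / (k <= l)%N.
  move=> H nx ny E; have [kl|/ltnW lk] := leqP k l; first exact: H E.
  by apply/esym; apply: H (esym E).
move=> nx ny; rewrite -(subnK kl) exprD [_ * q ^+ k]mulrC -mulrA.
move/(mulfI (expf_neq0 k q0)); case: (l - k)%N => [|i]; first by [].
by rewrite exprSr mulrAC => xE; case: nx; exists (q ^+ i * y).
Qed.

(** For c in [cs], [Q c] lists the prime factors of the fibre G - c and [e c] gives
    their multiplicities. *)
Section MonicPencil.
Variables (K : closedFieldType) (n : nat) (G : {poly {mpoly K[n]}}).
Hypotheses (GM : G \is monic) (sG : (1 < size G)%N).
Hypothesis pencil_closed : forall P, integralOver (pencil G) P -> exists H, P = pencil G H.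
Variables (cs : seq K) (Q : K -> seq {poly {mpoly K[n]}}) (e : K -> {poly {mpoly K[n]}} -> nat).
Hypothesis cs_uniq : uniq cs.
Hypothesis Q_uniq : forall c, c \in cs -> uniq (Q c).
Hypothesis Q_irr : forall c, c \in cs -> {in Q c, forall q, irreducible q}.
Hypothesis Q_distinct : forall c, c \in cs -> {in Q c &, forall q r, divides q r -> q = r}.
Hypothesis e_gt0 : forall c, c \in cs -> {in Q c, forall q, (0 < e c q)%N}.
Hypothesis QE : forall c, c \in cs -> exists2 k : K, k != 0 &
  G - (c%:MP)%:P = (k%:MP)%:P * \prod_(q <- Q c) q ^+ e c q.

Local Notation A := {mpoly K[n]}.

Let fA : factorial_domain {poly A} := factorial_poly (@factorial_mpoly K n).

Lemma Q_prime c q : c \in cs -> q \in Q c -> prime_elt q.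
Proof. by move=> cc qc; apply: factorial_irreducible_prime => //; apply: Q_irr qc. Qed.

Lemma const_unit (k : K) : k != 0 -> (k%:MP)%:P \is a @GRing.unit {poly A}.
Proof.
move=> k0; apply/unitrPr; exists (k^-1%:MP)%:P.
by rewrite -polyCM -mpolyCM divff.
Qed.

Lemma prime_not_unit (R : idomainType) (q u : R) : prime_elt q -> u \is a GRing.unit -> ~ divides q u.
Proof.
case=> _ /negP qU _ uU [x uE]; apply: qU; move: uU.
by rewrite uE unitrM => /andP[].
Qed.

Lemma Q_divides c q : c \in cs -> q \in Q c -> exists r, q * r = G - (c%:MP)%:P.
Proof.
move=> cc qc; have [k k0 E] := QE cc.
rewrite E (big_rem _ qc) /= -(prednK (e_gt0 cc qc)) exprS.
set r := \prod_(_ <- _) _; exists ((k%:MP)%:P * (q ^+ (e c q).-1 * r)).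
by rewrite mulrCA -!mulrA.
Qed.

Lemma fibres_coprime c c' q : c' != c -> c \in cs -> q \in Q c -> ~ divides q (G - (c'%:MP)%:P).
Proof.
move=> cc' cc qc [x xE]; have [r rE] := Q_divides cc qc.
apply: (@prime_not_unit _ q ((c' - c)%:MP)%:P (Q_prime cc qc)).
  by apply: const_unit; rewrite subr_eq0.
exists (r - x); rewrite mulrBl [r * q]mulrC rE -xE mpolyCB polyCB.
by ring.
Qed.

Lemma Q_disjoint c c' q : c \in cs -> c' \in cs -> q \in Q c -> q \in Q c' -> c' = c.
Proof.
move=> cc cc' qc qc'; apply/eqP; apply: contraT => ne.
case: (fibres_coprime ne cc qc); have [r <-] := Q_divides cc' qc'.
by exists r; rewrite mulrC.
Qed.

(** The exact power of [q] in a product of powers of the primes of [Q c]. *)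
Lemma Q_exact (m : {poly A} -> nat) c q : c \in cs -> q \in Q c ->
  exists x, ~ divides q x /\ \prod_(r <- Q c) r ^+ m r = q ^+ m q * x.
Proof.
move=> cc qc; exists (\prod_(r <- rem q (Q c)) r ^+ m r); split; last by rewrite (big_rem _ qc).
case/(prime_prod (Q_prime cc qc)) => r.
rewrite mem_rem_uniq ?Q_uniq // inE => /andP[/eqP rq rc].
move/(prime_exp (Q_prime cc qc)) => qr; apply: rq.
exact/esym/(Q_distinct cc qc rc qr).
Qed.

(** One prime factor of each fibre is left out: it is determined by the others
    modulo the fibre itself. *)
Definition free_factors : seq {poly A} := flatten [seq behead (Q c) | c <- cs].

Lemma free_factorsP q : q \in free_factors -> exists2 c, c \in cs & q \in behead (Q c).
Proof. by case/flatten_mapP => c cc qc; exists c. Qed.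

Lemma head_notin_free c : c \in cs -> (head 0 (Q c)) \in Q c -> head 0 (Q c) \notin free_factors.
Proof.
move=> cc hc; apply/negP => /free_factorsP[c' cc' qc'].
have c'E := Q_disjoint cc cc' hc (mem_behead qc').
move: (Q_uniq cc) qc'; rewrite c'E; case: (Q c) => [|x l] //=.
by case/andP => /negP.
Qed.

Lemma free_factors_uniq : uniq free_factors.
Proof.
suff gen s : uniq s -> {subset s <= cs} -> uniq (flatten [seq behead (Q c) | c <- s]).
  exact: gen.
elim: s => // c s IH /= /andP[cs' us] sub; rewrite cat_uniq IH //; last first.
  by move=> x xs; apply: sub; rewrite inE xs orbT.
have cc : c \in cs by apply: sub; rewrite mem_head.
rewrite andbT; apply/andP; split.
  by have := Q_uniq cc; case: (Q c) => //= x l /andP[].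
apply/hasPn => q /flatten_mapP[c' c's qc']; apply/negP => qc.
have cc' : c' \in cs by apply: sub; rewrite inE c's orbT.
have c'E := Q_disjoint cc cc' (mem_behead qc) (mem_behead qc').
by rewrite -c'E c's in cs'.
Qed.

Lemma size_free_factors : size free_factors = (\sum_(c <- cs) (size (Q c)).-1)%N.
Proof.
rewrite /free_factors size_flatten /shape -map_comp sumnE big_map.
by apply: eq_bigr => c _ /=; rewrite size_behead.
Qed.

Lemma size_prod_leq (R : idomainType) (I : Type) (s : seq I) (F : I -> {poly R}) :
  (size (\prod_(i <- s) F i)%R <= (\sum_(i <- s) (size (F i)).-1).+1)%N.
Proof.
elim: s => [|i s IH]; first by rewrite !big_nil size_poly1.
rewrite !big_cons (leq_trans (size_polyMleq _ _)) //; lia.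
Qed.

Section Relation.
Variables (L : fieldType) (j : {rmorphism {mpoly {poly K}[n]} -> L}) (w : L -> rat).
Hypotheses (jI : injective j) (wV : valuation w).
Hypothesis wj : forall d, d != 0 -> w (j d) = deg_val d.
Variable ths : seq L.
Hypothesis thsE : map_poly j (generic_fibre G) = \prod_(th <- ths) ('X - th%:P).
Hypothesis roots : {in cs, forall c, exists zs, fibre_roots G j c zs}.

Lemma ths_neq0 : ths != [::].
Proof.
apply/eqP => ths0; have := congr1 (fun p : {poly L} => size p) thsE.
rewrite ths0 big_nil size_poly1 (size_map_inj_poly jI (rmorph0 j)).
have sE : size (map_poly (@lift_coef K n) G) = size G.
  by rewrite size_map_poly_id0 // (monicP GM) rmorph1 oner_neq0.
rewrite /generic_fibre size_polyDl ?sE ?size_polyN; last first.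
  by rewrite (leq_ltn_trans (size_polyC_leq1 _)).
by move=> sG1; move: sG; rewrite sG1.
Qed.

Lemma roots_neq0 c zs : fibre_roots G j c zs -> zs != [::].
Proof.
move=> zsE; apply/eqP => zs0; have := congr1 (fun p : {poly L} => size p) zsE.
have GcM := @monic_sub_const _ G c%:MP sG GM.
rewrite zs0 big_nil size_poly1 size_map_poly_id0 ?(monicP GcM) ?rmorph1 ?oner_neq0 //.
rewrite size_polyDl ?size_polyN ?(leq_ltn_trans (size_polyC_leq1 _)) //.
by move=> sG1; move: sG; rewrite sG1.
Qed.

(** The distinct roots of G = c are roots of the product of the distinct prime
    factors of G - c. *)
Lemma distinct_roots_le c zs : c \in cs -> fibre_roots G j c zs ->
  (size (undup zs) <= \sum_(q <- Q c) (size q).-1)%N.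
Proof.
move=> cc zsE; pose emb := map_poly (j \o @lift_coef K n).
have [k k0 E] := QE cc.
have EE : \prod_(z <- zs) ('X - z%:P) = emb (k%:MP)%:P * \prod_(q <- Q c) emb q ^+ e c q.
  rewrite -zsE E rmorphM rmorph_prod; congr (_ * _).
  by apply: eq_bigr => q _; rewrite rmorphXn.
pose Rad := \prod_(q <- Q c) emb q.
have emb0 q : q \in Q c -> emb q != 0.
  move=> qc; apply: contraTneq (monic_neq0 (monic_prod_XsubC zs xpredT id)) => q0.
  rewrite negbK EE (big_rem _ qc) /= q0 expr0n gtn_eqF ?e_gt0 //.
  by rewrite mul0r mulr0.
have Rad0 : Rad != 0.
  rewrite /Rad big_seq; elim/big_ind: _ => [||q qc]; first exact: oner_neq0.
    by move=> x y; apply: mulf_neq0.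
  exact: emb0.
have : (size (undup zs) < size Rad)%N.
  apply: max_poly_roots => //; last exact: undup_uniq.
  apply/allP => z; rewrite mem_undup => zt.
  have : root (\prod_(z <- zs) ('X - z%:P)) z by rewrite root_prod_XsubC.
  rewrite EE rootM => /orP[|].
    by rewrite /emb map_polyC /= /root hornerC raddf_eq0 // /lift_coef map_mpolyC
      mpolyC_eq0 polyC_eq0 (negbTE k0).
  rewrite /Rad; elim: (Q c) => [|q s IH]; first by rewrite !big_nil.
  rewrite !big_cons !rootM => /orP[qz|/IH->]; last by rewrite orbT.
  by move: qz; rewrite /root horner_exp expf_eq0 => /andP[_ ->].
move=> lt; rewrite -ltnS (leq_trans lt) // (leq_trans (size_prod_leq _ _)) // ltnS.
apply: leq_sum => q _; rewrite -!subn1 leq_sub2r //; exact: size_poly.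
Qed.

(** If there are at least s(c0) free factors, the matrix of their values has at
    least as many rows as columns: one column for each distinct root [eta] of
    G = c0, with the values at a branch closest to [eta]. The columns satisfy the
    relation [m] in which [eta] is weighted by the number of branches closest to
    it, because the sum over all branches vanishes. *)
Lemma branch_relation c0 : c0 \in cs ->
  (\sum_(q <- Q c0) (size q).-1 <= size free_factors)%N ->
  exists b : {poly A} -> int, [/\ exists2 q, q \in free_factors & b q != 0,
    forall q, q \notin free_factors -> b q = 0 &
    {in ths, forall th, \sum_(q <- free_factors) (b q)%:~R * w (evalL j q th) = 0}].
Proof.
move=> c0c le; have [zs zsE] := roots c0c.
have [kap kapP] := choice (fun th => closest_exists w th (roots_neq0 zsE)).
set etas := undup zs; set s := size etas; set N := size free_factors in le *.
have kap_in th : kap th \in etas by rewrite mem_undup; have [] := kapP th.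
have kap_lt th : (index (kap th) etas < s)%N by rewrite index_mem.
pose ix th : 'I_s := Ordinal (kap_lt th).
pose q_ i := nth 0 free_factors i.
pose rep (k : 'I_s) := nth 0 ths (find (fun th => ix th == k) ths).
pose V := \matrix_(i < N, k < s)
  if has (fun th => ix th == k) ths then w (evalL j (q_ i) (rep k)) else 0.
pose m := \col_(k < s) (\sum_(th <- ths) (ix th == k)%:R : rat).
have qP (i : 'I_N) : exists2 c, c \in cs & q_ i \in Q c.
  have /free_factorsP[c cc qc] : q_ i \in free_factors by apply: mem_nth.
  by exists c => //; apply: mem_behead.
have VE (i : 'I_N) th : th \in ths -> V i (ix th) = w (evalL j (q_ i) th).
  move=> tht; have hth : has (fun t => ix t == ix th) ths by apply/hasP; exists th.
  rewrite mxE hth; have [c cc qc] := qP i.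
  have [r rE] := Q_divides cc qc; have [zs' zsE'] := roots cc.
  have rt : rep (ix th) \in ths by apply: mem_nth; rewrite -has_find.
  apply: (shared_closest_divisor jI wV wj thsE zsE zsE' rt tht _ (kapP th) rE).
  have /eqP/(congr1 val)/= := nth_find 0 hth; rewrite -/(rep (ix th)) => E.
  suff <- : kap (rep (ix th)) = kap th by apply: kapP.
  by rewrite -(nth_index 0 (kap_in (rep (ix th)))) E nth_index.
have Vm : V *m m = 0.
  apply/matrixP => i z; rewrite mxE [RHS]mxE.
  have [c cc qc] := qP i; have [r rE] := Q_divides cc qc.
  rewrite -[RHS](sum_branches_divisor jI wV wj thsE rE).
  under eq_bigr => k _ do rewrite [m k z]mxE mulr_sumr.
  rewrite exchange_big /= big_seq [RHS]big_seq; apply: eq_bigr => th tht.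
  rewrite (bigD1 (ix th)) //= eqxx mulr1 VE // big1 ?addr0 // => k kt.
  by rewrite eq_sym (negbTE kt) mulr0.
have m0 : m != 0.
  have [th tht] : exists th, th \in ths.
    by move: ths_neq0; case: (ths) => // t l _; exists t; rewrite mem_head.
  apply/negP => /eqP/matrixP/(_ (ix th) 0)/eqP; rewrite !mxE (big_rem _ tht) /= eqxx.
  by apply/negP; rewrite gt_eqF // ltr_pwDl ?ltr01 // sumr_ge0 // => t _; rewrite ler0n.
have sN : (s <= N)%N := leq_trans (distinct_roots_le c0c zsE) le.
have [b [[i bi] bV]] := integer_relation Vm m0 sN.
have inN q : q \in free_factors -> (index q free_factors < N)%N by rewrite index_mem.
(* The relation as a function on polynomials, zero outside the free factors. *)
pose b' q := if insub (index q free_factors) is Some k then b k else 0.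
have b'E (k : 'I_N) : b' (q_ k) = b k.
  rewrite /b' index_uniq ?free_factors_uniq // insubT ?ltn_ord // => h.
  by congr b; apply: val_inj.
exists b'; split.
- by exists (q_ i); [apply: mem_nth|rewrite b'E].
- by move=> q qn; rewrite /b' insubN // index_mem qn.
move=> th tht; rewrite -[RHS](bV (ix th)) (big_nth 0) big_mkord.
by apply: eq_bigr => k _; rewrite b'E VE.
Qed.

End Relation.

(** Otherwise [branch_relation] provides exponents b. The product P of the
    q^(M e(q) + b(q)) over all prime factors q of all fibres in [cs], where M makes
    the exponents nonnegative, has value 0 at every branch; hence it lies in
    K[G] and is a product of fibres. Unique factorization then gives
    M e(q) + b(q) = k e(q), where k depends only on the fibre; the factor left out
    has b = 0, so k = M and b = 0. *)
Lemma monic_total_reducibility_bound c0 : c0 \in cs ->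
  (\sum_(c <- cs) (size (Q c)).-1 < \sum_(q <- Q c0) (size q).-1)%N.
Proof.
move=> c0c; rewrite ltnNge -size_free_factors; apply/negP => le.
have [L [j [w [jI wV wj [ths thsE] roots]]]] := branches_exist cs GM sG.
have [b [[q1 q1f bq1] bn bE]] := branch_relation jI wV wj thsE roots c0c le.
pose M := (\sum_(q <- free_factors) absz (b q))%N.
pose N c q := absz ((M * e c q)%N%:Z + b q).
have b_le q : (absz (b q) <= M)%N.
  have [qf|qf] := boolP (q \in free_factors); last by rewrite bn.
  by rewrite /M (big_rem _ qf) /= leq_addr.
have NE c q : c \in cs -> q \in Q c -> (N c q)%:Z = (M * e c q)%N%:Z + b q.
  move=> cc qc; have := b_le q; have := e_gt0 cc qc; rewrite /N => e0 bM.
  have : (absz (b q) <= M * e c q)%N by rewrite (leq_trans bM) // leq_pmulr.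
  lia.
pose P := \prod_(c <- cs) \prod_(q <- Q c) q ^+ N c q.
have ev0 c q th : c \in cs -> q \in Q c -> th \in ths -> evalL j q th != 0.
  move=> cc qc tht; have [r rE] := Q_divides cc qc.
  exact: (evalL_neq0 jI wj thsE tht rE).
have evP th : th \in ths -> evalL j P th = \prod_(c <- cs) \prod_(q <- Q c) evalL j q th ^+ N c q.
  move=> tht; rewrite /evalL rmorph_prod horner_prod; apply: eq_bigr => c _.
  rewrite rmorph_prod horner_prod; apply: eq_bigr => q _.
  by rewrite rmorphXn /= horner_exp.
have val_fibre_prod c (m : {poly A} -> nat) th : c \in cs -> th \in ths ->
    \prod_(q <- Q c) evalL j q th ^+ m q != 0 /\
    w (\prod_(q <- Q c) evalL j q th ^+ m q) = \sum_(q <- Q c) (m q)%:R * w (evalL j q th).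
  move=> cc tht; have [|nz ->] := @val_prod _ _ wV _ (Q c) (fun q => evalL j q th ^+ m q).
    by move=> q qc; rewrite expf_neq0 // (ev0 c).
  split=> //; rewrite big_seq [RHS]big_seq; apply: eq_bigr => q qc.
  by rewrite (val_exp wV) ?(ev0 c) // mulr_natl.
have fibre0 c th : c \in cs -> th \in ths -> \sum_(q <- Q c) (e c q)%:R * w (evalL j q th) = 0.
  move=> cc tht; have [nz <-] := val_fibre_prod c (e c) th cc tht.
  have [k k0 E] := QE cc.
  have [wt _] := w_generic_sub jI wj c.
  have prodE : evalL j (\prod_(q <- Q c) q ^+ e c q) th = \prod_(q <- Q c) evalL j q th ^+ e c q.
    rewrite /evalL rmorph_prod horner_prod; apply: eq_bigr => q _.
    by rewrite rmorphXn /= horner_exp.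
  have kE : evalL j (k%:MP)%:P th = j (k%:P)%:MP.
    by rewrite /evalL map_polyC hornerC /= /lift_coef map_mpolyC.
  have kp : k%:P%:MP != 0 :> {mpoly {poly K}[n]} by rewrite mpolyC_eq0 polyC_eq0.
  move: wt; rewrite -(evalL_generic thsE tht) -evalL_fibre E evalLM kE prodE.
  have jk0 : j k%:P%:MP != 0 by rewrite raddf_eq0.
  rewrite (val_mul wV jk0 nz) => <-.
  by rewrite wj // deg_valC ?polyC_eq0 // add0r.
have wP th : th \in ths -> val_ge w 0 (evalL j P th).
  move=> tht; right; rewrite evP //.
  have [|_ ->] := @val_prod _ _ wV _ cs (fun c => \prod_(q <- Q c) evalL j q th ^+ N c q).
    by move=> c cc; have [] := val_fibre_prod c (N c) th cc tht.
  suff -> : \sum_(c <- cs) w (\prod_(q <- Q c) evalL j q th ^+ N c q) = 0 by [].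
  have wN c : c \in cs -> w (\prod_(q <- Q c) evalL j q th ^+ N c q) =
      \sum_(q <- behead (Q c)) (b q)%:~R * w (evalL j q th).
    move=> cc; have [_ ->] := val_fibre_prod c (N c) th cc tht.
    transitivity (\sum_(q <- Q c) (M%:R * ((e c q)%:R * w (evalL j q th)) + (b q)%:~R * w (evalL j q th))).
      rewrite big_seq [RHS]big_seq; apply: eq_bigr => q qc.
      rewrite -[(N c q)%:R]/((N c q)%:Z%:~R) NE // rmorphD /= -[(_ * _)%N%:Z%:~R]/((M * e c q)%:R) natrM.
      by ring.
    rewrite big_split /= -mulr_sumr fibre0 // mulr0 add0r.
    move: (@head_notin_free c cc); case: (Q c) => [|h l] hn; first by [].
    by rewrite big_cons /= bn ?mul0r ?add0r // hn // mem_head.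
  rewrite (eq_big_seq _ wN) -[RHS](bE th tht) /free_factors.
  by rewrite big_flatten big_map.
have [H HE] := pencil_closed (integral_of_nonneg jI wV wj thsE wP).
have [rs HrE] := closed_field_poly_normal H.
have pE : P = pencil G (lead_coef H)%:P * \prod_(r <- rs) (G - (r%:MP)%:P).
  rewrite HE [in LHS]HrE -mul_polyC rmorphM rmorph_prod; congr (_ * _).
  by apply: eq_bigr => r _; rewrite [LHS]rmorphB /= pencilX pencilC.
have P0 : P != 0.
  have [th tht] : exists th, th \in ths.
    by move: (ths_neq0 jI thsE); case: (ths) => // t l _; exists t; rewrite mem_head.
  apply: contraTneq isT => P0; have := evP th tht; rewrite P0 /evalL rmorph0 horner0 => /esym/eqP.
  have [|nz _] := @val_prod _ _ wV _ cs (fun c => \prod_(q <- Q c) evalL j q th ^+ N c q).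
    by move=> c cc; have [] := val_fibre_prod c (N c) th cc tht.
  by rewrite (negbTE nz).
have H0 : lead_coef H != 0.
  by apply: contra_neq P0 => H0; rewrite pE H0 rmorph0 mul0r.
(* The exponent of [q] in P, read from the two factorizations of P. *)
have expE c q : c \in cs -> q \in Q c -> N c q = (count_mem c rs * e c q)%N.
  move=> cc qc; have qP := Q_prime cc qc; have [q0 qU qD] := qP.
  have [x [qx xE]] := Q_exact (N c) cc qc.
  have [y [qy yE]] := Q_exact (e c) cc qc.
  have [k k0 E] := QE cc.
  have kU := const_unit k0.
  have cop c' : c' != c -> ~ divides q (G - (c'%:MP)%:P).
    by move=> ne; apply: fibres_coprime cc qc.
  have notM a d : ~ divides q a -> ~ divides q d -> ~ divides q (a * d).
    by move=> na nd /qD[].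
  have P_left : exists x', ~ divides q x' /\ P = q ^+ N c q * x'.
    exists (x * \prod_(c' <- rem c cs) \prod_(r <- Q c') r ^+ N c' r); split; last first.
      by rewrite /P (big_rem _ cc) /= xE mulrA.
    apply: notM => // /(prime_prod qP)[c']; rewrite mem_rem_uniq // inE => /andP[c'c cc'].
    case/(prime_prod qP) => r rc' /(prime_exp qP) qr.
    have [s sE] := Q_divides cc' rc'; apply: (cop c' c'c); rewrite -sE.
    exact: divides_mulr.
  have P_right : exists y', ~ divides q y' /\ P = q ^+ (count_mem c rs * e c q) * y'.
    rewrite pE; elim: (rs) => [|r l [y' [qy' IH]]].
      rewrite big_nil mulr1 mul0n; exists (pencil G (lead_coef H)%:P); rewrite mul1r; split=> //.
      by rewrite pencilC; apply: prime_not_unit qP (const_unit H0).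
    rewrite big_cons mulrCA IH /=; have [->|rc] := eqVneq r c.
      exists ((k%:MP)%:P * y * y'); split.
        by do 2!apply: (notM) => //; apply: prime_not_unit qP kU.
      rewrite E yE mulnDl mul1n exprD; ring.
    exists ((G - (r%:MP)%:P) * y'); split; first by apply: notM => //; apply: cop.
    by rewrite mulrCA.
  have [x' [qx' PE]] := P_left; have [y' [qy' PE']] := P_right.
  by apply: (mult_uniq q0 qx' qy'); rewrite -PE.
have [c cc q1c] := free_factorsP q1f.
have q1Q := mem_behead q1c.
have hQ : head 0 (Q c) \in Q c by move: q1c; case: (Q c) => // h l _; rewrite mem_head.
have := NE _ _ cc hQ; rewrite bn ?head_notin_free // addr0 (expE c _ cc hQ) => /eqP.
rewrite eqz_nat eqn_pmul2r ?e_gt0 // => /eqP cM.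
have := NE _ _ cc q1Q; rewrite (expE c _ cc q1Q) cM => /eqP.
by rewrite -subr_eq0 opprD addNKr oppr_eq0 (negbTE bq1).
Qed.

End MonicPencil.

(** * Polynomials integral over K[h] *)
(** A version of Luroth's theorem. The integral closure of K[h] in a factorial
    domain [R] embeds, by [phi], into a polynomial ring K[s] in one variable. Its
    image B is integrally closed in K[s], and the minimal polynomial M of s over
    B has coefficients in B; a coefficient [be] of M of maximal degree in s
    generates B. *)
Section Luroth.
Variables (K : closedFieldType) (R : idomainType) (io : {rmorphism K -> R}).
Variable phi : {rmorphism R -> {poly K}}.
Hypotheses (fR : factorial_domain R) (phi_const : forall c, phi (io c) = c%:P).

Definition eval_at (a : R) : {poly K} -> R := horner_eval a \o map_poly io.
HB.instance Definition _ a := GRing.RMorphism.on (eval_at a).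

Lemma eval_atC a c : eval_at a c%:P = io c.
Proof. by rewrite /eval_at /= map_polyC /horner_eval hornerC. Qed.

Lemma eval_atX a : eval_at a 'X = a.
Proof. by rewrite /eval_at /= map_polyX /horner_eval hornerX. Qed.

Lemma phi_eval_at a F : phi (eval_at a F) = F \Po phi a.
Proof.
move: F; apply: (@poly_morph_eq _ _ (phi \o eval_at a) (comp_poly (phi a))) => [c|] /=.
  by rewrite eval_atC comp_polyC phi_const.
by rewrite eval_atX comp_polyX.
Qed.

Variable h : R.
Hypothesis sh : (1 < size (phi h))%N.

Definition integral_h (P : R) : Prop := integralOver (eval_at h) P.

(** An integral equation of least degree for [P] has a nonzero constant term,
    which [phi] would send to 0 along with [P], although [phi h] is not
    constant. *)
Lemma integral_h_inj P : integral_h P -> phi P = 0 -> P = 0.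
Proof.
move=> [p pM pP] P0; apply: contrapT => /eqP Pn0.
have [m] := ubnP (size p); elim: m p pM pP => // m IH p pM pP; rewrite ltnS => sp.
elim/poly_ind: p pM pP sp => [|p c _] pM pP sp; first by move: (monic_neq0 pM); rewrite eqxx.
have E : (map_poly (eval_at h) p).[P] * P + eval_at h c = 0.
  by move/rootP: pP; rewrite rmorphD rmorphM /= map_polyX map_polyC !hornerE.
have c0 : c = 0.
  apply/eqP; rewrite -(comp_poly_eq0 c sh) -phi_eval_at.
  by have := congr1 phi E; rewrite rmorphD rmorphM /= P0 mulr0 add0r rmorph0 => ->.
rewrite c0 addr0 in pM sp; have p0 : p != 0.
  by apply: contraTneq (monic_neq0 pM) => ->; rewrite mul0r eqxx.
apply: (IH p); last by rewrite size_mulX // in sp.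
  by rewrite monicE -(monicP pM) lead_coefM lead_coefX mulr1.
move: E; rewrite c0 rmorph0 addr0 => /eqP; rewrite mulf_eq0 (negbTE Pn0) orbF.
exact.
Qed.

Lemma integral_h_eval P F : integral_h P -> integral_h (eval_at P F).
Proof.
move=> hP; rewrite /integral_h; apply: (@integral_horner _ _ (eval_at h) (map_poly io F)) => //.
apply/integral_poly => i; rewrite coef_map /= -(eval_atC h); exact: integral_id.
Qed.

Lemma integral_h_h : integral_h h.
Proof. by rewrite /integral_h -{2}(eval_atX h); apply: integral_id. Qed.

Lemma integral_h_const c : integral_h (io c).
Proof. by rewrite /integral_h -(eval_atC h c); apply: integral_id. Qed.

(** Factorial domains are integrally closed: the homogenized integral equation
    of a/b makes each prime of b divide a. *)
Lemma factorial_normal (c : nat -> R) (m : nat) (a b : R) : c m = 1 -> b != 0 ->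
  \sum_(i < m.+1) c i * a ^+ i * b ^+ (m - i) = 0 -> divides b a.
Proof.
move=> cm b0; have [u [s [uU sP bE]]] := fR b0.
elim: s sP a b b0 bE => [|q s IH] sP a b b0 bE E.
  by exists (a * u^-1); rewrite bE big_nil mulr1 divrK.
have qP := sP q (mem_head _ _); have [q0 _ _] := qP.
move: bE; rewrite big_cons mulrCA; set b' := u * _ => bE.
have b'0 : b' != 0 by apply: contra_neq b0 => b'0; rewrite bE b'0 mulr0.
have /(prime_exp qP)[a' aE] : divides q (a ^+ m).
  move: E; rewrite big_ord_recr /= subnn mulr1 cm mul1r.
  move/eqP; rewrite addrC addr_eq0 => /eqP ->.
  exists (- \sum_(i < m) c i * a ^+ i * (b' * b ^+ (m - i).-1)).
  rewrite mulNr; congr (- _); rewrite mulr_suml; apply: eq_bigr => i _.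
  have -> : b ^+ (m - i) = b * b ^+ (m - i).-1 by rewrite -exprS prednK // subn_gt0.
  by rewrite {1}bE; ring.
have [||d a'E] := IH _ a' b' b'0 erefl.
- by move=> x xs; apply: sP; rewrite inE xs orbT.
- apply: (mulfI (expf_neq0 m q0)); rewrite mulr0 -[RHS]E mulr_sumr.
  apply: eq_bigr => i _; rewrite aE bE !exprMn.
  have im : (i <= m)%N by rewrite -ltnS.
  have -> : q ^+ m = q ^+ (m - i) * q ^+ i by rewrite -exprD subnK.
  ring.
by exists d; rewrite aE a'E bE; ring.
Qed.

Definition image_h (s : {poly K}) : Prop := exists2 P, integral_h P & phi P = s.

Lemma image_hB s t : image_h s -> image_h t -> image_h (s - t).
Proof.
by move=> [P hP <-] [S hS <-]; exists (P - S); rewrite ?rmorphB //; apply: integral_sub.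
Qed.

Lemma image_hM s t : image_h s -> image_h t -> image_h (s * t).
Proof.
by move=> [P hP <-] [S hS <-]; exists (P * S); rewrite ?rmorphM //; apply: integral_mul.
Qed.

Lemma image_hC c : image_h c%:P.
Proof. by exists (io c); [apply: integral_h_const|apply: phi_const]. Qed.

(** K[s] is integral over K[phi h] because s is a root of phi(h)(T) - phi(h)(s). *)
Lemma integral_all (z : {poly K}) : integralOver (comp_poly (phi h)) z.
Proof.
have X_int : integralOver (comp_poly (phi h)) ('X : {poly K}).
  have l0 : lead_coef (phi h) != 0 by rewrite lead_coef_eq0 -size_poly_gt0 ltnW.
  pose p := (lead_coef (phi h))^-1%:P *: (map_poly polyC (phi h) - 'X%:P).
  exists p.
    rewrite monicE lead_coefZ lead_coefDl; last first.
      by rewrite size_polyN size_map_polyC (leq_ltn_trans (size_polyC_leq1 _)).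
    by rewrite lead_coef_map -polyCM mulVf.
  apply/rootP; rewrite /p -mul_polyC rmorphM rmorphB /= !map_polyC /= comp_polyX comp_polyC.
  rewrite -map_poly_comp hornerM hornerD hornerN !hornerC.
  have -> : map_poly (comp_poly (phi h) \o polyC) (phi h) = map_poly polyC (phi h).
    by apply: eq_map_poly => c /=; rewrite comp_polyC.
  by rewrite -[X in X - _]/(phi h \Po 'X) comp_polyXr subrr mulr0.
rewrite -[z]comp_polyXr; apply: integral_horner => //.
apply/integral_poly => i; rewrite coef_map /= -(comp_polyC _ (phi h)).
exact: integral_id.
Qed.

(** B is integrally closed in K[s]: an integral equation of z = a/b lifts to [R],
    where the quotient of the preimages exists by [factorial_normal]. *)
Lemma image_h_div a b z : image_h a -> image_h b -> b != 0 -> a = b * z -> image_h z.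
Proof.
move=> [a' ha aE] [b' hb bE] b0 abz.
have b'0 : b' != 0 by apply: contra_neq b0 => b'0; rewrite -bE b'0 rmorph0.
have [p pM /rootP pz] := integral_all z.
have sp : (0 < size p)%N by rewrite size_poly_gt0 monic_neq0.
pose m := (size p).-1; have sm : size p = m.+1 by rewrite prednK.
pose c i := eval_at h p`_i.
have cm : c m = 1 by rewrite /c -lead_coefE (monicP pM) rmorph1.
have pE a0 (f : {rmorphism {poly K} -> {poly K}}) : (map_poly f p).[a0] = \sum_(i < m.+1) f p`_i * a0 ^+ i.
  rewrite (@horner_coef_wide _ (size p) (map_poly f p) a0 (size_poly _ _)) sm.
  by apply: eq_bigr => i _; rewrite coef_map.
have hX x k : integral_h x -> integral_h (x ^+ k).
  move=> hx; elim: k => [|k IH]; first exact: integral1.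
  by rewrite exprS; apply: integral_mul.
have E : \sum_(i < m.+1) c i * a' ^+ i * b' ^+ (m - i) = 0.
  apply: integral_h_inj.
    elim/big_ind: _ => [|x y|i _]; [exact: integral0|exact: integral_add|].
    apply: integral_mul; last exact: hX.
    by apply: integral_mul; [apply: integral_id|apply: hX].
  rewrite rmorph_sum /=.
  transitivity (b ^+ m * (map_poly (comp_poly (phi h)) p).[z]); last by rewrite pz mulr0.
  rewrite pE mulr_sumr; apply: eq_bigr => i _.
  rewrite !rmorphM !rmorphXn /= aE bE phi_eval_at abz exprMn.
  have im : (i <= m)%N by rewrite -ltnS.
  have -> : b ^+ m = b ^+ (m - i) * b ^+ i by rewrite -exprD subnK.
  ring.
have [z' a'E] := factorial_normal cm b'0 E.
exists z'; last by apply: (mulfI b0); rewrite -abz -aE a'E rmorphM bE mulrC.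
exists p => //; apply/rootP.
apply: (mulfI (expf_neq0 m b'0)); rewrite mulr0 -[RHS]E.
rewrite (@horner_coef_wide _ (size p) (map_poly (eval_at h) p) z' (size_poly _ _)) sm mulr_sumr.
apply: eq_bigr => i _; rewrite coef_map a'E exprMn /=.
have im : (i <= m)%N by rewrite -ltnS.
have -> : b' ^+ m = b' ^+ (m - i) * b' ^+ i by rewrite -exprD subnK.
by rewrite /c; ring.
Qed.

(** The polynomial p(T) - p(s) in T over K[s]; evaluating it at ['X] sets T = s. *)
Definition diff_poly (p : {poly K}) : {poly {poly K}} := map_poly polyC p - p%:P.

Definition coefs_image (D : {poly {poly K}}) : Prop := forall i, image_h D`_i.

Lemma diff_poly_coefs p : image_h p -> coefs_image (diff_poly p).
Proof.
move=> hp i; rewrite coefB coef_map coefC; apply: image_hB; first exact: image_hC.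
by case: eqP => // _; rewrite -polyC0; apply: image_hC.
Qed.

Lemma diff_poly_root p : (diff_poly p).['X] = 0.
Proof. by rewrite /diff_poly hornerD hornerN hornerC -[X in X - _]/(p \Po 'X) comp_polyXr subrr. Qed.

Lemma size_diff_poly (p : {poly K}) : (1 < size p)%N -> size (diff_poly p) = size p.
Proof.
move=> sp; rewrite size_polyDl size_map_polyC // size_polyN.
by rewrite (leq_ltn_trans (size_polyC_leq1 _)).
Qed.

Lemma lead_diff_poly (p : {poly K}) : (1 < size p)%N -> lead_coef (diff_poly p) = (lead_coef p)%:P.
Proof.
move=> sp; rewrite lead_coefDl ?lead_coef_map // size_map_polyC size_polyN.
by rewrite (leq_ltn_trans (size_polyC_leq1 _)).
Qed.

(** Pseudo-division by [M] does not leave the polynomials over B that vanish at s. *)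
Lemma pseudo_divide (M : {poly {poly K}}) : M != 0 -> coefs_image M -> M.['X] = 0 ->
  (forall D, coefs_image D -> D.['X] = 0 -> (size D < size M)%N -> D = 0) ->
  forall D, coefs_image D -> D.['X] = 0 ->
  exists k S, (lead_coef M ^+ k)%:P * D = S * M.
Proof.
move=> M0 hM rM minM D; have [m] := ubnP (size D); elim: m D => // m IH D.
rewrite ltnS => sD hD rD; have [lt|le] := ltnP (size D) (size M).
  by exists 0%N, 0; rewrite (minM D hD rD lt) mulr0 mul0r.
have D0 : D != 0 by rewrite -size_poly_gt0 (leq_trans _ le) // size_poly_gt0.
pose D' := (lead_coef M)%:P * D - (lead_coef D)%:P * 'X^(size D - size M) * M.
have sD' : (size D' < size D)%N.
  have D1 : size ((lead_coef M)%:P * D) = size D.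
    by rewrite mul_polyC size_scale // lead_coef_eq0.
  have D2 : size ((lead_coef D)%:P * 'X^(size D - size M) * M) = size D.
    rewrite -mulrA mul_polyC size_scale ?lead_coef_eq0 // mulrC size_mulXn //.
    by rewrite subnK.
  have : (size D' <= size D)%N.
    by rewrite /D' (leq_trans (size_polyD _ _)) // size_polyN D1 D2 maxnn.
  rewrite leq_eqVlt => /predU1P[E|//].
  have : lead_coef D' = 0.
    rewrite lead_coefE E coefB coefCM -mulrA coefCM coefXnM.
    have sM : (0 < size M)%N by rewrite size_poly_gt0.
    have -> : ((size D).-1 < size D - size M)%N = false by apply/negP; lia.
    have -> : ((size D).-1 - (size D - size M))%N = (size M).-1 by lia.
    by rewrite -!lead_coefE mulrC subrr.
  move/eqP; rewrite lead_coef_eq0 => /eqP D'0.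
  by move: D0; rewrite -size_poly_gt0 -E D'0 size_poly0.
have [||k [S SE]] := IH D' (leq_trans sD' sD).
- move=> i; rewrite coefB coefCM -mulrA coefCM coefXnM; apply: image_hB.
    by apply: image_hM; [apply: hM|apply: hD].
  apply: image_hM; first exact: hD.
  case: ifP => _; [by rewrite -polyC0; apply: image_hC|exact: hM].
- by rewrite /D' hornerD hornerN !hornerM rD rM !mulr0 subrr.
exists k.+1, (S + (lead_coef M ^+ k * lead_coef D)%:P * 'X^(size D - size M)).
rewrite mulrDl -SE /D' exprSr !polyCM; ring.
Qed.

(** The minimal polynomial of s over the fractions of B, obtained as a nonzero
    polynomial of least degree over B that vanishes at s, made monic: its content
    is split off by Gauss's lemma, since a multiple of phi(h)(T) - phi(h)(s),
    whose leading coefficient is constant, is divisible by it. *)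
Lemma luroth_modulus : exists M : {poly {poly K}},
  [/\ M \is monic, coefs_image M, M.['X] = 0 &
      forall p, image_h p -> exists S, diff_poly p = S * M].
Proof.
have image_hh : image_h (phi h) by exists h => //; apply: integral_h_h.
have D0 : diff_poly (phi h) != 0 by rewrite -size_poly_gt0 size_diff_poly // ltnW.
pose good k := `[< exists M : {poly {poly K}}, [/\ M != 0, coefs_image M, M.['X] = 0 & size M = k] >].
have [|k /asboolP[M [M0 hM rM sM]] kmin] := @ex_minnP good.
  exists (size (diff_poly (phi h))); apply/asboolP; exists (diff_poly (phi h)); split=> //.
    exact: diff_poly_coefs.
  exact: diff_poly_root.
have minM D : coefs_image D -> D.['X] = 0 -> (size D < size M)%N -> D = 0.
  move=> hD rD lt; apply/eqP; apply: contraLR lt => D0'; rewrite -leqNgt sM.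
  by apply: kmin; apply/asboolP; exists D.
have div D := pseudo_divide M0 hM rM minM (D := D).
have l0 : lead_coef M != 0 by rewrite lead_coef_eq0.
have fKs : factorial_domain {poly K}.
  apply: factorial_poly => a a0; exists a, [::]; rewrite unitfE a0 big_nil mulr1.
  by split.
have [k0 [S SE]] := div _ (diff_poly_coefs image_hh) (diff_poly_root _).
have [r1 [r2 [f [g [_ _ ME DE]]]]] := factorial_split_polyC fKs (expf_neq0 k0 l0) SE.
have lfg : lead_coef f * lead_coef g = (lead_coef (phi h))%:P.
  by rewrite -lead_coefM -DE lead_diff_poly.
have lgU : lead_coef g \is a GRing.unit.
  apply/unitrPr; exists (lead_coef f * (lead_coef (phi h))^-1%:P).
  rewrite mulrA [lead_coef g * _]mulrC lfg -polyCM divff //.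
  by rewrite lead_coef_eq0 -size_poly_gt0 ltnW.
pose M1 := (lead_coef g)^-1%:P * g.
have M1M : M1 \is monic.
  by rewrite monicE lead_coefM lead_coefC mulVr.
have ME1 : M = (r2 * lead_coef g)%:P * M1.
  by rewrite ME /M1 mulrA -polyCM -mulrA mulrV // mulr1.
have lME : lead_coef M = r2 * lead_coef g.
  by rewrite ME1 lead_coefM lead_coefC (monicP M1M) mulr1.
rewrite -lME in ME1.
exists M1; split=> //.
- move=> i; apply: (@image_h_div M`_i (lead_coef M)) => //; first exact: hM.
  by rewrite {1}ME1 coefCM.
- by move/eqP: rM; rewrite ME1 hornerM hornerC mulf_eq0 (negbTE l0) => /eqP.
move=> p hp; have [k1 [S1 S1E]] := div _ (diff_poly_coefs hp) (diff_poly_root _).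
have DivE := Pdiv.RingMonic.rdivp_eq M1M (diff_poly p).
set rho := Pdiv.CommonRing.rmodp _ _ in DivE; set quo := Pdiv.CommonRing.rdivp _ _ in DivE.
exists quo; suff rho0 : rho = 0 by rewrite DivE rho0 addr0.
apply/eqP; apply: contraT => rho0.
have lt : (size rho < size M1)%N by apply: Pdiv.CommonRing.ltn_rmodpN0; apply: monic_neq0.
have E : (lead_coef M ^+ k1)%:P * rho = (S1 * (lead_coef M)%:P - (lead_coef M ^+ k1)%:P * quo) * M1.
  rewrite mulrBl -!mulrA -ME1 -S1E DivE; ring.
have lk0 : lead_coef M ^+ k1 != 0 by rewrite expf_neq0.
have srho : size ((lead_coef M ^+ k1)%:P * rho) = size rho by rewrite mul_polyC size_scale.
set T := _ - _ in E; have T0 : T != 0.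
  apply: contraTneq rho0 => T0; move: E; rewrite T0 mul0r => /eqP.
  by rewrite mulf_eq0 polyC_eq0 (negbTE lk0) negbK.
have : (size M1 <= size (T * M1)%R)%N.
  rewrite (size_mul T0 (monic_neq0 M1M)).
  by rewrite -ltnS (leq_trans _ (leqSpred _)) // -add1n leq_add2r size_poly_gt0.
by rewrite -E srho leqNgt lt.
Qed.

(** Modulo be(T) - be(s), a polynomial p(T) is congruent to N(T, be(s)) with N of
    degree in T smaller than that of [be], by expanding p in powers of [be]. *)
Lemma expand_along (be : {poly K}) : (1 < size be)%N -> forall p : {poly K},
  exists (N S : {poly {poly K}}), (size N < size be)%N /\
    map_poly polyC p - map_poly (comp_poly be) N = S * diff_poly be.
Proof.
move=> sb p; have [m] := ubnP (size p); elim: m p => // m IH p; rewrite ltnS => sp.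
have b0 : be != 0 by rewrite -size_poly_gt0 ltnW.
have mapC (r : {poly K}) : map_poly (comp_poly be) (map_poly polyC r) = map_poly polyC r.
  by rewrite -map_poly_comp; apply: eq_map_poly => c /=; rewrite comp_polyC.
have [lt|le] := ltnP (size p) (size be).
  by exists (map_poly polyC p), 0; rewrite size_map_polyC lt mapC subrr mul0r.
have := divp_eq p be; set a := p %/ be; set r := p %% be => pE.
have [|N [S [sN NE]]] := IH a.
  rewrite size_divp // (leq_trans _ sp) // ltn_subrL; apply/andP; split.
    by move: sb; case: (size be) => [|[]].
  by rewrite (leq_trans _ le) // ltnW.
exists ('X *: N + map_poly polyC r), (map_poly polyC a + be%:P * S); split.
  rewrite (leq_ltn_trans (size_polyD _ _)) // gtn_max size_map_polyC ltn_modp b0 andbT.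
  by rewrite (leq_ltn_trans (size_scale_leq _ _)).
rewrite -mul_polyC rmorphD rmorphM /= map_polyC /= comp_polyX mapC.
rewrite mulrDl -mulrA -NE pE rmorphD rmorphM /= /diff_poly; ring.
Qed.

(** With [be] a coefficient of M of maximal degree in s, M divides
    be(T) - be(s) and the degrees in s agree, so the quotient depends on T alone;
    it divides the leading coefficient in s, which is constant. Hence M is
    be(T) - be(s) up to a constant. For p in B, p(s) and the expansion
    N(T, be(s)) of [expand_along] are then congruent modulo M, and equal for
    degree reasons. *)
Lemma luroth_coefficient : exists be : {poly K}, [/\ (1 < size be)%N, image_h be &
  forall p, image_h p -> exists H, p = H \Po be].
Proof.
have [M [MM hM rM dvdM]] := luroth_modulus.
have [i si] : exists i, (1 < size (M`_i)%R)%N.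
  apply: contrapT => none; have constM i : M`_i = ((M`_i)`_0)%:P.
    by apply: size1_polyC; rewrite leqNgt; apply/negP => si; apply: none; exists i.
  have ME : M = map_poly polyC (map_poly (coefp 0) M).
    by apply/polyP => i; rewrite !coef_map /= -constM.
  move: rM; rewrite ME -[_.[_]]/(map_poly (coefp 0) M \Po 'X) comp_polyXr => M0.
  by move: (monic_neq0 MM); rewrite ME M0 rmorph0 eqxx.
have [i0 i0max] : exists i0, forall k, (size (M`_k)%R <= size (M`_i0)%R)%N.
  have sM : (0 < size M)%N by rewrite size_poly_gt0 monic_neq0.
  case: (@arg_maxnP _ (Ordinal sM) xpredT (fun k : 'I_(size M) => size (M`_k)%R)) => // k _ kmax.
  exists k => l; have [ls|ls] := ltnP l (size M); first exact: (kmax (Ordinal ls)).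
  by rewrite [M`_l]nth_default // size_poly0.
set be := M`_i0 in i0max; have sb : (1 < size be)%N by rewrite (leq_trans si).
have hb : image_h be := hM i0.
have [S SE] := dvdM _ hb.
have b0 : be != 0 by rewrite -size_poly_gt0 ltnW.
have M0 : M != 0 := monic_neq0 MM.
have S0 : S != 0.
  apply: contraTneq sb => S0; move: SE; rewrite S0 mul0r => D0.
  rewrite -leqNgt; apply: contraT; rewrite -ltnNge => sb.
  by move: (size_diff_poly sb); rewrite D0 size_poly0 => sb0; rewrite -sb0 in sb.
have swE : be%:P - map_poly polyC be = swapXY S * swapXY M.
  by rewrite -rmorphM -SE /diff_poly rmorphB /= swapXY_map_polyC swapXY_polyC.
have sw_size : size (be%:P - map_poly polyC be) = size be.
  by rewrite -opprB size_polyN -/(diff_poly be) size_diff_poly.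
have sM : size (swapXY M) = size be.
  rewrite -sizeYE /sizeY; apply/eqP; rewrite eqn_leq; apply/andP; split.
    by apply/bigmax_leqP => k _; apply: i0max.
  have i0s : (i0 < size M)%N.
    by rewrite ltnNge; apply/negP => h0; move: b0; rewrite /be nth_default ?eqxx.
  exact: (@leq_bigmax _ (fun k : 'I_(size M) => size (M`_k)%R) (Ordinal i0s)).
have sS : size (swapXY S) = 1%N.
  have := congr1 (fun p : {poly {poly K}} => size p) swE; rewrite sw_size size_mul ?swapXY_eq0 //.
  by rewrite sM; move: sb; move: (size be) => y; move: (size (swapXY S)) => x; lia.
have /size_poly1P[q q0 SqE] : size (swapXY S) == 1%N by rewrite sS.
have lE : - (lead_coef be)%:P = q * lead_coef (swapXY M).
  have := congr1 lead_coef swE; rewrite -opprB lead_coefN -/(diff_poly be).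
  by rewrite lead_diff_poly // lead_coefM SqE lead_coefC.
have qU : q \is a GRing.unit.
  apply/unitrPr; exists (- (lead_coef (swapXY M) * (lead_coef be)^-1%:P)).
  rewrite mulrN mulrA -lE mulNr opprK -polyCM divff //.
  by rewrite lead_coef_eq0.
have MS : M = map_poly polyC q^-1 * diff_poly be.
  have SE' : S = map_poly polyC q by rewrite -[S]swapXYK SqE swapXY_polyC.
  by rewrite SE SE' mulrA -rmorphM mulVr // rmorph1 mul1r.
exists be; split=> // p hp.
have [T TE] := dvdM _ hp.
have [N [V [sN NE]]] := expand_along sb p.
have E : map_poly (comp_poly be) N - p%:P = (T * map_poly polyC q^-1 - V) * diff_poly be.
  rewrite mulrBl -mulrA -MS -TE -NE /diff_poly; ring.
have smapN : (size (map_poly (comp_poly be) N - p%:P)%R < size be)%N.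
  rewrite (leq_ltn_trans (size_polyD _ _)) // gtn_max size_polyN.
  rewrite (leq_ltn_trans (size_poly _ _)) //=.
  by rewrite (leq_ltn_trans (size_polyC_leq1 _)).
have E0 : T * map_poly polyC q^-1 - V = 0.
  apply/eqP; apply: contraT => n0; move: smapN; rewrite E size_mul //; last first.
    by rewrite -size_poly_gt0 size_diff_poly // ltnW.
  by rewrite size_diff_poly // (polySpred n0) addSn /= ltnNge leq_addl.
move: E; rewrite E0 mul0r => /eqP; rewrite subr_eq0 => /eqP/(congr1 (fun p : {poly {poly K}} => p`_0)).
by rewrite coef_map coefC /= => <-; exists N`_0.
Qed.

Theorem luroth_polynomial : exists h', [/\ (1 < size (phi h'))%N, integral_h h' &
  forall P, integral_h P -> exists H, P = eval_at h' H].
Proof.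
have [be [sb [h' hh' h'E] beP]] := luroth_coefficient.
exists h'; split; rewrite ?h'E // => P hP.
have [|H HE] := beP (phi P); first by exists P.
exists H; apply/eqP; rewrite -subr_eq0; apply/eqP; apply: integral_h_inj.
  by apply: integral_sub => //; apply: integral_h_eval.
by rewrite rmorphB /= phi_eval_at h'E HE subrr.
Qed.

End Luroth.

(** * Prime factors of polynomials in several variables *)
Lemma prime_irreducible (R : idomainType) (p : R) : prime_elt p -> irreducible p.
Proof.
case=> p0 pU pD; split=> // a b pE.
have cof (x y c : R) : p = x * y -> x = c * p -> y \is a GRing.unit.
  move=> E xE; apply/unitrPr; exists c; apply: (mulIf p0).
  by rewrite mul1r -mulrA -xE mulrC -E.
have [|[c aE]|[c bE]] := pD a b; first by rewrite -pE; apply: divides_refl.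
  by right; apply: cof pE aE.
by left; apply: (@cof b a c) bE; rewrite mulrC.
Qed.

Lemma irreducible_iso (R S : idomainType) (f : {rmorphism R -> S}) (g : {rmorphism S -> R})
    (p : R) : cancel f g -> cancel g f -> irreducible p -> irreducible (f p).
Proof.
move=> fK gK [p0 pU pP]; split.
- by rewrite -(rmorph0 f) (can_eq fK).
- by apply: contra pU => /(rmorph_unit g); rewrite fK.
move=> a b E; have /pP[/(rmorph_unit f)|/(rmorph_unit f)] : p = g a * g b.
- by rewrite -rmorphM -E fK.
- by rewrite gK; left.
by rewrite gK; right.
Qed.

Lemma sum_subset (I : eqType) (F : I -> nat) (s t : seq I) :
  uniq s -> {subset s <= t} -> (\sum_(i <- s) F i <= \sum_(i <- t) F i)%N.
Proof.
elim: s t => [|x s IH] t /=; first by rewrite big_nil.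
case/andP => xs us sub; have xt : x \in t by apply: sub; rewrite mem_head.
rewrite big_cons (big_rem _ xt) /= leq_add2l; apply: IH => // y ys.
have yt : y \in t by apply: sub; rewrite inE ys orbT.
have := perm_to_rem xt => /perm_mem/(_ y); rewrite yt inE => /esym/orP[/eqP yx|//].
by rewrite -yx ys in xs.
Qed.

Section Factors.
Variables (K : closedFieldType) (n : nat).
Local Notation R := {mpoly K[n]}.
Implicit Types (p q r : R).

Let fR : factorial_domain R := @factorial_mpoly K n.

Lemma mpoly_unitP p : p \is a GRing.unit -> is_nzscalar p.
Proof.
case/andP => /eqP pE pU; exists p@_0; last exact: pE.
by apply: contraTneq pU => ->; rewrite unitr0.
Qed.

Lemma nzscalar_unit (c : K) : c != 0 -> c%:MP \is a @GRing.unit R.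
Proof. by move=> c0; apply: (rmorph_unit (@mpolyC n K)); rewrite unitfE. Qed.

Lemma irreducible_prime q : irreducible q -> prime_elt q.
Proof. exact: factorial_irreducible_prime. Qed.

Lemma irreducible_divides q r : irreducible q -> irreducible r -> divides q r -> proportional r q.
Proof.
move=> [q0 qU _] [r0 rU rP] [c rE]; case: (rP _ _ rE) => [/mpoly_unitP[k k0 cE]|]; last first.
  by rewrite (negbTE qU).
by exists k; rewrite // rE cE mul_mpolyC.
Qed.

Lemma proportional_sym p q : proportional p q -> proportional q p.
Proof.
by case=> c c0 ->; exists c^-1; rewrite ?invr_eq0 // scalerA mulVf // scale1r.
Qed.

Lemma proportional_trans q p r : proportional p q -> proportional q r -> proportional p r.
Proof. by case=> c c0 -> [d d0 ->]; exists (c * d); rewrite ?mulf_neq0 // scalerA. Qed.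

Lemma mdegree_proportional p q : proportional p q -> mdegree p = mdegree q.
Proof. by case=> c c0 ->; rewrite /mdegree msizeZ. Qed.

Lemma mdegreeM p q : p != 0 -> q != 0 -> mdegree (p * q) = (mdegree p + mdegree q)%N.
Proof.
move=> p0 q0; rewrite /mdegree msizeM // (mpolySpred _ p0) (mpolySpred _ q0).
by rewrite addSn addnS.
Qed.

Lemma mdegreeZ (c : K) p : c != 0 -> mdegree (c *: p) = mdegree p.
Proof. by move=> c0; rewrite /mdegree msizeZ. Qed.

Lemma mdegreeX p k : p != 0 -> mdegree (p ^+ k) = (k * mdegree p)%N.
Proof.
move=> p0; elim: k => [|k IH]; first by rewrite expr0 /mdegree msize1.
by rewrite exprS mdegreeM ?expf_neq0 // IH mulSn.
Qed.

Lemma irreducibleZ (c : K) p : c != 0 -> irreducible p -> irreducible (c *: p).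
Proof.
move=> c0 [p0 pU pP]; have cU := nzscalar_unit c0; rewrite -mul_mpolyC; split.
- by rewrite mulf_neq0 // mpolyC_eq0.
- by rewrite unitrM cU.
move=> a b E; have : p = (c^-1)%:MP * a * b.
  by rewrite -mulrA -E mulrA -mpolyCM mulVf // mul1r.
case/pP; last by right.
by rewrite unitrM => /andP[_]; left.
Qed.

Lemma mdegreeC (c : K) : mdegree (c%:MP : R) = 0%N.
Proof. by rewrite /mdegree msizeC; case: eqP. Qed.

Lemma mdegree_prod (I : eqType) (s : seq I) (F : I -> R) : {in s, forall i, F i != 0} ->
  \prod_(i <- s) F i != 0 /\ mdegree (\prod_(i <- s) F i) = (\sum_(i <- s) mdegree (F i))%N.
Proof.
elim: s => [|i s IH] F0; first by rewrite !big_nil oner_neq0 -(mpolyC1 n K) mdegreeC.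
have [|p0 pE] := IH; first by move=> x xs; apply: F0; rewrite inE xs orbT.
have Fi : F i != 0 by apply: F0; rewrite mem_head.
by rewrite !big_cons mulf_neq0 // mdegreeM // pE.
Qed.

(** Proportional primes are collected while the list of primes is traversed. *)
Lemma irr_factorization_exists p : p != 0 -> irr_factorization p (irr_factors p).
Proof.
move=> p0; apply: (@xgetPex _ [::] [set qs | irr_factorization p qs]).
have [u [s [/mpoly_unitP[k k0 ->] sP ->]]] := fR p0; rewrite mul_mpolyC.
suff [qs qsP] : exists qs, irr_factorization (\prod_(q <- s) q) qs.
  exists qs; case: qsP => qI qU qN [a [d [a0 d0 E]]]; split=> //.
  by exists (k * a), d; rewrite mulf_neq0 // E scalerA.
elim: s sP => [|q s IH] sP.
  exists [::]; split=> //; exists 1, (fun=> 0%N).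
  by rewrite !big_nil scale1r oner_neq0; split.
have [|qs [qI qU qN [a [d [a0 d0 E]]]]] := IH.
  by move=> x xs; apply: sP; rewrite inE xs orbT.
have qP : irreducible q by apply/prime_irreducible/sP; rewrite mem_head.
rewrite big_cons E.
have [[r rs [c c0 qr]]|none] := pselect (exists2 r, r \in qs & proportional q r).
  exists qs; split=> //; exists (c * a), (fun x => if x == r then (d x).+1 else d x).
  split; first by rewrite mulf_neq0.
    by move=> x xs /=; case: ifP => // _; apply: d0.
  rewrite qr -scalerAl -scalerAr scalerA !(big_rem _ rs) /= eqxx exprS mulrA.
  congr (_ *: (_ * _)); apply: eq_big_seq => x.
  by rewrite mem_rem_uniq // inE => /andP[/negbTE -> _].
have qnot : q \notin qs.
  apply/negP => qqs; apply: none; exists q => //; exists 1; rewrite ?oner_neq0 //.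
  by rewrite scale1r.
exists (q :: qs); split.
- by move=> x; rewrite inE => /predU1P[->|/qI].
- by rewrite /= qnot.
- move=> x y; rewrite !inE => /predU1P[->|xs] /predU1P[->|ys] xy; first by rewrite eqxx in xy.
  + by move=> qy; apply: none; exists y.
  + by move=> /proportional_sym qx; apply: none; exists x.
  exact: qN.
exists a, (fun x => if x == q then 1%N else d x); split=> //.
  by move=> x; rewrite inE; case: eqP => //= _; apply: d0.
rewrite big_cons eqxx expr1 -scalerAr; congr (_ *: (_ * _)).
apply: eq_big_seq => x xs; case: eqP => // xq; by rewrite -xq xs in qnot.
Qed.

Lemma irr_factors_divides p q : p != 0 -> q \in irr_factors p -> divides q p.
Proof.
move=> /irr_factorization_exists[_ _ _ [a [d [a0 d0 E]]]] qp; rewrite {1}E.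
rewrite (big_rem _ qp) /= -(prednK (d0 _ qp)) exprS -mulrA; set y := _ ^+ _ * _.
by exists (a *: y); rewrite -scalerAl mulrC.
Qed.

Lemma irr_factors_complete p q : p != 0 -> irreducible q -> divides q p ->
  exists2 r, r \in irr_factors p & proportional q r.
Proof.
move=> p0 qI; have [rI _ _ [a [d [a0 d0 E]]]] := irr_factorization_exists p0.
have qP := irreducible_prime qI; have [_ qU qD] := qP.
rewrite {1}E -mul_mpolyC => /qD[[c cE]|].
  case/negP: qU; have := nzscalar_unit a0; by rewrite cE unitrM => /andP[].
case/(prime_prod qP) => r rp /(prime_exp qP) qr; exists r => //.
by apply/proportional_sym/irreducible_divides => //; apply: rI.
Qed.

(** Pairwise non-proportional factors that are proportional to members of [rs] can
    be matched with distinct members of [rs], of the same degrees. *)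
Lemma factor_inject (qs rs : seq R) : uniq qs ->
  {in qs &, forall q r, q != r -> ~ proportional q r} ->
  {in qs, forall q, exists2 r, r \in rs & proportional q r} ->
  (size qs <= size rs)%N /\ (\sum_(q <- qs) mdegree q <= \sum_(r <- rs) mdegree r)%N.
Proof.
move=> qU qN qr.
have /choice[s sP] : forall q, exists r, q \in qs -> r \in rs /\ proportional q r.
  move=> q; have [/qr[r rs_r qr_]|nq] := boolP (q \in qs); first by exists r.
  by exists 0.
have sI : {in qs &, injective s}.
  move=> x y xq yq sxy; apply/eqP; apply: contraT => /(qN _ _ xq yq)[].
  apply: proportional_trans (sP x xq).2 _; rewrite sxy.
  by apply: proportional_sym; have [] := sP y yq.
have sU : uniq (map s qs) by rewrite map_inj_in_uniq.
have sub : {subset map s qs <= rs} by move=> _ /mapP[x xq ->]; have [] := sP x xq.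
split; first by rewrite -(size_map s) uniq_leq_size.
have := sum_subset (@mdegree K n) sU sub; rewrite big_map; apply: leq_trans.
rewrite big_seq [leqRHS]big_seq; apply: leq_sum => x xq.
by rewrite (mdegree_proportional (sP x xq).2).
Qed.

Lemma factor_le p p' : p != 0 -> p' != 0 -> divides p p' ->
  (\sum_(q <- irr_factors p) mdegree q <= \sum_(q <- irr_factors p') mdegree q)%N.
Proof.
move=> p0 p'0 pp'; have [qI qU qN _] := irr_factorization_exists p0.
apply: (factor_inject qU qN _).2 => q qp; apply: irr_factors_complete => //; first exact: qI.
by apply: divides_trans pp'; apply: irr_factors_divides.
Qed.

Lemma sum_irr_factors_le p : p != 0 -> (\sum_(q <- irr_factors p) mdegree q <= mdegree p)%N.
Proof.
move=> p0; have [qI qU qN [a [d [a0 d0 E]]]] := irr_factorization_exists p0.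
have q0 : {in irr_factors p, forall q, q ^+ d q != 0}.
  by move=> q /qI[q0 _ _]; rewrite expf_neq0.
rewrite [in leqRHS]E /mdegree msizeZ // -/(mdegree _) (mdegree_prod q0).2.
rewrite [leqLHS]big_seq [leqRHS]big_seq; apply: leq_sum => q qp.
have [qn0 _ _] := qI q qp.
rewrite -(prednK (d0 q qp)) exprS mdegreeM ?expf_neq0 //; exact: leq_addr.
Qed.

Lemma irr_factors_size_gt0 p : p != 0 -> ~ is_scalar p -> (0 < size (irr_factors p))%N.
Proof.
move=> p0 ps; have [_ _ _ [a [d [_ _ E]]]] := irr_factorization_exists p0.
rewrite lt0n; apply/negP => /nilP qs0; apply: ps; exists a.
by rewrite E qs0 big_nil -mul_mpolyC mulr1.
Qed.

End Factors.

(** * Generators of pencils *)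
Section PencilGenerator.
Variables (K : closedFieldType) (n : nat).
Local Notation R := {mpoly K[n.+1]}.

(** The substitution F -> F(h). *)
Definition mpoly_at : R -> {poly K} -> R := eval_at (@mpolyC n.+1 K).
HB.instance Definition _ (a : R) := GRing.RMorphism.on (mpoly_at a).

Lemma mpoly_atC (a : R) c : mpoly_at a c%:P = c%:MP.
Proof. exact: eval_atC. Qed.

Lemma mpoly_atX (a : R) : mpoly_at a 'X = a.
Proof. exact: eval_atX. Qed.

Lemma mpoly_at_comp (a : R) H G : mpoly_at (mpoly_at a H) G = mpoly_at a (G \Po H).
Proof.
move: G; apply: (@poly_morph_eq _ _ (mpoly_at (mpoly_at a H)) (mpoly_at a \o comp_poly H)) => [c|] /=.
  by rewrite mpoly_atC comp_polyC mpoly_atC.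
by rewrite mpoly_atX comp_polyX.
Qed.

Lemma mpoly_at_roots (a : R) (F : {poly K}) (rs : seq K) :
  F = lead_coef F *: \prod_(r <- rs) ('X - r%:P) ->
  mpoly_at a F = lead_coef F *: \prod_(r <- rs) (a - r%:MP).
Proof.
move=> {1}->; rewrite -mul_polyC rmorphM /= mpoly_atC mul_mpolyC; congr (_ *: _).
rewrite rmorph_prod; apply: eq_bigr => r _.
by rewrite rmorphB /= mpoly_atX mpoly_atC.
Qed.

Lemma sub_const_neq0 (a : R) c : (1 < msize a)%N -> a - c%:MP != 0.
Proof.
move=> sa; rewrite subr_eq0; apply: contraTneq sa => ->.
by rewrite msizeC; case: eqP.
Qed.

Lemma sub_const_nonscalar (a : R) c : (1 < msize a)%N -> ~ is_scalar (a - c%:MP).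
Proof.
move=> sa [k /eqP]; rewrite subr_eq => /eqP aE; move: sa.
by rewrite aE -mpolyCD msizeC; case: eqP.
Qed.

Lemma mdegree_sub_const (a : R) c : (1 < msize a)%N -> mdegree (a - c%:MP) = mdegree a.
Proof.
move=> sa; rewrite /mdegree; congr _.-1; apply/eqP; rewrite eqn_leq; apply/andP; split.
  apply: leq_trans (msizeD_le _ _) _; rewrite msizeN msizeC geq_max leqnn /=.
  by rewrite (leq_trans (leq_b1 _)) // ltnW.
have : (msize a <= maxn (msize (a - c%:MP)) (msize (c%:MP : R)))%N.
  by rewrite -{1}[a](subrK c%:MP) msizeD_le.
rewrite msizeC leq_max => /orP[//|h].
by have := leq_trans sa (leq_trans h (leq_b1 _)).
Qed.

Lemma mdegree_mpoly_at (a : R) (F : {poly K}) : (1 < msize a)%N -> F != 0 ->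
  mpoly_at a F != 0 /\ mdegree (mpoly_at a F) = ((size F).-1 * mdegree a)%N.
Proof.
move=> sa F0; have [rs FE] := closed_field_poly_normal F.
have l0 : lead_coef F != 0 by rewrite lead_coef_eq0.
have sF : (size F).-1 = size rs.
  by rewrite FE size_scale // size_prod_XsubC.
have [p0 pE] := @mdegree_prod K n.+1 _ rs (fun r => a - r%:MP) (fun r _ => sub_const_neq0 r sa).
rewrite (mpoly_at_roots a FE); split; first by rewrite scaler_eq0 negb_or l0.
rewrite mdegreeZ // pE sF.
under eq_bigr => r _ do rewrite mdegree_sub_const //.
by rewrite big_const_seq count_predT iter_addn_0 mulnC.
Qed.

(** The condition on [h] under which almost all its fibres are irreducible; it
    excludes in particular h = G(g) with G of degree at least 2. *)
Definition closed_pencil (h : R) : Prop :=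
  forall P, integralOver (mpoly_at h) P -> exists H, P = mpoly_at h H.

Lemma good_direction (h : R) : (1 < msize h)%N ->
  exists v : 'I_n.+1 -> K, exists k : K,
    [/\ v ord_max != 0, k != 0, (to_poly v h)`_(msize h).-1 = k%:MP &
        size (to_poly v h) = msize h].
Proof.
move=> sh; have h0 : h != 0 by rewrite -msize_poly_eq0 -lt0n ltnW.
have p0 : top_form (msize h).-1 h * 'X_ord_max != 0.
  by rewrite mulf_neq0 ?top_form_neq0 // -msize_poly_eq0 msizeX.
have [v] := mpoly_nonroot p0; rewrite mevalM mevalXU mulf_eq0 negb_or => /andP[tv vy].
have sh1 : (msize h <= (msize h).-1.+1)%N by exact: leqSpred.
have cE := coef_to_poly_top v sh1.
exists v, (top_form (msize h).-1 h).@[v]; split=> //.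
apply/eqP; rewrite eqn_leq size_to_poly /=; rewrite leqNgt; apply/negP => lt.
move: cE; rewrite nth_default => [/eqP|]; first by rewrite eq_sym mpolyC_eq0 (negbTE tv).
by rewrite -ltnS (leq_trans lt).
Qed.

(** Luroth's theorem, for the restriction [phi] to the line of direction [v]
    through the origin, on which [h] keeps its degree. *)
Lemma luroth_mpoly (h : R) : (1 < msize h)%N -> exists h' H,
  [/\ (1 < msize h')%N, h = mpoly_at h' H & forall P, integralOver (mpoly_at h) P -> exists F, P = mpoly_at h' F].
Proof.
move=> sh; have [v [k [vy k0 kE sE]]] := good_direction sh.
pose phi : {rmorphism R -> {poly K}} := map_poly (meval (fun _ : 'I_n => 0)) \o to_poly v.
have phiC c : phi (@mpolyC n.+1 K c) = c%:P.
  by rewrite /phi /= to_polyC map_polyC /= mevalC.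
have sphi : (1 < size (phi h))%N.
  rewrite ltnNge; apply/negP => le; have : (phi h)`_(msize h).-1 = k.
    by rewrite /phi /= coef_map kE /= mevalC.
  rewrite nth_default => [/esym/eqP|]; first by rewrite (negbTE k0).
  by rewrite (leq_trans le) // -ltnS prednK // ltnW.
have [h' [sh' hh' h'P]] := luroth_polynomial (@factorial_mpoly K n.+1) phiC sphi.
have [|H HE] := h'P h; first exact: integral_h_h.
exists h', H; split=> //; rewrite ltnNge; apply/negP => /msize1_polyC h'C.
by move: sh'; rewrite h'C phiC ltnNge size_polyC_leq1.
Qed.

(** Take [h] of least degree with f in K[h]. By [luroth_mpoly], h = H(h') with h'
    generating the integral closure; minimality makes H of degree 1. *)
Lemma pencil_generator (f : R) : ~ is_scalar f ->
  exists h F, [/\ (1 < msize h)%N, f = mpoly_at h F, closed_pencil h & F != 0].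
Proof.
move=> fs; have sf : (1 < msize f)%N.
  by rewrite ltnNge; apply/negP => /msize1_polyC fE; apply: fs; exists f@_0.
pose good m := `[< exists h F, [/\ (1 < msize h)%N, f = mpoly_at h F & msize h = m] >].
have [|m /asboolP[h [F [sh fE hm]]] mmin] := @ex_minnP good.
  by exists (msize f); apply/asboolP; exists f, 'X; rewrite mpoly_atX.
exists h, F; split=> //; last first.
  by apply: contraTneq sf => F0; rewrite fE F0 rmorph0 msize0.
have [h' [H [sh' hE h'P]]] := luroth_mpoly sh.
have H0 : H != 0 by apply: contraTneq sh => H0; rewrite hE H0 rmorph0 msize0.
have [_ dE] := mdegree_mpoly_at sh' H0; rewrite -hE in dE.
have le : (msize h <= msize h')%N.
  rewrite hm; apply: mmin; apply/asboolP; exists h', (F \Po H); split=> //.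
  by rewrite -mpoly_at_comp -hE.
have sH : size H = 2%N.
  have d'0 : (0 < mdegree h')%N by rewrite /mdegree -ltnS prednK // ltnW.
  have d0 : (0 < mdegree h)%N by rewrite /mdegree -ltnS prednK // ltnW.
  have le' : (mdegree h <= mdegree h')%N by rewrite /mdegree -!subn1 leq_sub2r.
  move: le' d0 d'0; rewrite dE; case: (size H) => [|[|[|k]]] //=; nia.
have H1 : H`_1 != 0 by have := lead_coef_eq0 H; rewrite lead_coefE sH (negbTE H0) => /negbT.
have HE : H = (H`_1)%:P * 'X + (H`_0)%:P.
  apply/polyP => i; rewrite coefD coefMX !coefC.
  case: i => [|[|i]] /=; rewrite ?add0r ?addr0 //.
  by rewrite nth_default // sH.
have hE2 : h = (H`_1)%:MP * h' + (H`_0)%:MP.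
  by rewrite [LHS]hE [X in mpoly_at _ X]HE rmorphD rmorphM /= mpoly_atX !mpoly_atC.
have h'E : h' = mpoly_at h ((H`_1)^-1 *: ('X - (H`_0)%:P)).
  rewrite -mul_polyC rmorphM rmorphB /= mpoly_atX !mpoly_atC hE2.
  by rewrite addrK mulrA -mpolyCM mulVf // mul1r.
move=> P /h'P[Q ->]; exists (Q \Po ((H`_1)^-1 *: ('X - (H`_0)%:P))).
by rewrite -mpoly_at_comp -h'E.
Qed.

Lemma closed_pencil_scale (h : R) k : k != 0 -> closed_pencil h -> closed_pencil (k *: h).
Proof.
move=> k0 hP P.
have gE H : mpoly_at (k *: h) H = mpoly_at h (H \Po (k *: 'X)).
  by rewrite -mpoly_at_comp -[k *: 'X]mul_polyC rmorphM /= mpoly_atC mpoly_atX mul_mpolyC.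
case=> p pM /rootP pP; have [|H HE] := hP P.
  exists (map_poly (comp_poly (k *: 'X)) p); first exact: monic_map.
  apply/rootP; rewrite -map_poly_comp -[RHS]pP; congr (_.[_]).
  by apply: eq_map_poly => H; rewrite [RHS]gE.
exists (H \Po (k^-1 *: 'X)); rewrite gE -comp_polyA comp_polyZ comp_polyX scalerA mulVf //.
by rewrite scale1r comp_polyXr.
Qed.

Lemma monic_pencil_generator (f : R) : ~ is_scalar f ->
  exists h F v, [/\ (1 < msize h)%N /\ F != 0, f = mpoly_at h F, closed_pencil h, v ord_max != 0 &
    to_poly v h \is monic /\ size (to_poly v h) = msize h].
Proof.
move=> fs; have [h [F [sh fE hP F0]]] := pencil_generator fs.
have [v [k [vy k0 kE sE]]] := good_direction sh.
have ki : k^-1 != 0 by rewrite invr_eq0.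
have sz : msize (k^-1 *: h) = msize h by apply: msizeZ.
have TE : to_poly v (k^-1 *: h) = (k^-1%:MP)%:P * to_poly v h.
  by rewrite -mul_mpolyC rmorphM /= to_polyC.
have kI : (k^-1%:MP : {mpoly K[n]}) != 0 by rewrite mpolyC_eq0.
have sT : size (to_poly v (k^-1 *: h)) = msize h by rewrite TE mul_polyC size_scale.
exists (k^-1 *: h), (F \Po (k *: 'X)), v; split.
- split; first by rewrite sz.
  by rewrite comp_poly_eq0 // size_scale // size_polyX.
- rewrite -mpoly_at_comp -[k *: 'X]mul_polyC rmorphM /= mpoly_atC mpoly_atX mul_mpolyC.
  by rewrite scalerA divff // scale1r.
- exact: closed_pencil_scale.
- exact: vy.
split; last by rewrite sT sz.
by rewrite monicE lead_coefE sT TE coefCM kE -mpolyCM mulVf.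
Qed.

End PencilGenerator.

Lemma to_poly_sub_const (K : closedFieldType) n (v : 'I_n.+1 -> K) (h : {mpoly K[n.+1]}) c :
  to_poly v (h - c%:MP) = to_poly v h - (c%:MP)%:P.
Proof. by rewrite rmorphB /= to_polyC. Qed.

Lemma pencil_to_poly (K : closedFieldType) n (v : 'I_n.+1 -> K) (h : {mpoly K[n.+1]}) H :
  pencil (to_poly v h) H = to_poly v (mpoly_at h H).
Proof.
pose f : {rmorphism {poly K} -> {poly {mpoly K[n]}}} := pencil (to_poly v h).
pose g : {rmorphism {poly K} -> {poly {mpoly K[n]}}} := to_poly v \o mpoly_at h.
suff : f =1 g by apply.
apply: poly_morph_eq => [c|]; rewrite /f /g /=.
  by rewrite pencilC mpoly_atC to_polyC.
by rewrite pencilX mpoly_atX.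
Qed.

(** * Total reducibility of a closed pencil *)
Section TotalReducibility.
Variables (K : closedFieldType) (n : nat) (h : {mpoly K[n.+1]}) (v : 'I_n.+1 -> K).
Hypotheses (sh : (1 < msize h)%N) (hP : closed_pencil h) (vy : v ord_max != 0).
Hypotheses (GM : to_poly v h \is monic) (sG : size (to_poly v h) = msize h).
Local Notation R := {mpoly K[n.+1]}.

Definition fibre_factors (c : K) : seq R := irr_factors (h - c%:MP).

Lemma total_reducibility_bound_mem (cs : seq K) (c0 : K) : uniq cs -> c0 \in cs ->
  (\sum_(c <- cs) (size (fibre_factors c)).-1 < \sum_(q <- fibre_factors c0) mdegree q)%N.
Proof.
move=> csU c0c.
pose T := to_poly v; pose S := of_poly v.
have TK : cancel T S := to_polyK vy; have SK : cancel S T := of_polyK vy.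
pose G := T h.
have pencilE H : pencil G H = T (mpoly_at h H) := pencil_to_poly v h H.
have int P : integralOver (pencil G) P -> exists H, P = pencil G H.
  case=> p pM /rootP pP; have [|H HE] := hP (P := S P).
    exists p => //; apply/rootP; rewrite -[RHS](rmorph0 S) -pP -horner_map -map_poly_comp.
    by congr (_.[_]); apply: eq_map_poly => H; rewrite /comp pencilE; apply/esym/TK.
  by exists H; rewrite pencilE -HE SK.
have fibre_neq0 c := sub_const_neq0 c sh.
have /choice[e eP] : forall c, exists d : R -> nat, {in fibre_factors c, forall q, (0 < d q)%N} /\
    exists2 a : K, a != 0 & h - c%:MP = a *: \prod_(q <- fibre_factors c) q ^+ d q.
  move=> c; have [_ _ _ [a [d [a0 d0 E]]]] := irr_factorization_exists (fibre_neq0 c).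
  by exists d; split=> //; exists a.
have fibreP c : [/\ {in fibre_factors c, forall q, irreducible q}, uniq (fibre_factors c) &
    {in fibre_factors c &, forall q r, q != r -> ~ proportional q r}].
  by have [] := irr_factorization_exists (fibre_neq0 c).
pose Q c := map T (fibre_factors c).
have TI : injective T := can_inj TK.
have sG' : (1 < size G)%N by rewrite /G /T sG.
have Q_uniq c : c \in cs -> uniq (Q c).
  by move=> _; rewrite map_inj_uniq //; have [] := fibreP c.
have Q_irr c : c \in cs -> {in Q c, forall q, irreducible q}.
  move=> _ _ /mapP[q qc ->]; apply: (irreducible_iso TK SK).
  by have [qI _ _] := fibreP c; apply: qI.
have Q_dist c : c \in cs -> {in Q c &, forall q r, divides q r -> q = r}.
  move=> _ _ _ /mapP[q qc ->] /mapP[r rc ->] [x xE]; congr T.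
  have [qI _ qN] := fibreP c; apply/eqP; apply: contraT => /(qN _ _ qc rc)[].
  apply/proportional_sym/(irreducible_divides (qI _ qc) (qI _ rc)).
  by exists (S x); apply: TI; rewrite xE [RHS](rmorphM (to_poly v)) -/T -/(S x) /= [to_poly v _]SK.
have Q_exp c : c \in cs -> {in Q c, forall q, (0 < e c (S q))%N}.
  by move=> _ _ /mapP[q qc ->]; rewrite TK; have [d0 _] := eP c; apply: d0.
have QE c : c \in cs -> exists2 a : K, a != 0 &
    G - (c%:MP)%:P = (a%:MP)%:P * \prod_(q <- Q c) q ^+ e c (S q).
  move=> _; have [_ [a a0 E]] := eP c; exists a => //.
  rewrite -to_poly_sub_const.
  rewrite E -mul_mpolyC [LHS](rmorphM (to_poly v)) /= to_polyC; congr (_ * _).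
  rewrite (rmorph_prod (to_poly v)) big_map; apply: eq_bigr => q _.
  by rewrite [LHS](rmorphXn (to_poly v)) TK.
have := monic_total_reducibility_bound GM sG' int csU Q_uniq Q_irr Q_dist Q_exp QE c0c.
rewrite big_map; under eq_bigr => c _ do rewrite size_map.
move=> lt; apply: (leq_trans lt); apply: leq_sum => q _.
by rewrite /mdegree -!subn1 leq_sub2r // size_to_poly.
Qed.

Lemma fibre_factors_gt0 c : (0 < size (fibre_factors c))%N.
Proof. by apply: irr_factors_size_gt0; [apply: sub_const_neq0|apply: sub_const_nonscalar]. Qed.

Lemma total_reducibility_bound (cs : seq K) (c0 : K) : uniq cs ->
  (\sum_(c <- cs) (size (fibre_factors c)).-1 < \sum_(q <- fibre_factors c0) mdegree q)%N.
Proof.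
move=> csU; have [c0c|c0c] := boolP (c0 \in cs); first exact: total_reducibility_bound_mem.
apply: leq_ltn_trans (@total_reducibility_bound_mem (c0 :: cs) c0 _ (mem_head _ _)).
  by rewrite big_cons leq_addl.
by rewrite /= c0c.
Qed.

(** A fibre with one prime factor is a multiple of a power q^e. Then q is integral
    over K[h], hence in K[h], and its degree is a multiple of that of h, so
    e = 1. *)
Lemma fibre_irreducible c : (size (fibre_factors c) <= 1)%N -> irreducible (h - c%:MP).
Proof.
move=> s1; have := fibre_factors_gt0 c; have hc0 := sub_const_neq0 c sh.
have [qI qU qN [a [d [a0 d0 E]]]] := irr_factorization_exists hc0.
rewrite -/(fibre_factors c) in qI d0 E; move: s1; case: (fibre_factors c) qI d0 E => [|q [|//]] // qI d0 E _ _.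
have qq : irreducible q by apply: qI; rewrite mem_head.
have dq : (0 < d q)%N by apply: d0; rewrite mem_head.
rewrite big_seq1 in E.
have q0 : q != 0 by have [] := qq.
have [H HE] : exists H, q = mpoly_at h H.
  apply: hP; exists ('X^(d q) - (a^-1 *: ('X - c%:P))%:P).
    by apply: monic_sub_const; rewrite ?size_polyXn ?monicXn.
  apply/rootP; rewrite rmorphB rmorphXn /= map_polyX map_polyC hornerD hornerN hornerXn hornerC.
  rewrite -mul_polyC /= rmorphM rmorphB /= mpoly_atX !mpoly_atC E -mul_mpolyC mulrA -mpolyCM mulVf //.
  by rewrite mul1r subrr.
have H0 : H != 0 by apply: contra_neq q0 => H0; rewrite HE H0 rmorph0.
have [_ dE] := mdegree_mpoly_at sh H0; rewrite -HE in dE.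
have := mdegree_sub_const c sh; rewrite E mdegreeZ // mdegreeX // dE.
have d1 : (0 < mdegree h)%N by rewrite /mdegree -ltnS prednK // ltnW.
move/eqP; rewrite mulnA -[eqbRHS]mul1n eqn_pmul2r // muln_eq1 => /andP[/eqP -> _].
by rewrite expr1; apply: irreducibleZ.
Qed.

End TotalReducibility.

(** * Fibres of f = F(h) *)
Lemma bounded_enumeration (T : eqType) (P : T -> Prop) (N : nat) :
  (forall s, uniq s -> {in s, forall x, P x} -> (size s < N)%N) ->
  exists s, [/\ uniq s, forall x, P x <-> x \in s & (size s < N)%N].
Proof.
move=> bound.
pose good m := `[< exists s, [/\ uniq s, {in s, forall x, P x} & size s = m] >].
have good0 : exists m, good m by exists 0%N; apply/asboolP; exists [::].
have goodN m : good m -> (m <= N)%N.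
  by move=> /asboolP[s [sU sP <-]]; apply/ltnW/bound.
have [m /asboolP[s [sU sP sm]] mmax] := ex_maxnP good0 goodN.
exists s; split=> //; last exact: bound.
move=> x; split=> [Px|/sP//]; apply: contraT => xs.
have : (size (x :: s) <= m)%N.
  apply: mmax; apply/asboolP; exists (x :: s); split=> //; first by rewrite /= xs.
  by move=> y; rewrite inE => /predU1P[->|/sP].
by rewrite /= sm ltnn.
Qed.

Section Fibres.
Variables (K : closedFieldType) (n : nat) (h : {mpoly K[n.+1]}) (v : 'I_n.+1 -> K).
Hypotheses (sh : (1 < msize h)%N) (hP : closed_pencil h) (vy : v ord_max != 0).
Hypotheses (GM : to_poly v h \is monic) (sG : size (to_poly v h) = msize h).
Variables (F : {poly K}).
Hypothesis sF : (1 < size F)%N.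
Local Notation R := {mpoly K[n.+1]}.
Let f : R := mpoly_at h F.

Definition shift_roots (mu : K) : seq K := sval (closed_field_poly_normal (F + mu%:P)).

Lemma lead_shift mu : lead_coef (F + mu%:P) = lead_coef F.
Proof. by rewrite lead_coefDl // (leq_ltn_trans (size_polyC_leq1 _)). Qed.

Lemma shift_rootsE mu :
  F + mu%:P = lead_coef F *: \prod_(r <- shift_roots mu) ('X - r%:P).
Proof. by rewrite /shift_roots -(lead_shift mu); case: closed_field_poly_normal. Qed.

Lemma leadF_neq0 : lead_coef F != 0.
Proof. by rewrite lead_coef_eq0 -size_poly_gt0 ltnW. Qed.

Lemma size_shift_roots mu : size (shift_roots mu) = (size F).-1.
Proof.
have -> : size F = size (F + mu%:P).
  by rewrite size_polyDl // (leq_ltn_trans (size_polyC_leq1 _)).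
by rewrite shift_rootsE size_scale ?leadF_neq0 // size_prod_XsubC.
Qed.

Lemma mem_shift_roots mu c : (c \in shift_roots mu) = (F.[c] == - mu).
Proof.
rewrite -root_prod_XsubC -(@rootZ _ _ (lead_coef F)) ?leadF_neq0 // -shift_rootsE.
by rewrite /root !hornerE addr_eq0.
Qed.

Lemma fibre_product mu :
  f + mu%:MP = lead_coef F *: \prod_(r <- shift_roots mu) (h - r%:MP).
Proof.
have -> : f + mu%:MP = mpoly_at h (F + mu%:P) by rewrite rmorphD /= mpoly_atC.
by rewrite -(lead_shift mu); apply: mpoly_at_roots; rewrite lead_shift -shift_rootsE.
Qed.

Lemma fibre_neq0 mu : f + mu%:MP != 0.
Proof.
rewrite fibre_product scaler_eq0 negb_or leadF_neq0 /=.
have [] // := @mdegree_prod K n.+1 _ (shift_roots mu) (fun r => h - r%:MP)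
  (fun r _ => sub_const_neq0 r sh).
Qed.

Lemma fibre_prime_factor mu q : irreducible q -> divides q (f + mu%:MP) ->
  exists2 c, c \in shift_roots mu & divides q (h - c%:MP).
Proof.
move=> qI; have qP := irreducible_prime qI; have [_ /negP qU qD] := qP.
rewrite fibre_product -mul_mpolyC => /qD[[x xE]|]; last exact: prime_prod.
case: qU; have := nzscalar_unit n.+1 leadF_neq0.
by rewrite xE unitrM => /andP[].
Qed.

Lemma fibre_factor_divides mu c : c \in shift_roots mu -> divides (h - c%:MP) (f + mu%:MP).
Proof.
move=> cr; rewrite fibre_product (big_rem _ cr) /=; set y := \prod_(_ <- _) _.
by exists (lead_coef F *: y); rewrite -scalerAl mulrC.
Qed.

Lemma nfactors_le mu :
  (nfactors mu f <= \sum_(c <- undup (shift_roots mu)) size (fibre_factors h c))%N.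
Proof.
have [qI qU qN _] := irr_factorization_exists (fibre_neq0 mu).
pose rs := flatten [seq fibre_factors h c | c <- undup (shift_roots mu)].
have -> : (\sum_(c <- undup (shift_roots mu)) size (fibre_factors h c))%N = size rs.
  by rewrite /rs size_flatten /shape -map_comp sumnE big_map.
apply: (factor_inject qU qN _).1 => q qf.
have qq := qI _ qf; have qd := irr_factors_divides (fibre_neq0 mu) qf.
have [c cr qc] := fibre_prime_factor qq qd.
have [r rc qr] := irr_factors_complete (sub_const_neq0 c sh) qq qc.
exists r => //; apply/flatten_mapP; exists c; rewrite ?mem_undup //.
Qed.

(** The prime factors of h - c are among those of f + mu. *)
Lemma sfactors_ge mu c : c \in shift_roots mu ->
  (\sum_(q <- fibre_factors h c) mdegree q <= sfactors mu f)%N.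
Proof.
move=> cr; apply: factor_le; first exact: sub_const_neq0.
  exact: fibre_neq0.
exact: fibre_factor_divides.
Qed.

(** Each reducible fibre contributes at least 1 to the sum bounded by
    [total_reducibility_bound]. *)
Lemma reducible_fibres_finite : exists cs : seq K,
  [/\ uniq cs, forall c, (1 < size (fibre_factors h c))%N <-> c \in cs & (size cs < mdegree h)%N].
Proof.
apply: (@bounded_enumeration _ (fun c => (1 < size (fibre_factors h c))%N)) => -[_ _|c s] /=.
  by rewrite /mdegree -ltnS prednK // ltnW.
move=> sU sP; apply: leq_trans (_ : _ < \sum_(q <- fibre_factors h c) mdegree q)%N _.
  apply: leq_ltn_trans _ (total_reducibility_bound sh hP vy GM sG (cs := c :: s) c sU).
  rewrite -[(size s).+1]/(size (c :: s)) -sum1_size.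
  rewrite [leqLHS]big_seq [leqRHS]big_seq; apply: leq_sum => x xs.
  by have := sP x xs; case: (size _) => [|[]].
by rewrite (leq_trans (sum_irr_factors_le (sub_const_neq0 c sh))) // mdegree_sub_const.
Qed.

(** The summand of index mu in the sum over all fibres, as deg f = deg F * deg h. *)
Definition defect (mu : K) : rat := (nfactors mu f)%:R - (size F).-1%:R.

(** f + mu has at most as many prime factors as the h - c together, c ranging over
    the distinct roots of F + mu, and these roots are at most deg F. *)
Lemma defect_le mu :
  defect mu <= (\sum_(c <- undup (shift_roots mu)) (size (fibre_factors h c)).-1)%N%:R.
Proof.
have e : (\sum_(c <- undup (shift_roots mu)) size (fibre_factors h c) =
   \sum_(c <- undup (shift_roots mu)) (size (fibre_factors h c)).-1 + size (undup (shift_roots mu)))%N.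
  rewrite -sum1_size -big_split /=; apply: eq_bigr => c _.
  by rewrite addn1 prednK // fibre_factors_gt0.
have := nfactors_le mu; rewrite e.
have := size_undup (shift_roots mu); rewrite size_shift_roots /defect.
rewrite lerBlDr -natrD ler_nat => le1 le2; apply: leq_trans le2 _.
by rewrite leq_add2l.
Qed.

(** The sets of roots of F + mu are disjoint for different mu. *)
Lemma defect_sum_lt (mus : seq K) (c0 : K) : uniq mus ->
  \sum_(mu <- mus) defect mu < (\sum_(q <- fibre_factors h c0) mdegree q)%N%:R.
Proof.
move=> musU; pose cs := flatten [seq undup (shift_roots mu) | mu <- mus].
have csU : uniq cs.
  rewrite /cs; elim: mus musU {cs} => // mu s IH /= /andP[mus sU].
  rewrite cat_uniq undup_uniq IH // andbT; apply/hasPn => c /flatten_mapP[nu nus].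
  rewrite /= !mem_undup !mem_shift_roots => /eqP ->; rewrite eqr_opp.
  by apply: contraNneq mus => <-.
apply: (@le_lt_trans _ _ (\sum_(c <- cs) (size (fibre_factors h c)).-1)%N%:R); last first.
  by rewrite ltr_nat; apply: (total_reducibility_bound sh hP vy GM sG c0 csU).
rewrite /cs big_flatten big_map natr_sum; apply: ler_sum => mu _; exact: defect_le.
Qed.

End Fibres.

Theorem theorem3 (K : closedFieldType) (n : nat) (f : {mpoly K[n]})
    (hf : ~ is_scalar f) :
  exists (E : {fset K}) (d : nat),
    [/\ (#|` E| < mdegree f)%N,
        (0 < d)%N,
        (* (1) and (2) *)
        exists fac : K -> seq {mpoly K[n]},
          [/\ forall mu : K, mu \notin E ->
                [/\ (0 < size (fac mu))%N,
                    exists2 alpha : K, alpha != 0 &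
                      f + mu%:MP = alpha *: \prod_(g <- fac mu) g,
                    {in fac mu, forall g, irreducible g} &
                    {in fac mu &, forall g h, is_scalar (g - h)}],
              forall mu nu : K, mu \notin E -> nu \notin E -> nu != mu ->
                {in fac mu & fac nu, forall g h, is_nzscalar (g - h)} &
              forall mu : K, mu \notin E ->
                {in fac mu, forall g, mdegree g = d}],
        (* (3) *)
        forall (mu : K) (q r : {mpoly K[n]}),
          irreducible q -> f + mu%:MP = q * r -> (mdegree q <= d)%N &
        (* (4) *)
        let term (mu : K) : rat :=
          (nfactors mu f)%:R - (mdegree f)%:R / d%:R in
        finite_set [set mu : K | 0 < term mu] /\
        (sum_ninfty term <
           EFin ((min_sfactors f)%:R : rat))%O].
Proof.
case: n f hf => [|n] f hf.
  by case: hf; exists f@_0; apply: mpoly0_const.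
have [h [F [v [[sh F0] fE hP vy [GM sG]]]]] := monic_pencil_generator hf.
have sF : (1 < size F)%N.
  rewrite ltnNge; apply/negP => /size1_polyC FC; apply: hf.
  by exists F`_0; rewrite fE [in LHS]FC mpoly_atC.
rewrite {f hf}fE.
have [cs [csU csP scs]] := reducible_fibres_finite sh hP vy GM sG.
have d0 : (0 < mdegree h)%N by apply: leq_ltn_trans scs.
have [_ df] := mdegree_mpoly_at sh F0.
have sF1 : (0 < (size F).-1)%N by rewrite -ltnS prednK // ltnW.
pose E := [fset mu in map (fun c => - F.[c]) cs]%fset.
have EP mu c : mu \notin E -> c \in shift_roots F mu -> (size (fibre_factors h c) <= 1)%N.
  move=> muE; rewrite (mem_shift_roots sF) => /eqP Fc; rewrite leqNgt.
  apply: contra muE => /csP ccs; rewrite inE; apply/mapP; exists c => //.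
  by rewrite Fc opprK.
have diffE c c' : (h - c%:MP) - (h - c'%:MP) = (c' - c)%:MP.
  by rewrite mpolyCB; ring.
exists E, (mdegree h); split=> //.
- rewrite card_fseq (leq_ltn_trans (size_undup _)) // size_map (leq_trans scs) //.
  by rewrite df leq_pmull.
- exists (fun mu => [seq h - c%:MP | c <- shift_roots F mu]); split.
  + move=> mu muE; split.
    * by rewrite size_map (size_shift_roots sF).
    * exists (lead_coef F); first exact: leadF_neq0 sF.
      by rewrite (fibre_product _ sF) big_map.
    * by move=> _ /mapP[c cr ->]; apply: (fibre_irreducible sh hP); apply: EP muE cr.
    by move=> _ _ /mapP[c cr ->] /mapP[c' cr' ->]; exists (c' - c).
  + move=> mu nu muE nuE ne _ _ /mapP[c cr ->] /mapP[c' cr' ->]; exists (c' - c) => //.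
    rewrite subr_eq0; apply: contraNneq ne => cc'; move: cr cr'.
    rewrite cc' !(mem_shift_roots sF) => /eqP -> /eqP/oppr_inj ->; exact: eqxx.
  by move=> mu muE _ /mapP[c cr ->]; apply: mdegree_sub_const.
- move=> mu q r qI E'; have [|c cr [x xE]] := fibre_prime_factor (h := h) sF (mu := mu) qI.
    by exists r; rewrite E' mulrC.
  have := sub_const_neq0 c sh; rewrite -(mdegree_sub_const c sh) xE mulf_eq0 negb_or.
  by case/andP=> x0 q0; rewrite mdegreeM // leq_addl.
move=> term.
have termE mu : term mu = defect h F mu.
  rewrite /term /defect df natrM mulfK // pnatr_eq0 -lt0n //.
split.
  apply: (@sub_finite_set _ _ [set` map (fun c => - F.[c]) cs]); last exact: finite_seq.
  move=> mu /=; rewrite termE => mu0; apply: contrapT => muE.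
  have : defect h F mu <= 0; last by rewrite leNgt mu0.
  apply: le_trans (defect_le sh sF mu) _; rewrite big_seq big1 // => c.
  rewrite mem_undup => cr; have : (size (fibre_factors h c) <= 1)%N.
    apply: EP cr; rewrite inE; exact/negP.
  by case: (size _) => [|[]].
have [mu0 mu0E] : exists mu0, sfactors mu0 (mpoly_at h F) = min_sfactors (mpoly_at h F).
  by rewrite /min_sfactors; case: ex_minnP => m /asboolP.
have [c0 c0r] : exists c0, c0 \in shift_roots F mu0.
  by move: sF1; rewrite -(size_shift_roots sF mu0); case: (shift_roots F mu0) => // c s _; exists c; rewrite mem_head.
rewrite /sum_ninfty; case: ifP => _; last exact: ltNyr.
rewrite lte_fin; under eq_fsbigr => mu _ do rewrite termE.
apply: lt_le_trans (defect_sum_lt sh hP vy GM sG sF c0 (finite_support_uniq _ _ _)) _.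
by rewrite ler_nat -mu0E; apply: (sfactors_ge sh sF).
Qed.
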